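(* Let $R$ be a ring, $\mathbb{C}$ a class of pure injective $R$-left-modules, $\mathbb{B}$ a class of $R$-right-modules, and $\mathbb{A}$ a class of finitely presented $R$-left-modules. (i) The classes ${}^{\perp}\mathbb{C}$ and $\operatorname{Ker}\operatorname{Tor}_1(\mathbb{B},-)$ are covering. If $R$ is left-coherent, then the classes $\mathbb{A}^{\perp} \cap {}^{\perp}\mathbb{C}$ and $\mathbb{A}^{\perp} \cap \operatorname{Ker}\operatorname{Tor}_1(\mathbb{B},-)$ are covering. (ii) The class $\operatorname{Ker}\operatorname{Tor}_1(\mathbb{B},-)$ is the first half of a perfect cotorsion pair. If $R$ is left-coherent and $R$ (as an $R$-left-module) is contained in $\mathbb{A}^{\perp}$, then the class $\mathbb{A}^{\perp} \cap \operatorname{Ker}\operatorname{Tor}_1(\mathbb{B},-)$ is the first half of a perfect cotorsion pair. (iii) The class $\mathbb{A}^{\perp}$ is preenveloping. If $R$ is right-coherent and $\mathbb{B}$ consists of finitely presented modules, then the class $\mathbb{A}^{\perp} \cap \operatorname{Ker}\operatorname{Tor}_1(\mathbb{B},-)$ is preenveloping.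
   Context: $R$ is a ring; classes of modules are closed under isomorphisms. Notation: $\mathbb{A}^{\perp} = \{ N \mid \operatorname{Ext}^1_R(A,N) = 0 \text{ for all } A \in \mathbb{A}\}$, ${}^{\perp}\mathbb{C} = \{ M \mid \operatorname{Ext}^1_R(M,C) = 0 \text{ for all } C \in \mathbb{C}\}$, and $\operatorname{Ker}\operatorname{Tor}_1(\mathbb{B},-) = \{ M \mid \operatorname{Tor}^R_1(B,M) = 0 \text{ for all } B \in \mathbb{B}\}$; these are classes of $R$-left-modules. A short exact sequence of $R$-left-modules is pure exact if it stays exact when tensored with any $R$-right-module; a module $C$ is pure injective if $\operatorname{Hom}_R(-,C)$ sends pure exact sequences to exact sequences. For a class $\mathbb{F}$ of $R$-left-modules, an $\mathbb{F}$-precover of an $R$-left-module $M$ is a homomorphism $F \to M$ with $F$ in $\mathbb{F}$ such that each homomorphism $F' \to M$ with $F'$ in $\mathbb{F}$ factors as $F' \to F \to M$. An $\mathbb{F}$-cover of $M$ is an $\mathbb{F}$-precover $F \to M$ such that each endomorphism $F \to F$ for which the composite $F \to F \to M$ equals $F \to M$ is an automorphism. $\mathbb{F}$ is covering if each $R$-left-module has an $\mathbb{F}$-cover. Dually, a $\mathbb{G}$-preenvelope of $N$ is a homomorphism $N \to G$ with $G$ in $\mathbb{G}$ such that each homomorphism $N \to G'$ with $G'$ in $\mathbb{G}$ factors as $N \to G \to G'$; it is a $\mathbb{G}$-envelope if each endomorphism $G \to G$ for which $N \to G \to G$ equals $N \to G$ is an automorphism. $\mathbb{G}$ is preenveloping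 (respectively enveloping) if each $R$-left-module has a $\mathbb{G}$-preenvelope (respectively a $\mathbb{G}$-envelope). A pair $(\mathbb{F},\mathbb{G})$ of classes of $R$-left-modules is a cotorsion pair if $\mathbb{F}^{\perp} = \mathbb{G}$ and $\mathbb{F} = {}^{\perp}\mathbb{G}$; it is perfect if $\mathbb{F}$ is covering and $\mathbb{G}$ is enveloping. The first half of the pair $(\mathbb{F},\mathbb{G})$ is $\mathbb{F}$. *)

(* Defs.v *)
From HB Require Import structures.
From mathcomp Require Import all_boot all_order all_algebra.
From mathcomp Require Import boolp.

Set Implicit Arguments.
Unset Strict Implicit.
Unset Printing Implicit Defensive.

Import GRing.Theory.
Local Open Scope ring_scope.
Local Open Scope quotient_scope.

(* Rings are associative and unital, possibly zero and noncommutative: they are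
   pzRingTypes.  A left R-module is an [lmodType R]; a right R-module is an
   [lmodType R^c] over the converse ring, so that [r *: b] there is b r. *)

Definition exact (U V W : zmodType) (f : U -> V) (g : V -> W) : Prop :=
  forall v, g v = 0 <-> exists u, f u = v.

Definition surjection (U V : Type) (f : U -> V) : Prop :=
  forall v, exists u, f u = v.

Definition short_exact (U V W : zmodType) (f : U -> V) (g : V -> W) : Prop :=
  [/\ injective f, exact f g & surjection g].

Section Tensor.
Variable R : pzRingType.

Section TensorProduct.
Variables (B : lmodType R^c) (M : lmodType R).

(* The sequence [:: (b1, m1); ...; (bn, mn)] stands for the formal sum
   b1 (x) m1 + ... + bn (x) mn, and [tensor_eq] is the congruence generated by
   the defining relations of B (x)_R M.  No formal opposites are needed, since
   (-b) (x) m is opposite to b (x) m. *)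
Inductive tensor_eq : seq (B * M) -> seq (B * M) -> Prop :=
| tensor_eq_refl s : tensor_eq s s
| tensor_eq_sym s t : tensor_eq s t -> tensor_eq t s
| tensor_eq_trans s t u : tensor_eq s t -> tensor_eq t u -> tensor_eq s u
| tensor_eq_cat s s' t t' :
    tensor_eq s s' -> tensor_eq t t' -> tensor_eq (s ++ t) (s' ++ t')
| tensor_eq_catC s t : tensor_eq (s ++ t) (t ++ s)
| tensor_eq_0l m : tensor_eq [:: (0, m)] [::]
| tensor_eq_Dl b b' m : tensor_eq [:: (b + b', m)] [:: (b, m); (b', m)]
| tensor_eq_Dr b m m' : tensor_eq [:: (b, m + m')] [:: (b, m); (b, m')]
| tensor_eq_Z (r : R) b m :
    tensor_eq [:: ((r : R^c) *: b, m)] [:: (b, r *: m)].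

Definition tensor_eqb (s t : seq (B * M)) : bool := `[< tensor_eq s t >].

Lemma tensor_eqb_refl : reflexive tensor_eqb.
Proof. by move=> s; apply/asboolP; exact: tensor_eq_refl. Qed.

Lemma tensor_eqb_sym : symmetric tensor_eqb.
Proof. by move=> s t; apply/asboolP/asboolP; exact: tensor_eq_sym. Qed.

Lemma tensor_eqb_trans : transitive tensor_eqb.
Proof.
move=> t s u /asboolP st /asboolP tu; apply/asboolP.
exact: tensor_eq_trans st tu.
Qed.

Canonical tensor_equiv :=
  EquivRel tensor_eqb tensor_eqb_refl tensor_eqb_sym tensor_eqb_trans.

Definition tensor : Type := {eq_quot tensor_equiv}.
HB.instance Definition _ := Choice.on tensor.
HB.instance Definition _ := Quotient.on tensor.

Definition tclass (s : seq (B * M)) : tensor := \pi_tensor s.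

Lemma tclassP s t : tclass s = tclass t <-> tensor_eq s t.
Proof. by split=> [/eqmodP/asboolP|st]; last by apply/eqmodP/asboolP. Qed.

Lemma tclass_repr x : tclass (repr x) = x.
Proof. exact: reprK. Qed.

Lemma tensor_eq_repr s : tensor_eq (repr (tclass s)) s.
Proof. by apply/tclassP; rewrite tclass_repr. Qed.

Definition tensor_add (x y : tensor) : tensor := tclass (repr x ++ repr y).

Definition fopp (s : seq (B * M)) := [seq (- p.1, p.2) | p <- s].

Definition tensor_opp (x : tensor) : tensor := tclass (fopp (repr x)).

Lemma tclass_cat s t : tclass (s ++ t) = tensor_add (tclass s) (tclass t).
Proof. by apply/tclassP/tensor_eq_sym/tensor_eq_cat; exact: tensor_eq_repr. Qed.

Lemma tensor_ind (P : tensor -> Prop) : (forall s, P (tclass s)) -> forall x, P x.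
Proof. by move=> Ps x; rewrite -(tclass_repr x). Qed.

Lemma tensor_addA : associative tensor_add.
Proof.
elim/tensor_ind=> s; elim/tensor_ind=> t; elim/tensor_ind=> u.
by rewrite -!tclass_cat catA.
Qed.

Lemma tensor_addC : commutative tensor_add.
Proof.
elim/tensor_ind=> s; elim/tensor_ind=> t; rewrite -!tclass_cat.
by apply/tclassP/tensor_eq_catC.
Qed.

Lemma tensor_add0 : left_id (tclass [::]) tensor_add.
Proof. by elim/tensor_ind=> s; rewrite -tclass_cat. Qed.

Lemma tensor_addN : left_inverse (tclass [::]) tensor_opp tensor_add.
Proof.
move=> x; rewrite -[x in tensor_add _ x]tclass_repr /tensor_opp.
elim: (repr x) => [|[b m] s IHs]; first by rewrite -tclass_cat.
rewrite /= -cat1s tclass_cat -[(b, m) :: s]cat1s tclass_cat -tensor_addA.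
rewrite [X in tensor_add _ X]tensor_addA [X in tensor_add X (tclass s)]tensor_addC.
rewrite -[X in tensor_add _ X]tensor_addA IHs tensor_addA -tclass_cat tensor_addC.
rewrite tensor_add0; apply/tclassP.
apply: tensor_eq_trans (tensor_eq_0l m); rewrite -(addNr b).
exact/tensor_eq_sym/tensor_eq_Dl.
Qed.

HB.instance Definition _ := GRing.isZmodule.Build tensor
  tensor_addA tensor_addC tensor_add0 tensor_addN.

Definition tens (b : B) (m : M) : tensor := tclass [:: (b, m)].

Lemma tclassE s : tclass s = \sum_(p <- s) tens p.1 p.2.
Proof.
elim: s => [|[b m] s IHs]; first by rewrite big_nil.
by rewrite big_cons -IHs -cat1s tclass_cat.
Qed.

Definition balanced (G : zmodType) (f : B -> M -> G) : Prop :=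
  [/\ forall b b' m, f (b + b') m = f b m + f b' m,
      forall b m m', f b (m + m') = f b m + f b m'
    & forall (r : R) b m, f ((r : R^c) *: b) m = f b (r *: m)].

Lemma tens_balanced : balanced tens.
Proof.
split=> [b b' m|b m m'|r b m]; last exact/tclassP/tensor_eq_Z.
- by rewrite -[RHS]tclass_cat; apply/tclassP/tensor_eq_Dl.
- by rewrite -[RHS]tclass_cat; apply/tclassP/tensor_eq_Dr.
Qed.

Definition tensor_lift (G : zmodType) (f : B -> M -> G) (x : tensor) : G :=
  \sum_(p <- repr x) f p.1 p.2.

Section Lift.
Variables (G : zmodType) (f : B -> M -> G).
Hypothesis f_bal : balanced f.

Lemma tensor_lift_class s : tensor_lift f (tclass s) = \sum_(p <- s) f p.1 p.2.
Proof.
have [fDl fDr fZ] := f_bal.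
have f0 m : f 0 m = 0 by apply: (addIr (f 0 m)); rewrite -fDl !add0r.
rewrite /tensor_lift; move: (repr _) (tensor_eq_repr s) => s0.
elim=> {s0 s} //=; first by move=> s t u _ -> _ ->.
- by move=> s s' t t' _ IHs _ IHt; rewrite !big_cat IHs IHt.
- by move=> s t; rewrite !big_cat /= addrC.
- by move=> m; rewrite big_seq1 big_nil f0.
- by move=> b b' m; rewrite big_seq1 big_cons big_seq1 fDl.
- by move=> b m m'; rewrite big_seq1 big_cons big_seq1 fDr.
- by move=> r b m; rewrite !big_seq1 fZ.
Qed.

Lemma tensor_liftE b m : tensor_lift f (tens b m) = f b m.
Proof. by rewrite tensor_lift_class big_seq1. Qed.

Lemma tensor_liftD : {morph tensor_lift f : x y / x + y}.
Proof.
elim/tensor_ind=> s; elim/tensor_ind=> t.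
by rewrite -[_ + _]tclass_cat !tensor_lift_class big_cat.
Qed.

End Lift.
End TensorProduct.

(* The homomorphism B (x) g. *)
Definition tensor_map (B : lmodType R^c) (M N : lmodType R) (g : {linear M -> N}) :
    tensor B M -> tensor B N :=
  tensor_lift (fun b m => tens b (g m)).

Section TensorMap.
Variables (B : lmodType R^c) (M N : lmodType R) (g : {linear M -> N}).

Lemma tensor_map_balanced :
  balanced (fun (b : B) (m : M) => tens b (g m)).
Proof.
have [tDl tDr tZ] := tens_balanced B N.
by split=> *; rewrite ?linearD ?linearZ ?tDl ?tDr ?tZ.
Qed.

Lemma tensor_mapE (b : B) m : tensor_map g (tens b m) = tens b (g m).
Proof. exact: tensor_liftE tensor_map_balanced _ _. Qed.

Lemma tensor_mapD : {morph @tensor_map B _ _ g : x y / x + y}.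
Proof. exact: tensor_liftD tensor_map_balanced. Qed.

End TensorMap.
End Tensor.

Section Modules.
Variable R : pzRingType.
Implicit Types M N P : lmodType R.

Definition finitely_generated M : Prop :=
  exists n (p : {linear 'rV[R]_n -> M}), surjection p.

Definition finitely_presented M : Prop :=
  exists m n (q : {linear 'rV[R]_m -> 'rV[R]_n}) (p : {linear 'rV[R]_n -> M}),
    exact q p /\ surjection p.

Definition isomorphic M N : Prop := exists f : {linear M -> N}, bijective f.

Definition iso_closed (X : lmodType R -> Prop) : Prop :=
  forall M N, isomorphic M N -> X M -> X N.

Definition projective P : Prop :=
  forall (M N : lmodType R) (p : {linear M -> N}) (f : {linear P -> N}),
    surjection p -> exists g : {linear P -> M}, forall x, p (g x) = f x.

(* ... -> P_2 -> P_1 -> P_0 -> M -> 0, with [res_diff n] from P_(n+1) to P_n.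
   Every module has such a resolution, by free modules, and the homology groups
   used below do not depend on its choice. *)
Record projective_resolution M := ProjectiveResolution {
  res_obj :> nat -> lmodType R;
  res_diff : forall n, {linear res_obj n.+1 -> res_obj n};
  res_aug : {linear res_obj 0 -> M};
  res_projective : forall n, projective (res_obj n);
  res_exact : forall n, exact (res_diff n.+1) (res_diff n);
  res_exact0 : exact (res_diff 0) res_aug;
  res_aug_surj : surjection res_aug
}.

(* Ext^1_R(M, N) = 0: the complex Hom(P_0, N) -> Hom(P_1, N) -> Hom(P_2, N) has
   no homology in the middle, for P a projective resolution of M. *)
Definition Ext1_vanishes M N : Prop :=
  forall (P : projective_resolution M) (f : {linear P 1 -> N}),
    (forall x, f (res_diff P 1 x) = 0) <->
    (exists g : {linear P 0 -> N}, forall x, g (res_diff P 0 x) = f x).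

(* Tor_1^R(B, M) = 0: the complex B (x) P_2 -> B (x) P_1 -> B (x) P_0 has no
   homology in the middle, for P a projective resolution of M. *)
Definition Tor1_vanishes (B : lmodType R^c) M : Prop :=
  forall P : projective_resolution M,
    exact (@tensor_map R B _ _ (res_diff P 1)) (@tensor_map R B _ _ (res_diff P 0)).

Definition pure_exact (L M N : lmodType R)
    (i : {linear L -> M}) (p : {linear M -> N}) : Prop :=
  short_exact i p /\
  forall B : lmodType R^c,
    short_exact (@tensor_map R B _ _ i) (@tensor_map R B _ _ p).

(* For i : L -> M and p : M -> N pure exact, the sequence
   0 -> Hom(N, E) -> Hom(M, E) -> Hom(L, E) -> 0 is exact. *)
Definition pure_injective (E : lmodType R) : Prop :=
  forall (L M N : lmodType R) (i : {linear L -> M}) (p : {linear M -> N}),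
    pure_exact i p ->
    [/\ forall g h : {linear N -> E}, g \o p =1 h \o p -> g =1 h,
        forall f : {linear M -> E},
          f \o i =1 (fun _ => 0) <-> exists g : {linear N -> E}, g \o p =1 f
      & forall f : {linear L -> E}, exists g : {linear M -> E}, g \o i =1 f].

Definition right_perp (X : lmodType R -> Prop) : lmodType R -> Prop :=
  fun N => forall M, X M -> Ext1_vanishes M N.

Definition left_perp (X : lmodType R -> Prop) : lmodType R -> Prop :=
  fun M => forall N, X N -> Ext1_vanishes M N.

Definition KerTor1 (X : lmodType R^c -> Prop) : lmodType R -> Prop :=
  fun M => forall B, X B -> Tor1_vanishes B M.

Definition classI (X Y : lmodType R -> Prop) : lmodType R -> Prop :=
  fun M => X M /\ Y M.

Definition class_eq (X Y : lmodType R -> Prop) : Prop := forall M, X M <-> Y M.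

Definition precover (X : lmodType R -> Prop) (F M : lmodType R)
    (f : {linear F -> M}) : Prop :=
  X F /\
  forall (F' : lmodType R) (f' : {linear F' -> M}), X F' ->
    exists h : {linear F' -> F}, f \o h =1 f'.

Definition cover (X : lmodType R -> Prop) (F M : lmodType R)
    (f : {linear F -> M}) : Prop :=
  precover X f /\
  forall e : {linear F -> F}, f \o e =1 f -> bijective e.

Definition covering (X : lmodType R -> Prop) : Prop :=
  forall M, exists (F : lmodType R) (f : {linear F -> M}), cover X f.

Definition preenvelope (Y : lmodType R -> Prop) (N G : lmodType R)
    (f : {linear N -> G}) : Prop :=
  Y G /\
  forall (G' : lmodType R) (f' : {linear N -> G'}), Y G' ->
    exists h : {linear G -> G'}, h \o f =1 f'.

Definition envelope (Y : lmodType R -> Prop) (N G : lmodType R)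
    (f : {linear N -> G}) : Prop :=
  preenvelope Y f /\
  forall e : {linear G -> G}, e \o f =1 f -> bijective e.

Definition preenveloping (Y : lmodType R -> Prop) : Prop :=
  forall N, exists (G : lmodType R) (f : {linear N -> G}), preenvelope Y f.

Definition enveloping (Y : lmodType R -> Prop) : Prop :=
  forall N, exists (G : lmodType R) (f : {linear N -> G}), envelope Y f.

Definition cotorsion_pair (X Y : lmodType R -> Prop) : Prop :=
  class_eq (right_perp X) Y /\ class_eq X (left_perp Y).

Definition perfect_cotorsion_pair (X Y : lmodType R -> Prop) : Prop :=
  [/\ cotorsion_pair X Y, covering X & enveloping Y].

Definition first_half_of_perfect_cotorsion_pair (X : lmodType R -> Prop) : Prop :=
  exists2 Y : lmodType R -> Prop, iso_closed Y & perfect_cotorsion_pair X Y.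

End Modules.

(* Every finitely generated left ideal is finitely presented; a left ideal is
   given as a module I with an injection into R. *)
Definition left_coherent (R : pzRingType) : Prop :=
  forall (I : lmodType R) (j : {linear I -> R^o}),
    injective j -> finitely_generated I -> finitely_presented I.

Definition right_coherent (R : pzRingType) : Prop := left_coherent R^c.

(* Main.v *)
From HB Require Import structures.
From mathcomp Require Import all_boot all_order all_algebra.
From mathcomp Require Import boolp.
Require Import Defs.

Set Implicit Arguments.
Unset Strict Implicit.
Unset Printing Implicit Defensive.

Import GRing.Theory.
Local Open Scope ring_scope.

(** Why the theorem holds.

    All the covers come from one principle: a class [X] closed under direct sums
    and pure quotients is covering ([covering_of_sums_pure_quotients]).  If [X] is
    moreover closed under extensions and contains the ring, it is the first half
    of a perfect cotorsion pair ([first_half_of_closed]).  A class closed under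
    products and pure submodules is preenveloping ([preenveloping_of_products]).
    The theorem is then a matter of closure properties.

    Covers and envelopes are handled at once.  Fix [c : N -> M] and consider the
    factorizations [N -> E -> M] of [c] in which [N -> E] is injective with
    cokernel in [X].  For [N = 0] they are the modules of [X] over [M]; for
    [M = 0] they are the extensions of modules of [X] by [N].  A factorization
    to which all others map, and whose endomorphisms are all bijective
    ([minimal_weakly_terminal]), is an [X]-cover of [M] in the first case; in the
    second case its middle term is orthogonal to [X], since an extension of it by
    a module of [X] is again a factorization and so retracts onto it, and it is
    therefore an envelope of [N] for the class orthogonal to [X].

    A weakly terminal factorization exists because only a set of factorizations
    matters ([weakly_terminal]).  This is the argument of Bican, El Bashir and
    Enochs.  Build in [E] a submodule [T] containing [N] that is saturated: every
    small configuration of elements of [E] has a copy in [T] with the same image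
    in [M] and the same linear relations with values in [T].  The size of [T] is
    bounded in terms of [R], [N] and [M].  If [x] lies outside [T], take a small
    family [f] containing [x] whose span is pure modulo [T], and a copy [f'] of it
    in [T].  The differences between combinations of [f] and the same combinations
    of [f'] form a nonzero submodule that dies in [M], meets [N] trivially and is
    pure, because [f - f'] restricts to a retraction onto it ([sat_eval_surj]).
    Dividing out a maximal submodule of that kind leaves a quotient no bigger
    than [T], whose cokernel is a pure quotient of the original one.

    A weakly terminal factorization [Z] is made minimal as Enochs does, through
    two applications of Zorn's lemma to factorizations equipped with generators
    indexed by a fixed set.  A chain of such objects has a colimit, and its
    cokernel stays in [X] because directed colimits are pure quotients of direct
    sums.  The first application makes every map to [Z] injective, the second
    makes every endomorphism surjective.

    Purity is used in the form: finitely many linear relations that hold in the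
    larger module can be realized by a mere function into the smaller one, fixing
    finitely many elements.  The derivation of an equality in a tensor product
    uses finitely many relations, so this notion implies purity for tensor
    products ([tensor_derivation], [pure_epi_exact]).

    Finally, the orthogonal of a class of finitely presented modules is closed
    under products and pure submodules, because extending a map from the finitely
    generated syzygy amounts to solving a finite linear system; when the ring is
    coherent the syzygy is itself finitely presented, which gives pure quotients
    ([coherent_kernel], [right_perp_pure_quotients]).  Likewise, if [B] has a
    presentation by free modules of finite rank of length two, the vanishing of
    Tor is the exactness of a sequence [M^r -> M^m -> M^n], which is inherited by
    products and pure submodules ([finite_Tor1P]). *)


(** * Formal linear combinations, linear maps and submodules *)

Lemma dep_choice (I : Type) (T : I -> Type) (P : forall i, T i -> Prop) :
  (forall i, exists x, P i x) -> exists f : forall i, T i, forall i, P i (f i).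
Proof.
by move=> PT; exists (fun i => sval (cid (PT i))) => i; exact: svalP (cid (PT i)).
Qed.

Section Combinations.
Variable R : pzRingType.

Definition lc (T : Type) (M : lmodType R) (phi : T -> M) (l : seq (R * T)) : M :=
  \sum_(x <- l) x.1 *: phi x.2.

Definition fscale (T : Type) (a : R) (l : seq (R * T)) : seq (R * T) :=
  [seq (a * x.1, x.2) | x <- l].

Definition fmap (T U : Type) (h : T -> U) (l : seq (R * T)) : seq (R * U) :=
  [seq (x.1, h x.2) | x <- l].

Definition supported (T : Type) (D : T -> Prop) (l : seq (R * T)) : Prop :=
  foldr (fun x P => D x.2 /\ P) True l.

Lemma lc_nil T (M : lmodType R) (phi : T -> M) : lc phi [::] = 0.
Proof. exact: big_nil. Qed.

Lemma lc_cons T (M : lmodType R) (phi : T -> M) x l :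
  lc phi (x :: l) = x.1 *: phi x.2 + lc phi l.
Proof. exact: big_cons. Qed.

Lemma lc1 T (M : lmodType R) (phi : T -> M) a t : lc phi [:: (a, t)] = a *: phi t.
Proof. by rewrite lc_cons lc_nil addr0. Qed.

Lemma lc_cat T (M : lmodType R) (phi : T -> M) l l' :
  lc phi (l ++ l') = lc phi l + lc phi l'.
Proof. exact: big_cat. Qed.

Lemma lc_scale T (M : lmodType R) (phi : T -> M) a l :
  lc phi (fscale a l) = a *: lc phi l.
Proof.
elim: l => [|x l IHl]; first by rewrite !lc_nil scaler0.
by rewrite [fscale _ _]/= !lc_cons IHl scalerDr scalerA.
Qed.

Lemma lc_map T U (M : lmodType R) (h : T -> U) (phi : U -> M) l :
  lc phi (fmap h l) = lc (phi \o h) l.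
Proof.
by elim: l => [|x l IHl]; rewrite ?lc_nil // [fmap _ _]/= !lc_cons IHl.
Qed.

Lemma lc_linear T (M N : lmodType R) (f : {linear M -> N}) (phi : T -> M) l :
  f (lc phi l) = lc (f \o phi) l.
Proof.
elim: l => [|x l IHl]; first by rewrite !lc_nil linear0.
by rewrite !lc_cons linearD linearZ IHl.
Qed.

Lemma eq_lc T (M : lmodType R) (phi psi : T -> M) l :
  phi =1 psi -> lc phi l = lc psi l.
Proof. by move=> e; apply: eq_bigr => x _; rewrite e. Qed.

Lemma eq_lc_supported T (M : lmodType R) (D : T -> Prop) (phi psi : T -> M) l :
  (forall t, D t -> phi t = psi t) -> supported D l -> lc phi l = lc psi l.
Proof.
move=> e; elim: l => [|x l IHl]; first by rewrite !lc_nil.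
by move=> [Dx Dl]; rewrite !lc_cons e // IHl.
Qed.

Lemma lcB T (M : lmodType R) (phi psi : T -> M) l :
  lc (fun t => phi t - psi t) l = lc phi l - lc psi l.
Proof.
elim: l => [|x l IHl]; first by rewrite !lc_nil subr0.
by rewrite !lc_cons IHl scalerBr opprD addrACA.
Qed.

Lemma lcD T (M : lmodType R) (phi psi : T -> M) l :
  lc (fun t => phi t + psi t) l = lc phi l + lc psi l.
Proof.
elim: l => [|x l IHl]; first by rewrite !lc_nil addr0.
by rewrite !lc_cons IHl scalerDr addrACA.
Qed.

Lemma supported_cat T (D : T -> Prop) (l l' : seq (R * T)) :
  supported D (l ++ l') <-> supported D l /\ supported D l'.
Proof. by elim: l => [|x l IHl] /=; tauto. Qed.

Lemma supported_scale T (D : T -> Prop) a (l : seq (R * T)) :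
  supported D l -> supported D (fscale a l).
Proof. by elim: l => [|x l IHl] //= [Dx /IHl]. Qed.

Lemma supported_imp T (D D' : T -> Prop) (l : seq (R * T)) :
  (forall t, D t -> D' t) -> supported D l -> supported D' l.
Proof. by move=> DD; elim: l => [|x l IHl] //= [/DD Dx /IHl]. Qed.

Lemma supported_all T (D : T -> Prop) (l : seq (R * T)) : (forall t, D t) -> supported D l.
Proof. by move=> DT; elim: l => [|x l IHl] //=; split. Qed.

Lemma supported_map T U (h : T -> U) (D : U -> Prop) (l : seq (R * T)) :
  (forall t, D (h t)) -> supported D (fmap h l).
Proof. by move=> Dh; elim: l => [|x l IHl] //=; split. Qed.

Definition linear_of (M N : lmodType R) (f : M -> N) (H : linear f)
  : {linear M -> N} :=
  HB.pack f (GRing.isLinear.Build R M N *:%R f H).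

Lemma linear_ofE (M N : lmodType R) (f : M -> N) (H : linear f) :
  linear_of H =1 f.
Proof. by []. Qed.

Lemma descend (L M N : lmodType R) (q : {linear L -> M}) (f : {linear L -> N}) :
  surjection q -> (forall x, q x = 0 -> f x = 0) ->
  exists g : {linear M -> N}, forall x, g (q x) = f x.
Proof.
move=> /choice[s qs] qf.
have fE x y : q x = q y -> f x = f y.
  by move=> e; apply/subr0_eq; rewrite -linearB qf // linearB e subrr.
have sP : linear (f \o s).
  by move=> a x y /=; rewrite -linearP; apply: fE; rewrite linearP !qs.
by exists (linear_of sP) => x; apply: fE; rewrite qs.
Qed.

Lemma corestrict (L M N : lmodType R) (i : {linear L -> M}) (f : {linear N -> M}) :
  injective i -> (forall x, exists y, i y = f x) ->
  exists g : {linear N -> L}, forall x, i (g x) = f x.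
Proof.
move=> i_inj /choice[s iS].
have sP : linear s by move=> a x y; apply: i_inj; rewrite linearP !iS linearP.
by exists (linear_of sP).
Qed.

Definition subm (M : lmodType R) (P : M -> Prop) : Prop :=
  P 0 /\ forall a x y, P x -> P y -> P (a *: x + y).

Lemma subm0 (M : lmodType R) (P : M -> Prop) : subm P -> P 0.
Proof. by case. Qed.

Lemma submP (M : lmodType R) (P : M -> Prop) a x y :
  subm P -> P x -> P y -> P (a *: x + y).
Proof. by case=> _; apply. Qed.

Lemma submZ (M : lmodType R) (P : M -> Prop) a x : subm P -> P x -> P (a *: x).
Proof. by move=> sP Px; rewrite -[_ *: _]addr0; apply: submP => //; exact: subm0. Qed.

Lemma submD (M : lmodType R) (P : M -> Prop) x y : subm P -> P x -> P y -> P (x + y).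
Proof. by move=> sP Px Py; rewrite -[x]scale1r; exact: submP. Qed.

Lemma submB (M : lmodType R) (P : M -> Prop) x y : subm P -> P x -> P y -> P (x - y).
Proof. by move=> sP Px Py; rewrite addrC -scaleN1r; exact: submP. Qed.

Lemma submN (M : lmodType R) (P : M -> Prop) x : subm P -> P x -> P (- x).
Proof. by move=> sP Px; rewrite -sub0r; apply: submB => //; exact: subm0. Qed.

Lemma subm_lc (M : lmodType R) (P : M -> Prop) T (phi : T -> M) l :
  subm P -> supported (P \o phi) l -> P (lc phi l).
Proof.
move=> sP; elim: l => [|x l IHl] /=; first by rewrite lc_nil => _; exact: subm0.
by move=> [Px /IHl Pl]; rewrite lc_cons; exact: submP.
Qed.

Lemma subm_ker (M N : lmodType R) (f : {linear M -> N}) : subm (fun x => f x = 0).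
Proof.
by split=> [|a x y fx fy]; rewrite ?linear0 // linearP fx fy scaler0 addr0.
Qed.

Lemma subm_im (M N : lmodType R) (f : {linear M -> N}) : subm (fun y => exists x, f x = y).
Proof.
split=> [|a _ _ [x <-] [y <-]]; first by exists 0; exact: linear0.
by exists (a *: x + y); exact: linearP.
Qed.

Lemma linear_inj (M N : lmodType R) (f : {linear M -> N}) :
  (forall x, f x = 0 -> x = 0) -> injective f.
Proof.
by move=> f0 x y e; apply/subr0_eq/f0; rewrite linearB e subrr.
Qed.

End Combinations.

(** * Modules presented by a set with operations modulo an equivalence *)

Section Setoid.
Variable R : pzRingType.

(** Working up to an equivalence relation, with the additive inverse given by
    scaling with [-1], lets the carrier be a type of formal expressions. *)
Record setoid_mod := SetoidMod {
  sm_car :> Type;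
  sm_eq : sm_car -> sm_car -> Prop;
  sm_zero : sm_car;
  sm_add : sm_car -> sm_car -> sm_car;
  sm_scale : R -> sm_car -> sm_car;
  sm_refl : forall x, sm_eq x x;
  sm_sym : forall x y, sm_eq x y -> sm_eq y x;
  sm_trans : forall x y z, sm_eq x y -> sm_eq y z -> sm_eq x z;
  sm_addW : forall x x' y y', sm_eq x x' -> sm_eq y y' ->
    sm_eq (sm_add x y) (sm_add x' y');
  sm_scaleW : forall a x y, sm_eq x y -> sm_eq (sm_scale a x) (sm_scale a y);
  sm_addA : forall x y z, sm_eq (sm_add x (sm_add y z)) (sm_add (sm_add x y) z);
  sm_addC : forall x y, sm_eq (sm_add x y) (sm_add y x);
  sm_add0 : forall x, sm_eq (sm_add sm_zero x) x;
  sm_addN : forall x, sm_eq (sm_add (sm_scale (-1) x) x) sm_zero;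
  sm_scaleA : forall a b x,
    sm_eq (sm_scale a (sm_scale b x)) (sm_scale (a * b) x);
  sm_scale1 : forall x, sm_eq (sm_scale 1 x) x;
  sm_scaleDr : forall a x y,
    sm_eq (sm_scale a (sm_add x y)) (sm_add (sm_scale a x) (sm_scale a y));
  sm_scaleDl : forall a b x,
    sm_eq (sm_scale (a + b) x) (sm_add (sm_scale a x) (sm_scale b x))
}.

Variable S : setoid_mod.

Definition smod : Type := {P : S -> Prop | exists x, P = sm_eq x}.

Definition scl (x : S) : smod :=
  exist (fun P : S -> Prop => exists x, P = sm_eq x) _ (ex_intro _ x erefl).

Lemma scl_eq x y : scl x = scl y <-> sm_eq x y.
Proof.
split=> [/(congr1 sval)/= e|xy]; first by rewrite e; exact: sm_refl.
apply/eq_exist/funext => z; apply/propext; split=> h; last exact: sm_trans h.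
exact: sm_trans (sm_sym xy) h.
Qed.

Lemma scl_surj (u : smod) : exists x, scl x = u.
Proof. by case: u => P [x eP]; exists x; apply: eq_exist; rewrite eP. Qed.

Definition srep (u : smod) : S := sval (cid (scl_surj u)).

Lemma srepK u : scl (srep u) = u.
Proof. exact: svalP (cid (scl_surj u)). Qed.

Lemma srep_eq x : sm_eq (srep (scl x)) x.
Proof. by apply/scl_eq; exact: srepK. Qed.

Definition s_add (u v : smod) := scl (sm_add (srep u) (srep v)).
Definition s_scale a (u : smod) := scl (sm_scale a (srep u)).

Lemma s_addE x y : s_add (scl x) (scl y) = scl (sm_add x y).
Proof. by apply/scl_eq/sm_addW; exact: srep_eq. Qed.

Lemma s_scaleE a x : s_scale a (scl x) = scl (sm_scale a x).
Proof. by apply/scl_eq/sm_scaleW/srep_eq. Qed.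

Lemma smod_ind (P : smod -> Prop) : (forall x, P (scl x)) -> forall u, P u.
Proof. by move=> Px u; rewrite -(srepK u). Qed.

Fact s_addA : associative s_add.
Proof.
elim/smod_ind=> x; elim/smod_ind=> y; elim/smod_ind=> z.
by rewrite !s_addE; apply/scl_eq/sm_addA.
Qed.

Fact s_addC : commutative s_add.
Proof.
by elim/smod_ind=> x; elim/smod_ind=> y; rewrite !s_addE; apply/scl_eq/sm_addC.
Qed.

Fact s_add0 : left_id (scl (sm_zero S)) s_add.
Proof. by elim/smod_ind=> x; rewrite s_addE; apply/scl_eq/sm_add0. Qed.

Fact s_addN : left_inverse (scl (sm_zero S)) (s_scale (-1)) s_add.
Proof. by elim/smod_ind=> x; rewrite s_scaleE s_addE; apply/scl_eq/sm_addN. Qed.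

HB.instance Definition _ := gen_eqMixin smod.
HB.instance Definition _ := gen_choiceMixin smod.
HB.instance Definition _ := GRing.isZmodule.Build smod s_addA s_addC s_add0 s_addN.

Fact s_scaleA a b u : s_scale a (s_scale b u) = s_scale (a * b) u.
Proof. by elim/smod_ind: u => x; rewrite !s_scaleE; apply/scl_eq/sm_scaleA. Qed.

Fact s_scale1 : left_id 1 s_scale.
Proof. by elim/smod_ind=> x; rewrite !s_scaleE; apply/scl_eq/sm_scale1. Qed.

Fact s_scaleDr : right_distributive s_scale +%R.
Proof.
move=> a; elim/smod_ind=> x; elim/smod_ind=> y.
by rewrite [scl x + _]s_addE [RHS]/GRing.add/= !s_scaleE s_addE; apply/scl_eq/sm_scaleDr.
Qed.

Fact s_scaleDl u : {morph s_scale^~ u : a b / a + b}.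
Proof.
elim/smod_ind: u => x a b.
by rewrite /= !s_scaleE [RHS]s_addE; apply/scl_eq/sm_scaleDl.
Qed.

HB.instance Definition _ := GRing.Zmodule_isLmodule.Build R smod
  s_scaleA s_scale1 s_scaleDr s_scaleDl.

Lemma sclD x y : scl (sm_add x y) = scl x + scl y.
Proof. by rewrite -s_addE. Qed.

Lemma sclZ a x : scl (sm_scale a x) = a *: scl x.
Proof. by rewrite -s_scaleE. Qed.

End Setoid.

(** * Quotients, submodules, free modules, direct sums and products *)

Section Constructions.
Variable R : pzRingType.

Section Quotient.
Variables (M : lmodType R) (P : M -> Prop) (sP : subm P).
Let eqP x y := P (x - y).
Let p0 x : P (x - x). Proof. by rewrite subrr; exact: subm0. Qed.
Let pe x y : x = y -> P (x - y). Proof. by move->. Qed.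

Definition quotient_setoid : setoid_mod R.
Proof.
refine (@SetoidMod R M eqP 0 +%R *:%R p0 _ _ _ _ _ _ _ _ _ _ _ _); rewrite /eqP.
- by move=> x y /(submN sP); rewrite opprB.
- by move=> x y z xy yz; rewrite -[x](subrK y) -addrA; exact: submD.
- by move=> x x' y y' px py; rewrite opprD addrACA; exact: submD.
- by move=> a x y /(submZ a sP); rewrite scalerBr.
- by move=> x y z; apply: pe; rewrite addrA.
- by move=> x y; apply: pe; rewrite addrC.
- by move=> x; apply: pe; rewrite add0r.
- by move=> x; apply: pe; rewrite scaleN1r addNr.
- by move=> a b x; apply: pe; rewrite scalerA.
- by move=> x; apply: pe; rewrite scale1r.
- by move=> a x y; apply: pe; rewrite scalerDr.
- by move=> a b x; apply: pe; rewrite scalerDl.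
Defined.

Lemma quotient_exists : exists (Q : lmodType R) (q : {linear M -> Q}),
  surjection q /\ forall x, q x = 0 <-> P x.
Proof.
pose S := quotient_setoid.
have qP : linear (scl (S := S) : M -> smod S).
  by move=> a x y; rewrite -sclZ -sclD.
exists (smod S), (linear_of qP); split=> [u|x]; first by have [x <-] := scl_surj u; exists x.
rewrite linear_ofE -[X in _ = X]/(scl (sm_zero S)).
by split=> [/scl_eq|Px]; last apply/scl_eq; rewrite /= /eqP subr0.
Qed.
End Quotient.

Section Sub.
Variables (M : lmodType R) (P : M -> Prop) (sP : subm P).
Let T := {x : M | P x}.
Let add (x y : T) : T := exist P _ (submD sP (svalP x) (svalP y)).
Let scale a (x : T) : T := exist P _ (submZ a sP (svalP x)).

Definition sub_setoid : setoid_mod R.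
Proof.
refine (@SetoidMod R T (fun x y => sval x = sval y) (exist P _ (subm0 sP)) add scale
  _ _ _ _ _ _ _ _ _ _ _ _ _) => //=.
- by move=> x y z -> ->.
- by move=> x x' y y' -> ->.
- by move=> a x y ->.
- by move=> x y z; rewrite addrA.
- by move=> x y; rewrite addrC.
- by move=> x; rewrite add0r.
- by move=> x; rewrite scaleN1r addNr.
- by move=> a b x; rewrite scalerA.
- by move=> x; rewrite scale1r.
- by move=> a x y; rewrite scalerDr.
- by move=> a b x; rewrite scalerDl.
Defined.

Lemma sub_exists : exists (K : lmodType R) (i : {linear K -> M}),
  injective i /\ forall x, P x <-> exists k, i k = x.
Proof.
pose S := sub_setoid; pose f (u : smod S) : M := sval (srep u).
have fE x : f (scl x) = sval x by exact: (srep_eq x).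
have fP : linear f.
  move=> a; elim/smod_ind=> x; elim/smod_ind=> y.
  by rewrite -sclZ -sclD !fE.
exists (smod S), (linear_of fP); split.
  by elim/smod_ind=> x; elim/smod_ind=> y; rewrite !linear_ofE !fE => ?; apply/scl_eq.
move=> x; split=> [Px|[u <-]]; first by exists (scl (exist P x Px : S)); exact: fE.
by rewrite linear_ofE; exact: svalP.
Qed.
End Sub.

Lemma kernel_exists (M N : lmodType R) (f : {linear M -> N}) :
  exists (K : lmodType R) (i : {linear K -> M}), injective i /\ exact i f.
Proof. exact: sub_exists (subm_ker f). Qed.

Definition is_free (T : Type) (F : lmodType R) (b : T -> F) : Prop :=
  (forall x, exists l, lc b l = x) /\
  forall (N : lmodType R) (phi : T -> N),
    exists g : {linear F -> N}, forall t, g (b t) = phi t.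

Section Free.
Variable T : Type.

(** Two formal combinations are identified when all valuations in all modules
    agree on them, so that the universal property holds by definition. *)
Definition free_setoid : setoid_mod R.
Proof.
refine (@SetoidMod R (seq (R * T))
  (fun l l' => forall (N : lmodType R) (phi : T -> N), lc phi l = lc phi l')
  [::] cat (@fscale R T) _ _ _ _ _ _ _ _ _ _ _ _ _) => //=.
- by move=> x y z xy yz N phi; rewrite xy.
- by move=> x x' y y' ex ey N phi; rewrite !lc_cat ex ey.
- by move=> a x y e N phi; rewrite !lc_scale e.
- by move=> x y z N phi; rewrite catA.
- by move=> x y N phi; rewrite !lc_cat addrC.
- by move=> x N phi; rewrite lc_cat lc_scale lc_nil scaleN1r addNr.
- by move=> a b x N phi; rewrite !lc_scale scalerA.
- by move=> x N phi; rewrite lc_scale scale1r.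
- by move=> a x y N phi; rewrite !(lc_cat, lc_scale) scalerDr.
- by move=> a b x N phi; rewrite !(lc_cat, lc_scale) scalerDl.
Defined.

Lemma free_exists : exists (F : lmodType R) (b : T -> F), is_free b.
Proof.
pose S := free_setoid.
pose b t : smod S := scl ([:: (1, t)] : S).
have bE l : lc b l = scl (l : S).
  elim: l => [|[a t] l IHl]; first by rewrite lc_nil.
  rewrite lc_cons IHl -sclZ -sclD; apply/scl_eq => N phi /=.
  by rewrite !lc_cons /= mulr1.
exists (smod S), b; split=> [|N phi].
  by elim/smod_ind=> l; exists l; exact: bE.
pose g (u : smod S) := lc phi (srep u).
have gE l : g (scl l) = lc phi l by exact: (srep_eq l).
have gP : linear g.
  move=> a; elim/smod_ind=> x; elim/smod_ind=> y.
  by rewrite -sclZ -sclD !gE lc_cat lc_scale.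
by exists (linear_of gP) => t; rewrite linear_ofE gE lc1 scale1r.
Qed.
End Free.

Lemma free_projective T (F : lmodType R) (b : T -> F) : is_free b -> projective F.
Proof.
move=> [gen univ] M N p f /choice[s sP].
have [g gE] := univ M (fun t => s (f (b t))).
exists g => x; have [l <-] := gen x; rewrite !lc_linear; apply: eq_lc => t /=.
by rewrite gE sP.
Qed.

Lemma free_cover (M : lmodType R) : exists (T : Type) (F : lmodType R) (b : T -> F)
  (p : {linear F -> M}), is_free b /\ surjection p.
Proof.
have [F [b bF]] := free_exists M; have [p pE] := bF.2 M id.
by exists M, F, b, p; split=> // x; exists (b x); exact: pE.
Qed.

(** Direct sums are recognized by generation and the universal property; the
    projections and finite supports follow. *)
Definition is_dsum (I : Type) (E : I -> lmodType R) (S : lmodType R)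
    (inj : forall i, {linear E i -> S}) : Prop :=
  (forall x, exists l : seq {i : I & E i},
    x = \sum_(p <- l) inj (projT1 p) (projT2 p)) /\
  forall (N : lmodType R) (f : forall i, {linear E i -> N}),
    exists g : {linear S -> N}, forall i e, g (inj i e) = f i e.

Section DirectSum.
Variables (I : Type) (E : I -> lmodType R).
Let T := seq {i : I & E i}.
Let ev (N : lmodType R) (f : forall i, {linear E i -> N}) (l : T) :=
  \sum_(p <- l) f (projT1 p) (projT2 p).
Let scale a (l : T) : T :=
  [seq existT E (projT1 p) (a *: projT2 p) | p <- l].

Let ev_cat N f (l l' : T) : @ev N f (l ++ l') = ev f l + ev f l'.
Proof. exact: big_cat. Qed.
Let ev_scale N f a (l : T) : @ev N f (scale a l) = a *: ev f l.
Proof.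
by rewrite /ev big_map scaler_sumr; apply: eq_bigr => p _; rewrite /= linearZ.
Qed.

(** As for free modules, formal sums are identified when all families of maps
    agree on them. *)
Definition dsum_setoid : setoid_mod R.
Proof.
refine (@SetoidMod R T
  (fun l l' => forall (N : lmodType R) (f : forall i, {linear E i -> N}),
     ev f l = ev f l')
  [::] cat scale _ _ _ _ _ _ _ _ _ _ _ _ _) => //=.
- by move=> x y z xy yz N phi; rewrite xy.
- by move=> x x' y y' ex ey N phi; rewrite !ev_cat ex ey.
- by move=> a x y e N phi; rewrite !ev_scale e.
- by move=> x y z N phi; rewrite catA.
- by move=> x y N phi; rewrite !ev_cat addrC.
- by move=> x N phi; rewrite ev_cat ev_scale scaleN1r addNr /ev big_nil.
- by move=> a b x N phi; rewrite !ev_scale scalerA.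
- by move=> x N phi; rewrite ev_scale scale1r.
- by move=> a x y N phi; rewrite !(ev_cat, ev_scale) scalerDr.
- by move=> a b x N phi; rewrite !(ev_cat, ev_scale) scalerDl.
Defined.

Lemma dsum_exists : exists (S : lmodType R) (inj : forall i, {linear E i -> S}),
  is_dsum inj.
Proof.
pose S := dsum_setoid.
pose b i (e : E i) : smod S := scl ([:: existT E i e] : S).
have bP i : linear (b i).
  move=> a x y; rewrite -sclZ -sclD; apply/scl_eq => N f /=.
  by rewrite /ev /= !big_cons !big_nil /= !addr0 linearD.
exists (smod S), (fun i => linear_of (bP i)); split=> [|N f].
  elim/smod_ind=> l; exists l; elim: l => [|[i e] l IHl]; first by rewrite big_nil.
  by rewrite big_cons -IHl /= -sclD.
pose g (u : smod S) := ev f (srep u).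
have gE l : g (scl l) = ev f l by exact: (srep_eq l).
have gP : linear g.
  move=> a; elim/smod_ind=> x; elim/smod_ind=> y.
  by rewrite -sclZ -sclD !gE ev_cat ev_scale.
by exists (linear_of gP) => i e; rewrite linear_ofE gE /ev big_seq1.
Qed.

Variables (S : lmodType R) (inj : forall i, {linear E i -> S}).
Hypothesis dS : is_dsum inj.

Lemma dsum_gen_eq (N : lmodType R) (f g : {linear S -> N}) :
  (forall i e, f (inj i e) = g (inj i e)) -> f =1 g.
Proof.
by move=> fg x; have [l ->] := dS.1 x; rewrite !linear_sum; apply: eq_bigr.
Qed.

Lemma dsum_proj : exists pr : forall i, {linear S -> E i},
  (forall i e, pr i (inj i e) = e) /\ forall i j e, i <> j -> pr j (inj i e) = 0.
Proof.
pose d j i (e : E i) : E j :=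
  if pselect (i = j) is left ij then ecast k (E k) ij e else 0.
have dP j i : linear (@d j i).
  by move=> a x y; rewrite /d; case: pselect => [ij|_]; first case: j / ij;
    rewrite // scaler0 addr0.
have /dep_choice[pr prE] : forall j, exists g : {linear S -> E j},
  forall i e, g (inj i e) = d j i e by move=> j; exact: (dS.2 _ (fun i => linear_of (dP j i))).
exists pr; split=> [i e|i j e ij]; rewrite prE /d; case: pselect => // ii.
by rewrite (Prop_irrelevance ii erefl).
Qed.

(** The list of indices may be enlarged, so that finitely many elements can be
    decomposed along a common list. *)
Lemma dsum_decomp (pr : forall i, {linear S -> E i}) :
  (forall i e, pr i (inj i e) = e) ->
  (forall i j e, i <> j -> pr j (inj i e) = 0) ->
  forall x, exists J : seq {classic I}, uniq J /\
    forall J', uniq J' -> {subset J <= J'} ->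
    x = \sum_(i <- J') inj (i : I) (pr i x).
Proof.
move=> pr1 pr0 x; have [l ->] := dS.1 x.
exists (undup [seq projT1 p : {classic I} | p <- l]); split; first exact: undup_uniq.
move=> J' uJ sJ.
have {}sJ i : i \in [seq projT1 p : {classic I} | p <- l] -> i \in J'.
  by move=> il; apply: sJ; rewrite mem_undup.
elim: l sJ => [|[i e] l IHl] sJ.
  by rewrite big_nil big1 // => i _; rewrite !linear0.
rewrite big_cons; under [RHS]eq_bigr => j _ do rewrite 2!linearD.
rewrite big_split /=; congr (_ + _); last first.
  by apply: IHl => j jl; apply: sJ; rewrite /= inE jl orbT.
rewrite (bigD1_seq (i : {classic I})) //=; last by apply: sJ; rewrite /= inE eqxx.
rewrite pr1 big1 ?addr0 // => j /eqP ji; rewrite pr0 ?linear0 //.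
by move=> ij; apply: ji.
Qed.

Lemma dsum_eq0 (pr : forall i, {linear S -> E i}) :
  (forall i e, pr i (inj i e) = e) ->
  (forall i j e, i <> j -> pr j (inj i e) = 0) ->
  forall x, (forall i, pr i x = 0) -> x = 0.
Proof.
move=> pr1 pr0 x x0; have [J [uJ /(_ J uJ (fun _ => id))->]] := dsum_decomp pr1 pr0 x.
by rewrite big1 // => i _; rewrite x0 linear0.
Qed.

Lemma dsum_projective : (forall i, projective (E i)) -> projective S.
Proof.
move=> pE M N p f p_surj.
have /dep_choice[g gE] : forall i, exists g : {linear E i -> M},
    forall x, p (g x) = f (inj i x).
  by move=> i; have [g gE] := pE i M N p (f \o inj i) p_surj; exists g.
have [h hE] := dS.2 M g.
exists h; apply: (@dsum_gen_eq N (p \o h) f) => i e /=.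
by rewrite hE gE.
Qed.
End DirectSum.

Section Product.
Variables (I : Type) (E : I -> lmodType R).
Definition prod_setoid : setoid_mod R.
Proof.
refine (@SetoidMod R (forall i, E i) (fun x y => forall i, x i = y i)
  (fun i => 0) (fun x y i => x i + y i) (fun a x i => a *: x i)
  _ _ _ _ _ _ _ _ _ _ _ _ _) => //=.
- by move=> x y z xy yz i; rewrite xy.
- by move=> x x' y y' ex ey i; rewrite ex ey.
- by move=> a x y e i; rewrite e.
- by move=> x y z i; rewrite addrA.
- by move=> x y i; rewrite addrC.
- by move=> x i; rewrite add0r.
- by move=> x i; rewrite scaleN1r addNr.
- by move=> a b x i; rewrite scalerA.
- by move=> x i; rewrite scale1r.
- by move=> a x y i; rewrite scalerDr.
- by move=> a b x i; rewrite scalerDl.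
Defined.

Definition is_prod (P : lmodType R) (pr : forall i, {linear P -> E i}) : Prop :=
  (forall e : forall i, E i, exists x, forall i, pr i x = e i) /\
  forall x y, (forall i, pr i x = pr i y) -> x = y.

Lemma prod_exists : exists (P : lmodType R) (pr : forall i, {linear P -> E i}),
  is_prod pr.
Proof.
pose S := prod_setoid; pose f i (u : smod S) : E i := srep u i.
have fE i x : f i (scl x) = x i by exact: (srep_eq x).
have fP i : linear (f i).
  move=> a; elim/smod_ind=> x; elim/smod_ind=> y.
  by rewrite -sclZ -sclD !fE.
exists (smod S), (fun i => linear_of (fP i)); split.
  by move=> e; exists (scl (e : S)) => i; rewrite linear_ofE fE.
elim/smod_ind=> x; elim/smod_ind=> y => e; apply/scl_eq => i.
by have := e i; rewrite !linear_ofE !fE.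
Qed.

Lemma prod_lift (P : lmodType R) (pr : forall i, {linear P -> E i})
    (N : lmodType R) (f : forall i, {linear N -> E i}) : is_prod pr ->
  exists g : {linear N -> P}, forall i x, pr i (g x) = f i x.
Proof.
move=> [ex uq].
have /choice[g gE] : forall x, exists y, forall i, pr i y = f i x by move=> x; exact: ex.
have gP : linear g by move=> a x y; apply: uq => i; rewrite linearP !gE linearP.
by exists (linear_of gP) => i x; exact: gE.
Qed.
End Product.

Lemma pair_ext (T U : Type) (x y : T * U) : x.1 = y.1 -> x.2 = y.2 -> x = y.
Proof. by case: x y => [? ?] [? ?] /= -> ->. Qed.

Section Pairing.
Variables (L M N : lmodType R).
Implicit Types (f : {linear L -> M}) (g : {linear L -> N}).
Lemma pair_linear f g : linear (fun x => (f x, g x)).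
Proof. by move=> a x y; rewrite !linearP. Qed.
Definition pairl f g : {linear L -> (M * N)%type} := linear_of (pair_linear f g).
Lemma pairlE f g x : pairl f g x = (f x, g x).
Proof. by []. Qed.

Implicit Types (h : {linear M -> L}) (k : {linear N -> L}).
Lemma copair_linear h k : linear (fun x : M * N => h x.1 + k x.2).
Proof. by move=> a [x x'] [y y']; rewrite /= !linearP scalerDr addrACA. Qed.
Definition copair h k : {linear (M * N)%type -> L} := linear_of (copair_linear h k).
Lemma copairE h k x : copair h k x = h x.1 + k x.2.
Proof. by []. Qed.
End Pairing.

End Constructions.

(** * Presentations and the vanishing of Ext *)

Section Ext.
Variable R : pzRingType.
Implicit Types K L M N P U : lmodType R.

Lemma syzygy_exists P N (d : {linear P -> N}) :
  exists (F : lmodType R) (e : {linear F -> P}), projective F /\ exact e d.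
Proof.
have [K [i [i_inj iE]]] := kernel_exists d.
have [T [F [b [p [bF p_surj]]]]] := free_cover K.
exists F, (i \o p); split; first exact: free_projective bF.
move=> x; split=> [/iE[k <-]|[y <-]]; last by apply/iE; exists (p y).
by have [y <-] := p_surj k; exists y.
Qed.

Record arrow := Arrow {asrc : lmodType R; atgt : lmodType R; amap : {linear asrc -> atgt}}.

(** The vanishing of Ext and Tor quantifies over resolutions; their existence is
    what makes it informative. *)
Lemma resolution_exists M : exists P : projective_resolution M, True.
Proof.
have [T [F [b [p [bF p_surj]]]]] := free_cover M.
pose next (a : arrow) : arrow :=
  let s := cid (syzygy_exists (amap a)) in
  Arrow (sval (cid (svalP s))).
pose arr := fix arr n := if n is n'.+1 then next (arr n') else Arrow p.
have nextP a : projective (asrc (next a)) /\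
    exact (sval (cid (svalP (cid (syzygy_exists (amap a)))))) (amap a).
  exact: (svalP (cid (svalP (cid (syzygy_exists (amap a)))))).
have proj n : projective (asrc (arr n)).
  by case: n => [|n]; [exact: free_projective bF|have [] := nextP (arr n)].
have ex n : exact (amap (arr n.+2)) (amap (arr n.+1)) by have [] := nextP (arr n.+1).
have ex0 : exact (amap (arr 1%N)) p by have [] := nextP (arr 0%N).
by exists (@ProjectiveResolution R M (fun n => asrc (arr n)) (fun n => amap (arr n.+1)) p
  proj ex ex0 p_surj).
Qed.

Lemma lift_presentation M K L P P' (i : {linear K -> L}) (p : {linear L -> M})
    (d : {linear P' -> P}) (q : {linear P -> M}) :
  short_exact i p -> projective P -> (forall y, q (d y) = 0) ->
  exists (a0 : {linear P -> L}) (a1 : {linear P' -> K}),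
    (forall x, p (a0 x) = q x) /\ forall y, i (a1 y) = a0 (d y).
Proof.
move=> [i_inj ip p_surj] prP qd; have [a0 a0E] := prP _ _ p q p_surj.
have [|a1 a1E] := @corestrict R K L P' i (a0 \o d) i_inj.
  by move=> y; apply/ip; rewrite /= a0E.
by exists a0, a1.
Qed.

Definition extends_along K L N (i : {linear K -> L}) : Prop :=
  forall f : {linear K -> N}, exists g : {linear L -> N}, forall x, g (i x) = f x.

(** Along the comparison maps [a0] and [a1], the module [L] is the pushout of [j]
    and [a1], so a map out of [K] extends to [L] once its restriction to [U]
    extends to [P]. *)
Lemma projective_extends M N P U K L (j : {linear U -> P}) (q : {linear P -> M})
    (i : {linear K -> L}) (p : {linear L -> M}) :
  projective P -> short_exact j q -> extends_along N j ->
  short_exact i p -> extends_along N i.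
Proof.
move=> prP [j_inj jq q_surj] jN ex f; have [i_inj ip p_surj] := ex.
have qj u : q (j u) = 0 by apply/jq; exists u.
have [a0 [a1 [a0E a1E]]] := lift_presentation ex prP qj.
have [h hE] := jN (f \o a1).
have [||g gE] := @descend R (K * P)%type L N (copair i a0) (copair f h).
- move=> l; have [x qx] := q_surj (p l).
  have [|k kE] := (ip (l - a0 x)).1; first by rewrite linearB a0E qx subrr.
  by exists (k, x); rewrite copairE /= kE subrK.
- move=> [k x]; rewrite copairE /= => e.
  have [|u ux] := (jq x).1.
    have : p (i k + a0 x) = 0 by rewrite e linear0.
    by rewrite linearD a0E (_ : p (i k) = 0) ?add0r //; apply/ip; exists k.
  rewrite -ux hE /= -linearD (_ : k + a1 u = 0) ?linear0 //.
  by apply: i_inj; rewrite linearD a1E ux e linear0.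
by exists g => k; rewrite -[i k]addr0 -(linear0 a0) (gE (k, 0)) copairE /= linear0 addr0.
Qed.

Lemma Ext1_extend M N : Ext1_vanishes M N ->
  forall K L (i : {linear K -> L}) (p : {linear L -> M}),
    short_exact i p -> extends_along N i.
Proof.
move=> EMN K L i p; have [P _] := resolution_exists M; have dE := @res_exact0 _ _ P.
have [U [j [j_inj jE]]] := kernel_exists (res_aug P).
have [|e eE] := @corestrict R U _ _ j (res_diff P 0) j_inj.
  by move=> y; apply/jE/dE; exists y.
apply: (@projective_extends M N (P 0) U K L j (res_aug P)).
- exact: res_projective.
- by split=> //; exact: res_aug_surj.
move=> f; have /(EMN P (f \o e))[h hE] : forall x, (f \o e) (res_diff P 1 x) = 0.
  move=> x /=; rewrite (_ : e _ = 0) ?linear0 //; apply: j_inj.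
  by rewrite eE linear0; apply/(@res_exact _ _ P 0); exists x.
exists h => u; have [|y yE] := (dE (j u)).1; first by apply/jE; exists u.
by rewrite -yE hE /=; congr (f _); apply: j_inj; rewrite eE.
Qed.

Lemma extend_Ext1 M N :
  (forall K L (i : {linear K -> L}) (p : {linear L -> M}),
    short_exact i p -> extends_along N i) -> Ext1_vanishes M N.
Proof.
move=> ext P f; have dE := @res_exact0 _ _ P; split=> [fd|[g gE] x]; last first.
  rewrite -gE (_ : res_diff P 0 _ = 0) ?linear0 //.
  by apply/(@res_exact _ _ P 0); exists x.
have [K [i [i_inj iE]]] := kernel_exists (res_aug P).
have [|e eE] := @corestrict R K _ _ i (res_diff P 0) i_inj.
  by move=> y; apply/iE/dE; exists y.
have [||f' f'E] := @descend R _ K N e f.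
- move=> k; have [|y yE] := (dE (i k)).1; first by apply/iE; exists k.
  by exists y; apply: i_inj; rewrite eE.
- move=> y ey; have [|x <-] := (@res_exact _ _ P 0 y).1; last exact: fd.
  by rewrite -eE ey linear0.
have ex : short_exact i (res_aug P) by split=> //; exact: res_aug_surj.
have [g gE] := ext _ _ i (res_aug P) ex f'.
by exists g => y; rewrite -eE gE.
Qed.

Lemma projective_Ext1 M N P U (j : {linear U -> P}) (q : {linear P -> M}) :
  projective P -> short_exact j q -> extends_along N j -> Ext1_vanishes M N.
Proof.
by move=> prP ex jN; apply: extend_Ext1 => K L i p; exact: projective_extends prP ex jN.
Qed.

Lemma Ext1_split M N : Ext1_vanishes M N ->
  forall L (i : {linear N -> L}) (p : {linear L -> M}), short_exact i p ->
    exists r : {linear L -> N}, forall x, r (i x) = x.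
Proof. by move=> E L i p ex; exact: (Ext1_extend E ex idfun). Qed.

Lemma pushout_short_exact K L M N (i : {linear K -> L}) (p : {linear L -> M})
    (f : {linear K -> N}) : short_exact i p ->
  exists (Q : lmodType R) (u : {linear N -> Q}) (v : {linear L -> Q})
      (p' : {linear Q -> M}),
    [/\ short_exact u p', forall x, u (f x) = v (i x), forall l, p' (v l) = p l
      & forall (E : lmodType R) (a : {linear N -> E}) (b : {linear L -> E}),
          (forall x, a (f x) = b (i x)) ->
          exists g : {linear Q -> E}, (forall n, g (u n) = a n) /\ forall l, g (v l) = b l].
Proof.
move=> [i_inj ip p_surj].
pose h := pairl f (\- i : {linear K -> L}).
have [Q [q [q_surj qE]]] := quotient_exists (subm_im h).
pose u : {linear N -> Q} := q \o pairl idfun \0.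
pose v : {linear L -> Q} := q \o pairl \0 idfun.
have [|p' p'E] := @descend R (N * L)%type Q M q (copair \0 p) q_surj.
  move=> [n l] /qE[k [_ <-]]; rewrite copairE /= add0r linearN /=.
  by rewrite (_ : p (i k) = 0) ?oppr0 //; apply/ip; exists k.
exists Q, u, v, p'; split.
- split.
  + apply: linear_inj => n /qE[k [fk ik]].
    have k0 : k = 0 by apply: i_inj; rewrite linear0; apply/oppr_inj; rewrite oppr0.
    by rewrite -fk k0 linear0.
  + move=> y; have [[n l] <-] := q_surj y; rewrite p'E copairE /= add0r; split.
      move=> /ip[k ik]; exists (n + f k); apply/subr0_eq; rewrite -linearB.
      apply/qE; exists k; apply: pair_ext => /=.
        by rewrite addrC addKr.
      by rewrite sub0r ik.
    move=> [n' /= e].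
    have : q ((n, l) - (n', 0)) = 0 by rewrite linearB -e subrr.
    move=> /qE[k [_ kl]]; apply/ip; exists (- k); rewrite linearN /=.
    by move: kl; rewrite /= oppr0 addr0.
  + by move=> m; have [l <-] := p_surj m; exists (v l); rewrite /v /= p'E copairE /= add0r.
- move=> x; rewrite /u /v /=; apply/subr0_eq; rewrite -linearB; apply/qE.
  exists x; apply: pair_ext => /=; first by rewrite subr0.
  by rewrite sub0r.
- by move=> l; rewrite /v /= p'E copairE /= add0r.
- move=> E a b ab; have [|g gE] := @descend R (N * L)%type Q E q (copair a b) q_surj.
    by move=> _ /qE[k <-]; rewrite copairE /= linearN ab subrr.
  exists g; split=> x; rewrite /u /v /= gE copairE /= linear0 ?addr0 ?add0r //.
Qed.

Lemma split_Ext1 M N :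
  (forall L (i : {linear N -> L}) (p : {linear L -> M}), short_exact i p ->
    exists r : {linear L -> N}, forall x, r (i x) = x) -> Ext1_vanishes M N.
Proof.
move=> split; apply: extend_Ext1 => K L i p ex f.
have [Q [u [v [p' [exu uv _ _]]]]] := pushout_short_exact f ex.
have [r rE] := split Q u p' exu.
by exists (r \o v) => x /=; rewrite -uv rE.
Qed.

End Ext.

(** * Tensor products and the vanishing of Tor *)

Section Tensor.
Variables (R : pzRingType) (B : lmodType R^c).
Implicit Types (K L M N P U V W : lmodType R).

Notation tmap := (@tensor_map R B _ _).

Lemma tclass_cons (M : lmodType R) (b : B) (m : M) s :
  tclass ((b, m) :: s) = tens b m + tclass s.
Proof. exact: (tclass_cat [:: (b, m)] s). Qed.

Lemma tensor_map_class M N (f : {linear M -> N}) s :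
  tmap f (tclass s) = tclass [seq (x.1, f x.2) | x <- s].
Proof.
rewrite /tensor_map tensor_lift_class; last exact: tensor_map_balanced.
by rewrite tclassE big_map.
Qed.

Lemma tensor_map0 M N (f : {linear M -> N}) : tmap f 0 = 0.
Proof. by apply: (addIr (tmap f 0)); rewrite -tensor_mapD !add0r. Qed.

Lemma tensor_mapN M N (f : {linear M -> N}) x : tmap f (- x) = - tmap f x.
Proof. by apply: (addIr (tmap f x)); rewrite -tensor_mapD !addNr tensor_map0. Qed.

Lemma tensor_mapB M N (f : {linear M -> N}) x y : tmap f (x - y) = tmap f x - tmap f y.
Proof. by rewrite tensor_mapD tensor_mapN. Qed.

Lemma tensor_map_comp L M N (f : {linear L -> M}) (g : {linear M -> N})
    (h : {linear L -> N}) : (forall x, g (f x) = h x) ->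
  forall x, tmap g (tmap f x) = tmap h x.
Proof.
move=> gf; elim/tensor_ind=> s; rewrite !tensor_map_class -map_comp.
by congr tclass; apply: eq_map => x /=; rewrite gf.
Qed.

Lemma tens0l (M : lmodType R) (m : M) : tens (0 : B) m = 0.
Proof. exact/tclassP/tensor_eq_0l. Qed.

Lemma tensDr (M : lmodType R) (b : B) (m m' : M) : tens b (m + m') = tens b m + tens b m'.
Proof. by have [_ ->] := tens_balanced B M. Qed.

Lemma tensDl (M : lmodType R) (b b' : B) (m : M) : tens (b + b') m = tens b m + tens b' m.
Proof. by have [->] := tens_balanced B M. Qed.

Lemma tensZ (M : lmodType R) (r : R) (b : B) (m : M) :
  tens ((r : R^c) *: b) m = tens b (r *: m).
Proof. by have [_ _ ->] := tens_balanced B M. Qed.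

Lemma tens0r (M : lmodType R) (b : B) : tens b (0 : M) = 0.
Proof. by apply: (addIr (tens b 0)); rewrite -tensDr !add0r. Qed.

Lemma tensNr (M : lmodType R) (b : B) (m : M) : tens b (- m) = - tens b m.
Proof. by apply: (addIr (tens b m)); rewrite -tensDr !addNr tens0r. Qed.

Lemma tensBr (M : lmodType R) (b : B) (m m' : M) : tens b (m - m') = tens b m - tens b m'.
Proof. by rewrite tensDr tensNr. Qed.

Lemma tensor_map_zero M N (f : {linear M -> N}) : (forall m, f m = 0) ->
  forall x, tmap f x = 0.
Proof.
move=> f0; elim/tensor_ind=> s; rewrite tensor_map_class tclassE big_map big1 //.
by move=> x _; rewrite /= f0 tens0r.
Qed.

Lemma tensor_map_inj M N (f : {linear M -> N}) :
  (forall x, tmap f x = 0 -> x = 0) -> injective (tmap f).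
Proof. by move=> f0 x y e; apply/subr0_eq/f0; rewrite tensor_mapB e subrr. Qed.

Lemma tensor_map_surj M N (f : {linear M -> N}) : surjection f -> surjection (tmap f).
Proof.
move=> /choice[s sE]; elim/tensor_ind=> l.
exists (tclass [seq (x.1, s x.2) | x <- l]); rewrite tensor_map_class -map_comp.
by rewrite (eq_map (g := id)) ?map_id // => -[b m] /=; rewrite sE.
Qed.

(** A set-theoretic section of [p] is carried along the derivation of an
    equality in the tensor product with [W]: each defining relation lifts up to
    an element of the image of [i]. *)
Lemma tensor_right_exact U V W (i : {linear U -> V}) (p : {linear V -> W}) :
  exact i p -> surjection p -> exact (tmap i) (tmap p).
Proof.
move=> ip /choice[s sE].
have pi u : p (i u) = 0 by apply/ip; exists u.
pose sec l := tclass [seq (x.1 : B, s x.2) | x <- l].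
have sec_cat l l' : sec (l ++ l') = sec l + sec l' by rewrite /sec map_cat tclass_cat.
have sec_nil : sec [::] = 0 by [].
have sec_cons b w l : sec ((b, w) :: l) = tens b (s w) + sec l by rewrite -cat1s sec_cat.
pose Im x := exists u, tmap i u = x.
have Im0 : Im 0 by exists 0; exact: tensor_map0.
have ImD x y : Im x -> Im y -> Im (x + y).
  by move=> [u <-] [v <-]; exists (u + v); exact: tensor_mapD.
have ImN x : Im x -> Im (- x) by move=> [u <-]; exists (- u); exact: tensor_mapN.
have ImT b v : p v = 0 -> Im (tens b v).
  by move=> /ip[u <-]; exists (tens b u); exact: tensor_mapE.
have main l l' : tensor_eq l l' -> Im (sec l - sec l').
  elim=> {l l'}.
  - by move=> l; rewrite subrr.
  - by move=> l l' _ /ImN; rewrite opprB.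
  - by move=> l l' l'' _ h _ h'; rewrite -(subrK (sec l') (sec l)) -addrA; exact: ImD.
  - move=> l l' m m' _ hl _ hm; rewrite !sec_cat opprD addrACA; exact: ImD.
  - by move=> l l'; rewrite !sec_cat [X in _ - X]addrC subrr.
  - by move=> w; rewrite sec_cons sec_nil tens0l addr0 subrr.
  - by move=> b b' w; rewrite !sec_cons sec_nil !addr0 tensDl subrr.
  - move=> b w w'; rewrite !sec_cons sec_nil !addr0 opprD addrA.
    by rewrite -!tensBr; apply: ImT; rewrite !linearB /= !sE addrAC addrK subrr.
  - move=> r b w.
    by rewrite !sec_cons sec_nil !addr0 tensZ -tensBr; apply: ImT; rewrite linearB linearZ /= !sE subrr.
move=> x; split=> [|[u <-]]; last first.
  by rewrite (@tensor_map_comp _ _ _ i p \0) // tensor_map_zero.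
elim/tensor_ind: x => l; rewrite tensor_map_class => /tclassP/main.
rewrite -[sec [::]]/(0 : tensor B V) subr0 => h.
rewrite -(subrK (sec [seq (x.1, p x.2) | x <- l]) (tclass l)); apply: (ImD) => //.
elim: l {h} => [|[b v] l IHl]; first by rewrite subrr.
rewrite [map _ _]/= sec_cons tclass_cons opprD addrACA.
apply: ImD => //; rewrite -tensBr; apply: ImT.
by rewrite linearB /= sE subrr.
Qed.

(** A derivation of an equality in the tensor product only uses finitely many
    linear relations of [M], and can be transported by any function that respects
    those relations. *)
Lemma tensor_derivation M (s t : seq (B * M)) : tensor_eq s t ->
  exists rho : seq (seq (R * M)), {in rho, forall l, lc id l = 0} /\
    forall L (phi : M -> L), {in rho, forall l, lc phi l = 0} ->
      tensor_eq [seq (x.1, phi x.2) | x <- s] [seq (x.1, phi x.2) | x <- t].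
Proof.
have cat2 (r r' : seq (seq (R * M))) (P : seq (R * M) -> Prop) :
    {in r ++ r', forall l, P l} -> {in r, forall l, P l} /\ {in r', forall l, P l}.
  by move=> h; split=> l lr; apply: h; rewrite mem_cat lr ?orbT.
have cat2' (r r' : seq (seq (R * M))) (P : seq (R * M) -> Prop) :
    {in r, forall l, P l} -> {in r', forall l, P l} -> {in r ++ r', forall l, P l}.
  by move=> h h' l; rewrite mem_cat => /orP[/h|/h'].
elim=> {s t}.
- by move=> s; exists [::]; split=> // L phi _; exact: tensor_eq_refl.
- move=> s t _ [r [r0 rE]]; exists r; split=> // L phi /rE; exact: tensor_eq_sym.
- move=> s t u _ [r [r0 rE]] _ [r' [r'0 r'E]]; exists (r ++ r'); split.
    exact: cat2'.
  by move=> L phi /cat2[/rE h /r'E]; exact: tensor_eq_trans.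
- move=> s s' t t' _ [r [r0 rE]] _ [r' [r'0 r'E]]; exists (r ++ r'); split.
    exact: cat2'.
  by move=> L phi /cat2[/rE h /r'E h']; rewrite !map_cat; exact: tensor_eq_cat.
- move=> s t; exists [::]; split=> // L phi _; rewrite !map_cat; exact: tensor_eq_catC.
- by move=> m; exists [::]; split=> // L phi _; exact: tensor_eq_0l.
- by move=> b b' m; exists [::]; split=> // L phi _; exact: tensor_eq_Dl.
- move=> b m m'; exists [:: [:: (1, m + m'); (-1, m); (-1, m')]]; split.
    move=> l; rewrite inE => /eqP->; rewrite !lc_cons lc_nil /= scale1r !scaleN1r.
    by rewrite addr0 -opprD subrr.
  move=> L phi /(_ _ (mem_head _ _)); rewrite !lc_cons lc_nil /= scale1r !scaleN1r.
  by rewrite addr0 -opprD => /subr0_eq ->; exact: tensor_eq_Dr.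
- move=> r b m; exists [:: [:: (r, m); (-1, r *: m)]]; split.
    move=> l; rewrite inE => /eqP->; rewrite !lc_cons lc_nil /= !scaleN1r.
    by rewrite addr0 subrr.
  move=> L phi /(_ _ (mem_head _ _)); rewrite !lc_cons lc_nil /= !scaleN1r.
  by rewrite addr0 => /subr0_eq <-; exact: tensor_eq_Z.
Qed.

(** The module [L] is the cokernel of [U -> K * P].  An element of the tensor
    product with [K] that dies in that with [L] comes from some [w] over [U], which
    must vanish because its component over [P] does. *)
Lemma projective_Tor1_mono P M U K L (j : {linear U -> P}) (q : {linear P -> M})
    (i : {linear K -> L}) (p : {linear L -> M}) :
  projective P -> short_exact j q -> injective (tmap j) ->
  short_exact i p -> injective (tmap i).
Proof.
move=> prP [j_inj jq q_surj] tj_inj ex; have [i_inj ip p_surj] := ex.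
have qj u : q (j u) = 0 by apply/jq; exists u.
have [a0 [a1 [a0E a1E]]] := lift_presentation ex prP qj.
pose d := pairl (\- a1 : {linear U -> K}) j.
have ker : exact d (copair i a0).
  move=> [k x]; rewrite copairE /=; split=> [e|[u [<- <-]]]; last first.
    by rewrite /= linearN a1E addNr.
  have /jq[u ux] : q x = 0.
    have : p (i k + a0 x) = 0 by rewrite e linear0.
    by rewrite linearD a0E (_ : p (i k) = 0) ?add0r //; apply/ip; exists k.
  exists u; apply: pair_ext => //=; rewrite -[k]opprK; congr (- _).
  by apply: i_inj; rewrite a1E ux linearN; apply/eqP; rewrite -subr_eq0 opprK addrC e.
have surj : surjection (copair i a0).
  move=> l; have [x xE] := q_surj (p l).
  have [|k kE] := (ip (l - a0 x)).1; first by rewrite linearB a0E xE subrr.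
  by exists (k, x); rewrite copairE /= kE subrK.
apply: tensor_map_inj => x x0.
pose inK : {linear K -> (K * P)%type} := pairl idfun \0.
have [|w wE] := (tensor_right_exact ker surj (tmap inK x)).1.
  by rewrite (@tensor_map_comp _ _ _ _ _ i) // => k; rewrite copairE /= linear0 addr0.
have w0 : w = 0.
  apply: tj_inj; rewrite tensor_map0.
  rewrite -(@tensor_map_comp _ _ _ d (copair \0 idfun : {linear (K * P)%type -> P})); last first.
    by move=> u; rewrite copairE /= add0r.
  rewrite wE (@tensor_map_comp _ _ _ _ _ \0) ?tensor_map_zero // => k.
  by rewrite copairE /= addr0.
move: wE; rewrite w0 tensor_map0 => /(congr1 (tmap (copair idfun \0 : {linear (K * P)%type -> K}))).
rewrite tensor_map0 (@tensor_map_comp _ _ _ _ _ idfun); last first.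
  by move=> k; rewrite copairE /= addr0.
move=> ->; elim/tensor_ind: x {x0} => s; rewrite tensor_map_class.
by congr tclass; rewrite -[LHS]map_id; apply: eq_map => -[].
Qed.

Lemma mono_Tor1 M :
  (forall K L (i : {linear K -> L}) (p : {linear L -> M}),
    short_exact i p -> injective (tmap i)) -> Tor1_vanishes B M.
Proof.
move=> mono P; have dE := @res_exact0 _ _ P.
have [K [i [i_inj iE]]] := kernel_exists (res_aug P).
have [|e eE] := @corestrict R K _ _ i (res_diff P 0) i_inj.
  by move=> y; apply/iE/dE; exists y.
have ti_inj : injective (tmap i).
  by apply: (mono _ _ i (res_aug P)); split=> //; exact: res_aug_surj.
have ee : exact (res_diff P 1) e.
  move=> y; split=> [ey|/(@res_exact _ _ P 0 y) y0].
    by apply/(@res_exact _ _ P 0 y); rewrite -eE ey linear0.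
  by apply: i_inj; rewrite eE y0 linear0.
have es : surjection e.
  move=> k; have [|y yE] := (dE (i k)).1; first by apply/iE; exists k.
  by exists y; apply: i_inj; rewrite eE.
move=> x; rewrite -(tensor_right_exact ee es x).
rewrite -(tensor_map_comp eE); split=> [h|->]; last exact: tensor_map0.
by apply: ti_inj; rewrite h tensor_map0.
Qed.

Lemma projective_Tor1 P M U (j : {linear U -> P}) (q : {linear P -> M}) :
  projective P -> short_exact j q -> injective (tmap j) -> Tor1_vanishes B M.
Proof.
move=> prP ex tj; apply: mono_Tor1 => K L i p.
exact: projective_Tor1_mono prP ex tj.
Qed.

Lemma Tor1_mono M : Tor1_vanishes B M ->
  forall K L (i : {linear K -> L}) (p : {linear L -> M}),
    short_exact i p -> injective (tmap i).
Proof.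
move=> T0 K L i p; have [P _] := resolution_exists M; have dE := @res_exact0 _ _ P.
have [U [j [j_inj jE]]] := kernel_exists (res_aug P).
have [|e eE] := @corestrict R U _ _ j (res_diff P 0) j_inj.
  by move=> y; apply/jE/dE; exists y.
apply: (@projective_Tor1_mono (P 0) M U K L j (res_aug P)).
- exact: res_projective.
- by split=> //; exact: res_aug_surj.
have ee : exact (res_diff P 1) e.
  move=> y; split=> [ey|/(@res_exact _ _ P 0 y) y0].
    by apply/(@res_exact _ _ P 0 y); rewrite -eE ey linear0.
  by apply: j_inj; rewrite eE y0 linear0.
have es : surjection e.
  move=> k; have [|y yE] := (dE (j k)).1; first by apply/jE; exists k.
  by exists y; apply: j_inj; rewrite eE.
apply: tensor_map_inj => x; have [y <-] := tensor_map_surj es x.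
rewrite (tensor_map_comp eE) => /(T0 P)[z <-].
by apply/(tensor_right_exact ee es); exists z.
Qed.

End Tensor.

(** * Purity *)

Section Purity.
Variable R : pzRingType.
Implicit Types (E H K L M N P Q S U : lmodType R) (X Y : lmodType R -> Prop).

Lemma eq_lc_in (T : eqType) M (phi psi : T -> M) (l : seq (R * T)) :
  {in [seq x.2 | x <- l], phi =1 psi} -> lc phi l = lc psi l.
Proof.
move=> e; rewrite /lc !big_seq; apply: eq_bigr => x xl; rewrite e //.
exact: map_f.
Qed.

Definition terms (T : Type) (rho : seq (seq (R * T))) : seq T :=
  flatten [seq [seq x.2 | x <- l] | l <- rho].

Lemma eq_lc_terms (T : eqType) M (phi psi : T -> M) rho l :
  {in terms rho, phi =1 psi} -> l \in rho -> lc phi l = lc psi l.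
Proof.
move=> e lr; apply: eq_lc_in => t tl; apply: e; apply/flattenP.
by exists [seq x.2 | x <- l] => //; exact: map_f.
Qed.

(** Every finite system of linear relations satisfied in [N] lifts to [M]; the
    lift is recorded by a plain function [psi] instead of by unknowns. *)
Definition pure_epi M N (p : {linear M -> N}) : Prop :=
  forall (s : seq N) (rho : seq (seq (R * N))), {in rho, forall l, lc id l = 0} ->
    exists psi : N -> M, {in s, forall n, p (psi n) = n} /\
      {in rho, forall l, lc psi l = 0}.

(** Every finite system of linear relations of [M] with parameters in [L] is
    realized in [L]. *)
Definition pure_mono L M (i : {linear L -> M}) : Prop :=
  forall (s : seq L) (rho : seq (seq (R * M))), {in rho, forall l, lc id l = 0} ->
    exists phi : M -> L, {in s, forall x, phi (i x) = x} /\
      {in rho, forall l, lc phi l = 0}.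

Lemma pure_epi_surj M N (p : {linear M -> N}) : pure_epi p -> surjection p.
Proof.
by move=> pp n; have [//|psi [h _]] := pp [:: n] [::]; exists (psi n); rewrite h // mem_head.
Qed.

(** If [psi] lifts the relations along [p], then [m - psi (p m)] lies in [L] and
    realizes them there. *)
Lemma pure_epi_mono L M N (i : {linear L -> M}) (p : {linear M -> N}) :
  short_exact i p -> pure_epi p -> pure_mono i.
Proof.
move=> [i_inj ip _] pp s rho rho0.
(* the extra relation 1 *: 0 = 0 makes psi vanish at 0, so that phi fixes L *)
have [|psi [psiP psi0]] := pp (0 :: [seq p m | m <- terms rho])
   ([:: (1, 0)] :: [seq fmap p l | l <- rho]).
  move=> l; rewrite inE => /orP[/eqP->|/mapP[l' l'r ->]]; first by rewrite lc1 scaler0.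
  by rewrite lc_map -(lc_linear p id) rho0 ?linear0.
have psi00 : psi 0 = 0.
  by have := psi0 _ (mem_head _ _); rewrite lc1 scale1r.
have /choice[phi phiE] : forall m, exists x, p (psi (p m)) = p m -> i x = m - psi (p m).
  move=> m; case: (pselect (p (psi (p m)) = p m)) => [e|]; last by exists 0.
  by have [|x xE] := (ip (m - psi (p m))).1; [rewrite linearB e subrr|exists x].
have pi x : p (i x) = 0 by apply/ip; exists x.
exists phi; split=> [x _|l lr].
  by apply: i_inj; rewrite phiE pi psi00 ?subr0 // linear0.
apply: i_inj; rewrite linear0 lc_linear.
rewrite (@eq_lc_terms _ _ _ (fun m => m - psi (p m)) rho) //; last first.
  move=> m mr /=; apply: phiE; apply: psiP.
  by rewrite inE map_f ?orbT.
rewrite lcB rho0 // -[X in _ - X](lc_map p psi) psi0 ?subrr //.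
by rewrite inE map_f ?orbT.
Qed.

(** The finitely many relations responsible for an equality over [M] are realized
    in [L], where they yield the same equality. *)
Lemma pure_mono_tensor (B : lmodType R^c) L M (i : {linear L -> M}) :
  pure_mono i -> injective (@tensor_map R B _ _ i).
Proof.
move=> pi; apply: tensor_map_inj; elim/tensor_ind=> s.
rewrite tensor_map_class => /tclassP/tensor_derivation[rho [rho0 rhoP]].
have [phi [phiE phi0]] := pi [seq x.2 | x <- s] rho rho0.
apply/tclassP; have := rhoP _ phi phi0; rewrite -map_comp.
rewrite (_ : map _ s = s) //.
rewrite -[RHS]map_id; apply/eq_in_map => -[b m] xs /=.
by rewrite phiE //; apply: (map_f snd xs).
Qed.

Lemma pure_epi_exact L M N (i : {linear L -> M}) (p : {linear M -> N}) :
  short_exact i p -> pure_epi p -> pure_exact i p.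
Proof.
move=> ex pp; split=> // B; have [i_inj ip p_surj] := ex; split.
- exact/pure_mono_tensor/(pure_epi_mono ex).
- exact: tensor_right_exact.
- exact: tensor_map_surj.
Qed.

Lemma pure_injective_extend L M N E (i : {linear L -> M}) (p : {linear M -> N}) :
  pure_injective E -> short_exact i p -> pure_epi p -> extends_along E i.
Proof.
move=> pE ex pp f; have [_ _ /(_ f)[g gE]] := pE _ _ _ _ _ (pure_epi_exact ex pp).
by exists g => x; exact: gE.
Qed.

Lemma iso_pure_epi M N (f : {linear M -> N}) : bijective f -> pure_epi f.
Proof.
move=> [g fK gK] s rho rho0; exists g; split=> [n _|l lr]; first exact: gK.
apply: (can_inj fK); rewrite linear0 lc_linear -(rho0 l lr).
by apply: eq_lc => n /=; rewrite gK.
Qed.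

Definition closed_sums X : Prop :=
  forall (I : Type) (E : I -> lmodType R) S (inj : forall i, {linear E i -> S}),
    is_dsum inj -> (forall i, X (E i)) -> X S.

Definition closed_products X : Prop :=
  forall (I : Type) (E : I -> lmodType R) P (pr : forall i, {linear P -> E i}),
    is_prod pr -> (forall i, X (E i)) -> X P.

Definition closed_pure_quotients X : Prop :=
  forall M N (p : {linear M -> N}), pure_epi p -> X M -> X N.

Definition closed_pure_submodules X : Prop :=
  forall L M (i : {linear L -> M}), pure_mono i -> X M -> X L.

Definition closed_extensions X : Prop :=
  forall K L M (i : {linear K -> L}) (p : {linear L -> M}),
    short_exact i p -> X K -> X M -> X L.

Lemma pure_quotients_iso X : closed_pure_quotients X -> iso_closed X.
Proof. by move=> cX M N [f /iso_pure_epi fP]; exact: cX fP. Qed.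

Lemma closed_sumsI X Y : closed_sums X -> closed_sums Y -> closed_sums (classI X Y).
Proof.
move=> cX cY I E S inj dS XY; split.
  by apply: cX dS _ => i; have [] := XY i.
by apply: cY dS _ => i; have [] := XY i.
Qed.

Lemma closed_productsI X Y :
  closed_products X -> closed_products Y -> closed_products (classI X Y).
Proof.
move=> cX cY I E S inj dS XY; split.
  by apply: cX dS _ => i; have [] := XY i.
by apply: cY dS _ => i; have [] := XY i.
Qed.

Lemma closed_pure_quotientsI X Y :
  closed_pure_quotients X -> closed_pure_quotients Y ->
  closed_pure_quotients (classI X Y).
Proof. by move=> cX cY M N p pp [XM YM]; split; [exact: cX pp XM|exact: cY pp YM]. Qed.

Lemma closed_pure_submodulesI X Y :
  closed_pure_submodules X -> closed_pure_submodules Y ->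
  closed_pure_submodules (classI X Y).
Proof. by move=> cX cY M N p pp [XM YM]; split; [exact: cX pp XM|exact: cY pp YM]. Qed.

Lemma closed_extensionsI X Y :
  closed_extensions X -> closed_extensions Y -> closed_extensions (classI X Y).
Proof.
by move=> cX cY K L M i p ex [XK YK] [XM YM]; split; [exact: cX ex XK XM|exact: cY ex YK YM].
Qed.

(** * Pullbacks and extensions *)

Lemma pullback_exists L M N (u : {linear L -> N}) (v : {linear M -> N}) :
  exists Q (a : {linear Q -> L}) (b : {linear Q -> M}),
    [/\ forall x, u (a x) = v (b x),
        forall x y, a x = a y -> b x = b y -> x = y
      & forall l m, u l = v m -> exists x, a x = l /\ b x = m].
Proof.
have [Q [j [j_inj jE]]] := kernel_exists (copair u (\- v : {linear M -> N})).
pose a : {linear Q -> L} := copair idfun \0 \o j.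
pose b : {linear Q -> M} := copair \0 idfun \o j.
have aE x : a x = (j x).1 by rewrite /a /= addr0.
have bE x : b x = (j x).2 by rewrite /b /= add0r.
exists Q, a, b; split.
- move=> x; have : copair u (\- v : {linear M -> N}) (j x) = 0 by apply/jE; exists x.
  by rewrite aE bE copairE => /subr0_eq.
- by move=> x y; rewrite !aE !bE => e1 e2; apply: j_inj; exact: pair_ext.
- move=> l m e; have /jE[x xE] : copair u (\- v : {linear M -> N}) (l, m) = 0.
    by rewrite copairE /= e subrr.
  by exists x; rewrite aE bE xE.
Qed.

Lemma pullback_short_exact K L M N (i : {linear K -> L}) (p : {linear L -> N})
    (q : {linear M -> N}) : short_exact i p ->
  exists Q (a : {linear Q -> L}) (b : {linear Q -> M}) (u : {linear K -> Q}),
    [/\ short_exact u b, forall x, p (a x) = q (b x),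
        forall x y, a x = a y -> b x = b y -> x = y,
        forall l m, p l = q m -> exists x, a x = l /\ b x = m
      & forall k, a (u k) = i k].
Proof.
move=> [i_inj ip p_surj]; have [Q [a [b [ab ab_inj abS]]]] := pullback_exists p q.
have pi k : p (i k) = 0 by apply/ip; exists k.
have [||u uE] := @corestrict R Q _ K (pairl a b) (pairl i \0).
- by move=> x y [e1 e2]; exact: ab_inj.
- move=> k; have [|x [ax bx]] := abS (i k) 0; first by rewrite pi linear0.
  by exists x; rewrite !pairlE ax bx.
have au k : a (u k) = i k by have := uE k; rewrite !pairlE => -[].
have bu k : b (u k) = 0 by have := uE k; rewrite !pairlE => -[].
exists Q, a, b, u; split=> //; split.
- by move=> k k' e; apply: i_inj; rewrite -!au e.
- move=> x; split=> [bx|[k <-]]; last exact: bu.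
  have [|k kE] := (ip (a x)).1; first by rewrite ab bx linear0.
  by exists k; apply: ab_inj; rewrite ?au ?bu.
- by move=> m; have [l lE] := p_surj (q m); have [x [_ <-]] := abS _ _ lE; exists x.
Qed.

(** The extension pulled back along [h] splits. *)
Lemma Ext1_lift M N L Q (i : {linear N -> L}) (p : {linear L -> Q})
    (h : {linear M -> Q}) : Ext1_vanishes M N -> short_exact i p ->
  exists s : {linear M -> L}, forall m, p (s m) = h m.
Proof.
move=> E ex; have [P [a [b [u [exu ab ab_inj abS au]]]]] := pullback_short_exact h ex.
have [r rE] := Ext1_split E exu; have [u_inj ub b_surj] := exu.
have [i_inj ip p_surj] := ex.
have [|s sE] := @descend R P M L b (a \- (i \o r)) b_surj.
  by move=> x /ub[n <-] /=; rewrite au rE subrr.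
exists s => m; have [x <-] := b_surj m; rewrite sE /= linearB ab.
by rewrite (_ : p (i _) = 0) ?subr0 //; apply/ip; exists (r x).
Qed.

Lemma section_retraction K L M (i : {linear K -> L}) (p : {linear L -> M})
    (s : {linear M -> L}) : short_exact i p -> (forall m, p (s m) = m) ->
  exists r : {linear L -> K}, forall k, r (i k) = k.
Proof.
move=> [i_inj ip p_surj] ps.
have [|r rE] := @corestrict R K L L i (idfun \- (s \o p)) i_inj.
  by move=> l; apply/ip; rewrite /= linearB ps subrr.
exists r => k; apply: i_inj; rewrite rE /= (_ : p (i k) = 0) ?linear0 ?subr0 ?addr0 ?addr0 //.
by apply/ip; exists k.
Qed.

(** The third isomorphism theorem for [N -> E -> L]. *)
Lemma short_exact_comp N E L H M (n : {linear N -> E}) (p : {linear E -> H})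
    (i : {linear E -> L}) (q : {linear L -> M}) :
  short_exact n p -> short_exact i q ->
  exists Q (t : {linear L -> Q}) (i' : {linear H -> Q}) (q' : {linear Q -> M}),
    [/\ short_exact (i \o n) t, short_exact i' q' & forall l, q' (t l) = q l].
Proof.
move=> [n_inj np p_surj] [i_inj iq q_surj].
have [Q [t [t_surj tE]]] := quotient_exists (subm_im (i \o n)).
have qi x : q (i x) = 0 by apply/iq; exists x.
have [|q' q'E] := @descend R L Q M t q t_surj.
  by move=> l /tE[x <-]; exact: qi.
have [|i' i'E] := @descend R E H Q p (t \o i) p_surj.
  by move=> x /np[y <-]; apply/tE; exists y.
exists Q, t, i', q'; split=> //; split=> //.
- by move=> x y /i_inj/n_inj.
- apply: linear_inj => h; have [x <-] := p_surj h; rewrite i'E => /tE[y /i_inj <-].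
  by apply/np; exists y.
- move=> x; have [l <-] := t_surj x; rewrite q'E; split.
    by move=> /iq[y <-]; exists (p y); rewrite i'E.
  move=> [h]; have [y <-] := p_surj h; rewrite i'E /= => e.
  have /tE[z zE] : t (i y - l) = 0 by rewrite linearB e subrr.
  apply/iq; exists (y - n z); rewrite linearB /=.
  by move: zE => /= ->; rewrite opprB addrC subrK.
- by move=> m; have [l <-] := q_surj m; exists (t l).
Qed.

(** The middle term [Q] is the inverse image of [M'] in [L]. *)
Lemma presentation_extension K L M M' M'' (i : {linear K -> L}) (p : {linear L -> M})
    (j : {linear M' -> M}) (q : {linear M -> M''}) :
  short_exact i p -> short_exact j q ->
  exists Q (u : {linear K -> Q}) (u' : {linear Q -> M'}) (v : {linear Q -> L}),
    [/\ short_exact u u', short_exact v (q \o p) & forall k, v (u k) = i k].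
Proof.
move=> ex [j_inj jq q_surj].
have [Q [v [b [u [exu vb v_inj vS vu]]]]] := pullback_short_exact j ex.
have [_ _ p_surj] := ex.
exists Q, u, b, v; split=> //; split.
- by move=> x y e; apply: v_inj => //; apply: j_inj; rewrite -!vb e.
- move=> l; split=> /=.
    by move=> /jq[m' m'E]; have [x [<- _]] := vS l m' (esym m'E); exists x.
  by move=> [x <-]; rewrite vb; apply/jq; exists (b x).
- move=> m; have [m1 <-] := q_surj m; have [l <-] := p_surj m1.
  by exists l.
Qed.

(** * Closure properties of left orthogonals and of kernels of Tor *)

(** Sections over the summands assemble to a section over the direct sum. *)
Lemma left_perp_sums (C : lmodType R -> Prop) : closed_sums (left_perp C).
Proof.
move=> I E S inj dS CE N CN; apply: split_Ext1 => L i p ex.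
have /dep_choice[s sE] : forall j, exists s : {linear E j -> L}, forall e, p (s e) = inj j e.
  by move=> j; exact: (Ext1_lift (inj j) (CE j N CN) ex).
have [t tE] := dS.2 L s; apply: (@section_retraction _ _ _ i p t) => // x.
by rewrite -[RHS]/(idfun x); apply: (dsum_gen_eq dS (f := p \o t) (g := idfun)) => j e /=; rewrite tE sE.
Qed.

(** Pull the presentation [K -> L -> N] back to [M].  A map [f] on [K] extends to
    the pullback [Q]; its restriction to the kernel [M'] of [q] extends to [M] by
    purity, and subtracting this extension makes the map descend to [L]. *)
Lemma left_perp_pure_quotients (C : lmodType R -> Prop) :
  (forall N, C N -> pure_injective N) -> closed_pure_quotients (left_perp C).
Proof.
move=> pC M N q pq CM E CE; apply: extend_Ext1 => K L i p ex f.
have [Q [a [b [u [exu ab ab_inj abS au]]]]] := pullback_short_exact q ex.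
have [g gE] := Ext1_extend (CM E CE) exu f.
have [M' [j [j_inj jE]]] := kernel_exists q.
have exj : short_exact j q by split=> //; exact: pure_epi_surj.
have [_ ub _] := exu; have bu k : b (u k) = 0 by apply/ub; exists k.
have [_ _ p_surj] := ex.
have [||w wE] := @corestrict R Q (L * M)%type M' (pairl a b) (pairl \0 j).
- by move=> x y [e1 e2]; exact: ab_inj.
- move=> m; have [|x [ax bx]] := abS 0 (j m).
    by rewrite linear0; apply/esym/jE; exists m.
  by exists x; rewrite !pairlE ax bx.
have bw m : b (w m) = j m by have := wE m; rewrite !pairlE => -[].
have aw m : a (w m) = 0 by have := wE m; rewrite !pairlE => -[].
have [g' g'E] := pure_injective_extend (pC E CE) exj pq (g \o w).
have [||h hE] := @descend R Q L E a (g \- (g' \o b)).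
- move=> l; have [m mE] := pure_epi_surj pq (p l).
  by have [x [<- _]] := abS l m (esym mE); exists x.
- move=> x ax; have /jE[m mE] : q (b x) = 0 by rewrite -ab ax linear0.
  have -> : x = w m by apply: ab_inj; rewrite ?aw ?bw.
  by rewrite /= bw g'E subrr.
by exists h => k; rewrite -au hE /= bu linear0 subr0 gE.
Qed.

(** An equality over [L] is derived from finitely many relations.  A lift of their
    images in [N] along [q] turns it into an equality over the pullback [Q], which
    is a presentation of [M]. *)
Lemma KerTor1_pure_quotients (B : lmodType R^c -> Prop) :
  closed_pure_quotients (KerTor1 B).
Proof.
move=> M N q pq BM b Bb; apply: mono_Tor1 => K L i p ex.
have [Q [a [c [u [exu ac ac_inj acS au]]]]] := pullback_short_exact q ex.
have [_ uc _] := exu; have cu k : c (u k) = 0 by apply/uc; exists k.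
have [_ ip _] := ex; have pi k : p (i k) = 0 by apply/ip; exists k.
have tu := Tor1_mono (BM b Bb) exu.
apply: tensor_map_inj; elim/tensor_ind=> s.
rewrite tensor_map_class => /tclassP/tensor_derivation[rho [rho0 rhoP]].
(* adding the relation 0 = 0 forces psi 0 = 0, hence phi (i k) = u k *)
have [|psi [psiP psi0]] := pq (0 :: [seq p m | m <- terms rho])
   ([:: (1, 0)] :: [seq fmap p l | l <- rho]).
  move=> l; rewrite inE => /orP[/eqP->|/mapP[l' l'r ->]]; first by rewrite lc1 scaler0.
  by rewrite lc_map -(lc_linear p id) rho0 ?linear0.
have psi00 : psi 0 = 0.
  by have := psi0 _ (mem_head _ _); rewrite lc1 scale1r.
have /choice[phi phiE] : forall l, exists x,
    p l = q (psi (p l)) -> a x = l /\ c x = psi (p l).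
  move=> l; case: (pselect (p l = q (psi (p l)))) => [e|]; last by exists 0.
  by have [x] := acS _ _ e; exists x.
have phiS l : l \in terms rho -> a (phi l) = l /\ c (phi l) = psi (p l).
  by move=> lr; apply: phiE; rewrite psiP // inE map_f ?orbT.
have phi0 : {in rho, forall l, lc phi l = 0}.
  move=> l lr; apply: ac_inj; rewrite linear0 lc_linear.
    rewrite -(rho0 l lr); apply: (eq_lc_terms _ lr) => m /phiS[] //=.
  rewrite (eq_lc_terms (psi := psi \o p) _ lr); last by move=> m /phiS[].
  by rewrite -lc_map psi0 // inE map_f ?orbT.
apply: tu; rewrite tensor_map0 tensor_map_class; apply/tclassP.
have := rhoP _ phi phi0; rewrite -map_comp.
rewrite (_ : map _ s = [seq (x.1, u x.2) | x <- s]) //.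
apply: eq_map => -[d k] /=; congr pair; have [|e1 e2] := phiE (i k).
  by rewrite pi psi00 linear0.
by apply: ac_inj; rewrite ?e1 ?e2 ?au ?cu ?pi.
Qed.

Lemma KerTor1_extensions (B : lmodType R^c -> Prop) : closed_extensions (KerTor1 B).
Proof.
move=> M' M M'' j q exj BM' BM'' b Bb; apply: mono_Tor1 => K L i p ex.
have [Q [u [u' [v [exu exv vu]]]]] := presentation_extension ex exj.
move=> x y; rewrite -!(tensor_map_comp vu).
by move=> /(Tor1_mono (BM'' b Bb) exv)/(Tor1_mono (BM' b Bb) exu).
Qed.

(** The direct sum of projective presentations is a presentation of the sum, and
    an element of the tensor product is the sum of finitely many of its
    components. *)
Lemma KerTor1_sums (B : lmodType R^c -> Prop) : closed_sums (KerTor1 B).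
Proof.
move=> I E S inj dS BE b Bb.
have /dep_choice[P] : forall i, exists P, exists q : {linear P -> E i},
    projective P /\ surjection q.
  move=> i; have [T [F [c [q [cF q_surj]]]]] := free_cover (E i).
  by exists F, q; split=> //; exact: free_projective cF.
move=> /dep_choice[q qP].
have /dep_choice[U] : forall i, exists U, exists j : {linear U -> P i},
   short_exact j (q i).
  move=> i; have [U [j [j_inj jE]]] := kernel_exists (q i).
  by exists U, j; split=> //; exact: (qP i).2.
move=> /dep_choice[j jP].
have [PS [inP dP]] := dsum_exists P.
have [pr [pr1 pr0]] := dsum_proj dP.
have [pq pqE] := dP.2 S (fun i => inj i \o q i).
have pq_surj : surjection pq.
  move=> x; have [l ->] := dS.1 x.
  have /dep_choice[s sE] : forall i, exists s : E i -> P i, forall e, q i (s e) = e.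
    by move=> i; have /choice[s sE] := (qP i).2; exists s.
  exists (\sum_(p <- l) inP (projT1 p) (s _ (projT2 p))); rewrite linear_sum.
  by apply: eq_bigr => p _; rewrite pqE /= sE.
have [K [k [k_inj kE]]] := kernel_exists pq.
have exk : short_exact k pq by split.
apply: (projective_Tor1 (dsum_projective dP (fun i => (qP i).1)) exk).
have [prS [prS1 prS0]] := dsum_proj dS.
have pr_pq i x : prS i (pq x) = q i (pr i x).
  apply: (dsum_gen_eq dP (f := prS i \o pq) (g := q i \o pr i)) => i' e /=.
  rewrite pqE /=; case: (pselect (i' = i)) => [ii|ii]; last by rewrite prS0 // pr0 // linear0.
  by case: i / ii; rewrite prS1 pr1.
have /dep_choice[prK prKE] : forall i, exists f : {linear K -> U i},
    forall x, j i (f x) = pr i (k x).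
  move=> i; have [j_inj jq _] := jP i; apply: (@corestrict R _ _ _ (j i) (pr i \o k)) => // x.
  by apply/jq; rewrite /= -pr_pq (_ : pq (k x) = 0) ?linear0 //; apply/kE; exists x.
have /dep_choice[inK inKE] : forall i, exists f : {linear U i -> K},
    forall x, k (f x) = inP i (j i x).
  move=> i; have [j_inj jq _] := jP i; apply: (@corestrict R _ _ _ k (inP i \o j i)) => // x.
  by apply/kE; rewrite /= pqE /= (_ : q i _ = 0) ?linear0 //; apply/jq; exists x.
apply: tensor_map_inj => x kx.
have prx i : tensor_map (B := b) (prK i) x = 0.
  apply: (Tor1_mono (BE i b Bb) (jP i)).
  rewrite (@tensor_map_comp R b _ _ _ (prK i) (j i) (pr i \o k)); last exact: prKE.
  by rewrite -(@tensor_map_comp R b _ _ _ k (pr i) (pr i \o k)) // kx !tensor_map0.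
have [J uJ JE] : exists2 J : seq {classic I}, uniq J &
    x = \sum_(i <- J) tensor_map (inK (i : I)) (tensor_map (prK i) x).
  elim/tensor_ind: x {kx prx} => s.
  have [J [uJ JE]] : exists J : seq {classic I}, uniq J /\ forall J', uniq J' ->
      {subset J <= J'} -> {in s, forall y, y.2 = \sum_(i <- J') inK (i : I) (prK i y.2)}.
    elim: s => [|y s [J [uJ JE]]]; first by exists [::].
    have [J1 [uJ1 J1E]] := dsum_decomp dP pr1 pr0 (k y.2).
    exists (undup (J ++ J1)); split=> [|J' uJ' sJ']; first exact: undup_uniq.
    have sub1 : {subset J <= J'} by move=> i iJ; apply: sJ'; rewrite mem_undup mem_cat iJ.
    have sub2 : {subset J1 <= J'} by move=> i iJ; apply: sJ'; rewrite mem_undup mem_cat iJ orbT.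
    move=> z; rewrite inE => /orP[/eqP->|zs]; last exact: JE.
    apply: k_inj; rewrite (J1E J' uJ' sub2) linear_sum; apply: eq_bigr => i _.
    by rewrite inKE prKE.
  exists J => //; rewrite [LHS]tclassE.
  under [RHS]eq_bigr => i _ do rewrite !tensor_map_class -map_comp tclassE big_map /=.
  rewrite exchange_big /= !big_seq; apply: eq_bigr => y ys.
  rewrite {1}(JE J uJ (fun _ => id) y ys).
  elim: J {uJ JE} => [|i J IHJ]; first by rewrite !big_nil tens0r.
  by rewrite !big_cons tensDr IHJ.
by rewrite JE big1 // => i _; rewrite prx tensor_map0.
Qed.

Lemma scale_linear M (x : M) : linear ((fun t : R => t *: x) : R^o -> M).
Proof. by move=> t u v; rewrite scalerDl scalerA. Qed.

Lemma ring_projective : projective (R^o : lmodType R).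
Proof.
move=> M N p f p_surj; have [m mE] := p_surj (f 1).
exists (linear_of (scale_linear m)) => x; rewrite linear_ofE linearZ /= mE -linearZ.
by congr (f _); exact: mulr1.
Qed.

Lemma projective_KerTor1 (B : lmodType R^c -> Prop) P : projective P -> KerTor1 B P.
Proof.
move=> prP b Bb.
have [U [j [j_inj jE]]] := kernel_exists (idfun : {linear P -> P}).
apply: (@projective_Tor1 R b P P U j idfun) => //.
  by split=> // x; exists x.
apply: tensor_map_inj => x _.
have U0 (z : U) : z = 0.
  by apply: j_inj; rewrite linear0; apply/(jE (j z)); exists z.
elim/tensor_ind: x => s; rewrite tclassE big1 // => y _.
by rewrite (U0 y.2) tens0r.
Qed.

End Purity.

(** * Free modules of finite rank and coherence *)

Section Rows.
Variable R : pzRingType.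
Implicit Types (K L M N P Q S U : lmodType R).

Lemma row_map_linear n N (v : 'I_n -> N) :
  linear (fun x : 'rV[R]_n => \sum_i x 0 i *: v i).
Proof.
move=> a x y; rewrite scaler_sumr -big_split; apply: eq_bigr => i _ /=.
by rewrite !mxE scalerDl scalerA.
Qed.

Definition row_map n N (v : 'I_n -> N) : {linear 'rV[R]_n -> N} :=
  linear_of (row_map_linear v).

Lemma row_mapE n N (v : 'I_n -> N) x : row_map v x = \sum_i x 0 i *: v i.
Proof. by []. Qed.

Lemma row_map_of n N (f : {linear 'rV[R]_n -> N}) x :
  f x = \sum_i x 0 i *: f 'e_i.
Proof.
by rewrite {1}(row_sum_delta x) linear_sum; apply: eq_bigr => i _; rewrite linearZ.
Qed.

Lemma row_map_delta n N (v : 'I_n -> N) i : row_map v 'e_i = v i.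
Proof.
rewrite row_mapE (bigD1 i) //= mxE !eqxx scale1r big1 ?addr0 // => j ji.
by rewrite mxE eqxx (negbTE ji) scale0r.
Qed.

Lemma row_map_eq n N (f g : {linear 'rV[R]_n -> N}) :
  (forall i, f 'e_i = g 'e_i) -> f =1 g.
Proof.
by move=> fg x; rewrite row_map_of [RHS]row_map_of; apply: eq_bigr => i _; rewrite fg.
Qed.

Lemma row_projective n : projective ('rV[R]_n : lmodType R).
Proof.
move=> M N p f /choice[s sE]; exists (row_map (fun i => s (f 'e_i))).
apply: (@row_map_eq n N (p \o row_map _) f) => i.
by rewrite -[LHS]/(p (row_map _ 'e_i)) row_map_delta sE.
Qed.

Definition row_comb n T (x : 'rV[R]_n) (t : 'I_n -> T) : seq (R * T) :=
  [seq (x 0 i, t i) | i <- index_enum 'I_n].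

Lemma lc_row_comb n T N (x : 'rV[R]_n) (t : 'I_n -> T) (phi : T -> N) :
  lc phi (row_comb x t) = row_map (phi \o t) x.
Proof. by rewrite /lc big_map. Qed.

(** With lifts [al] and [be] between the two presentations, [x] in the kernel of
    [p] is the sum of [x - be (al x)] and of the image of a relation of the given
    finite presentation. *)
Lemma fp_kernel M n (p : {linear 'rV[R]_n -> M}) :
  finitely_presented M -> surjection p ->
  exists m (c : {linear 'rV[R]_m -> 'rV[R]_n}), exact c p.
Proof.
move=> [m1 [n1 [q1 [p1 [q1p1 p1_surj]]]]] p_surj.
have [al alE] := row_projective p p1_surj.
have [be beE] := row_projective p1 p_surj.
have pbq y : p (be (q1 y)) = 0 by rewrite beE; apply/q1p1; exists y.
pose c1 : {linear 'rV[R]_n -> 'rV[R]_n} := idfun \- (be \o al).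
pose c2 : {linear 'rV[R]_m1 -> 'rV[R]_n} := be \o q1.
exists (n + m1)%N, ((c1 \o lsubmx) \+ (c2 \o rsubmx)) => x; split=> [px|[z <-]].
  have [|y yE] := (q1p1 (al x)).1; first by rewrite alE.
  exists (row_mx x y); rewrite /= row_mxKl row_mxKr /c1 /c2 /= yE.
  by rewrite subrK.
by rewrite /= linearD /c1 /c2 /= pbq addr0 linearB /= beE alE subrr.
Qed.

(** By induction on [n]: the first coordinate of [q] has a finitely generated left
    ideal as its image, hence a finitely generated kernel, and on the free module
    covering that kernel only [n] coordinates remain. *)
Lemma coherent_kernel : left_coherent R -> forall n m (q : {linear 'rV[R]_m -> 'rV[R]_n}),
  exists p (c : {linear 'rV[R]_p -> 'rV[R]_m}), exact c q.
Proof.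
move=> coh; elim=> [|n IHn] m q.
  exists m, idfun => x; split=> [_|[u _]]; first by exists x.
  by apply/rowP => -[].
have hP : linear (fun x : 'rV[R]_m => q x 0 0 : R^o).
  by move=> a x y; rewrite linearP !mxE.
pose h := linear_of hP.
have [I [i [i_inj iE]]] := sub_exists (subm_im h).
have [|e eE] := @corestrict R I R^o 'rV[R]_m i h i_inj.
  by move=> x; apply/iE; exists x.
have e_surj : surjection e.
  by move=> y; have [|x xE] := (iE (i y)).2; [exists y|exists x; apply: i_inj; rewrite eE].
have [|p1 [c1 c1E]] := fp_kernel (coh I i i_inj _) e_surj.
  by exists m, e.
pose q' : {linear 'rV[R]_m -> 'rV[R]_(1 + n)} := q.
pose tl : {linear 'rV[R]_(1 + n) -> 'rV[R]_n} := rsubmx.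
have [p [c2 c2E]] := IHn p1 (tl \o q' \o c1).
exists p, (c1 \o c2) => x; split=> [qx|[z <-]].
  have [|y yE] := (c1E x).1.
    by apply: i_inj; rewrite eE linear0 linear_ofE qx mxE.
  have [|z zE] := (c2E y).1; first by rewrite /= yE [q' x]qx linear0.
  by exists z; rewrite /= zE.
have /eqP h0 : h (c1 (c2 z)) == 0.
  by rewrite -eE (_ : e _ = 0) ?linear0 //; apply/c1E; exists (c2 z).
have t0 : tl (q' (c1 (c2 z))) = 0 by apply/c2E; exists z.
rewrite -[LHS]/(q' (c1 (c2 z))) -[LHS]hsubmxK [rsubmx _]t0.
rewrite (_ : lsubmx _ = 0) ?row_mx0 //; apply/rowP => k.
rewrite ord1 mxE [RHS]mxE -[RHS]h0; congr (q' _ _ _); exact: val_inj.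
Qed.

End Rows.

(** * Closure properties of the orthogonal of finitely presented modules *)

Section RightPerp.
Variables (R : pzRingType) (A : lmodType R -> Prop).
Implicit Types (K L M N P Q S U : lmodType R).

Lemma right_perp_products : closed_products (right_perp A).
Proof.
move=> I E P pr dP AE M AM; apply: extend_Ext1 => K L i p ex f.
have /dep_choice[g gE] : forall j, exists g : {linear L -> E j},
    forall x, g (i x) = pr j (f x).
  by move=> j; exact: (Ext1_extend (AE j M AM) ex (pr j \o f)).
have [h hE] := prod_lift g dP; exists h => x; apply: dP.2 => j.
by rewrite hE gE.
Qed.

Lemma right_perp_extensions : closed_extensions (right_perp A).
Proof.
move=> N' N N'' j q exj AN' AN'' M AM.
apply: split_Ext1 => L i p ex.
have [Q [t [i' [p' [ext ex' p'E]]]]] := short_exact_comp exj ex.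
have [s sE] := Ext1_lift idfun (AN'' M AM) ex'.
have [s' s'E] := Ext1_lift s (AN' M AM) ext.
by apply: (@section_retraction R N L M i p s' ex) => m; rewrite -p'E s'E sE.
Qed.

Hypothesis fpA : forall M, A M -> finitely_presented M.

(** A map on the finitely generated syzygy extends to the free module exactly when
    a finite linear system is solvable, and purity moves a solution from [N] to
    the submodule. *)
Lemma right_perp_pure_submodules : closed_pure_submodules (right_perp A).
Proof.
move=> N' N i pi AN M AM; have [m [n [q [p [qp p_surj]]]]] := fpA AM.
have [U [j [j_inj jE]]] := kernel_exists p; have exj : short_exact j p by split.
apply: (projective_Ext1 (row_projective (n := n)) exj) => f.
have [g gE] := Ext1_extend (AN M AM) exj (i \o f).
have [|e eE] := @corestrict R U _ _ j q j_inj.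
  by move=> y; apply/jE/qp; exists y.
(* the unknowns are the images of the basis vectors *)
have [|phi [phiE phi0]] := pi [seq f (e 'e_k) | k <- enum 'I_m]
    [seq rcons (row_comb (q 'e_k) (fun l => g 'e_l)) (-1, i (f (e 'e_k))) | k <- enum 'I_m].
  move=> _ /mapP[k _ ->]; rewrite -cats1 lc_cat lc_row_comb lc1 scaleN1r.
  by rewrite -[row_map _ _](row_map_of g) -eE gE subrr.
exists (row_map (fun l => phi (g 'e_l))) => u.
have [y <-] : exists y, e y = u.
  have [|y yE] := (qp (j u)).1; first by apply/jE; exists u.
  by exists y; apply: j_inj; rewrite eE.
apply: (@row_map_eq R m N' (row_map _ \o j \o e) (f \o e)) => k /=.
have kI : k \in enum 'I_m by rewrite mem_enum.
rewrite eE; have := phi0 _ (map_f _ kI).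
rewrite -cats1 lc_cat lc_row_comb lc1 scaleN1r phiE; last exact: map_f.
by move/subr0_eq.
Qed.

(** A direct sum is pure in the product of the same family: truncating to
    finitely many coordinates is linear and fixes the given elements. *)
Lemma right_perp_sums : closed_sums (right_perp A).
Proof.
move=> I E S inj dS AE; have [P [pr dP]] := prod_exists E.
have [prS [prS1 prS0]] := dsum_proj dS.
have [i iE] := prod_lift prS dP.
apply: (right_perp_pure_submodules (i := i)); last exact: right_perp_products dP AE.
move=> s rho rho0.
have [J [uJ JE]] : exists J : seq {classic I}, uniq J /\
    {in s, forall x, x = \sum_(k <- J) inj (k : I) (prS k x)}.
  suff [J [uJ JE]] : exists J : seq {classic I}, uniq J /\ forall J', uniq J' ->
      {subset J <= J'} -> {in s, forall x, x = \sum_(k <- J') inj (k : I) (prS k x)}.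
    by exists J; split=> //; exact: JE.
  elim: s => [|y s [J [uJ JE]]]; first by exists [::].
  have [J1 [uJ1 J1E]] := dsum_decomp dS prS1 prS0 y.
  exists (undup (J ++ J1)); split=> [|J' uJ' sJ']; first exact: undup_uniq.
  have sub1 : {subset J <= J'} by move=> k kJ; apply: sJ'; rewrite mem_undup mem_cat kJ.
  have sub2 : {subset J1 <= J'} by move=> k kJ; apply: sJ'; rewrite mem_undup mem_cat kJ orbT.
  by move=> z; rewrite inE => /orP[/eqP->|zs]; [exact: J1E|exact: JE].
have phiP : linear (fun x => \sum_(k <- J) inj (k : I) (pr k x)).
  move=> a x y; rewrite scaler_sumr -big_split; apply: eq_bigr => k _ /=.
  by rewrite !linearP.
exists (linear_of phiP); split=> [x xs|l lr].
  rewrite linear_ofE {2}(JE x xs); apply: eq_bigr => k _.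
  by rewrite iE.
by rewrite -(lc_linear (linear_of phiP) id) rho0 ?linear0.
Qed.

(** Coherence makes the syzygy [U] finitely presented, so a map from [U] to the
    quotient lifts along [pi], extends to the free module, and is pushed forward
    again. *)
Lemma right_perp_pure_quotients : left_coherent R ->
  closed_pure_quotients (right_perp A).
Proof.
move=> coh N N'' pi ppi AN M AM; have [m [n [q [p [qp p_surj]]]]] := fpA AM.
have [U [j [j_inj jE]]] := kernel_exists p; have exj : short_exact j p by split.
have [r [c cq]] := coherent_kernel coh q.
apply: (projective_Ext1 (row_projective (n := n)) exj) => f.
have [|e eE] := @corestrict R U _ _ j q j_inj.
  by move=> y; apply/jE/qp; exists y.
have e_surj : surjection e.
  move=> u; have [|y yE] := (qp (j u)).1; first by apply/jE; exists u.
  by exists y; apply: j_inj; rewrite eE.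
have e0 y : e y = 0 <-> exists z, c z = y.
  rewrite -(cq y) -eE; split=> [->|ey]; first exact: linear0.
  by apply: j_inj; rewrite ey linear0.
pose v k := f (e 'e_k).
have vE : row_map v =1 f \o e.
  by apply: (@row_map_eq R m _ (row_map v) (f \o e)) => k; rewrite row_map_delta.
have [|psi [psiE psi0]] := ppi [seq v k | k <- enum 'I_m]
    [seq row_comb (c 'e_l) v | l <- enum 'I_r].
  move=> _ /mapP[l _ ->]; rewrite lc_row_comb [LHS]vE /= (_ : e _ = 0) ?linear0 //.
  by apply/e0; exists 'e_l.
have [|w wE] := @descend R _ U N e (row_map (psi \o v)) e_surj.
  move=> y /e0[z <-].
  suff /(_ z) : (row_map (psi \o v) \o c) =1 (\0 : {linear 'rV[R]_r -> N}) by [].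
  apply: row_map_eq => l; rewrite -[LHS]/(row_map (psi \o v) (c 'e_l)).
  rewrite -lc_row_comb psi0 //.
  by apply/mapP; exists l; rewrite ?mem_enum.
have [g gE] := Ext1_extend (AN M AM) exj w.
exists (pi \o g) => u; have [y <-] := e_surj u; rewrite /= gE wE.
rewrite -[RHS]vE.
apply: (@row_map_eq R m N'' (pi \o row_map (psi \o v)) (row_map v)) => k.
rewrite -[LHS]/(pi (row_map _ 'e_k)) !row_map_delta psiE //.
by apply/mapP; exists k; rewrite ?mem_enum.
Qed.

End RightPerp.

(** * Tor of modules with a finite free presentation of length two *)

Section FiniteTor.
Variables (R : pzRingType) (B : lmodType R^c) (m n r : nat).
Variables (c : {linear 'rV[R^c]_r -> 'rV[R^c]_m}) (q : {linear 'rV[R^c]_m -> 'rV[R^c]_n}).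
Variable p : {linear 'rV[R^c]_n -> B}.
Hypotheses (cq : exact c q) (qp : exact q p) (p_surj : surjection p).
Implicit Types (K L M N : lmodType R).

Let a k i : R := (q 'e_k) 0 i.
Let d l k : R := (c 'e_l) 0 k.

Let qE w i : (q w) 0 i = \sum_k a k i * (w 0 k : R) :> R.
Proof. by rewrite row_map_of summxE; apply: eq_bigr => k _; rewrite mxE. Qed.

Let cE w k : (c w) 0 k = \sum_l d l k * (w 0 l : R) :> R.
Proof. by rewrite row_map_of summxE; apply: eq_bigr => l _; rewrite mxE. Qed.

Let rowB K (w w' : 'rV[R^c]_n) i (x : K) :
  ((w - w') 0 i : R) *: x = (w 0 i : R) *: x - (w' 0 i : R) *: x.
Proof. by rewrite !mxE; exact: (scalerBl (w 0 i : R) (w' 0 i : R) x). Qed.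

Let rowZ K (t : R) (w : 'rV[R^c]_n) i (x : K) :
  (((t : R^c) *: w) 0 i : R) *: x = (w 0 i : R) *: (t *: x).
Proof. by rewrite mxE scalerA. Qed.

(** Exactness at the middle of [M^r -> M^m -> M^n], the tensor product of [M] with
    the presentation of [B]. *)
Definition finite_Tor1 M : Prop :=
  forall y : 'I_m -> M, (forall i, \sum_k a k i *: y k = 0) ->
    exists z : 'I_r -> M, forall k, y k = \sum_l d l k *: z l.

Let gen i : B := p 'e_i.

Lemma tensor_gen K (x : tensor B K) :
  exists k : 'I_n -> K, x = \sum_i tens (gen i) (k i).
Proof.
elim/tensor_ind: x => s; elim: s => [|[b k] s [v vE]].
  by exists (fun=> 0); rewrite big1 // => i _; rewrite tens0r.
have [w wE] := p_surj b.
exists (fun i => (w 0 i : R) *: k + v i); rewrite tclass_cons vE.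
under [RHS]eq_bigr => i _ do rewrite tensDr.
rewrite big_split /=; congr (_ + _); rewrite -wE row_map_of.
elim: (index_enum _) => [|i t IHt]; first by rewrite !big_nil tens0l.
by rewrite !big_cons tensDl IHt tensZ.
Qed.

(** The tensor product of [B] with [K] is the cokernel of [K^m -> K^n]: a section
    of [p] assigns coordinates to formal sums, and each defining relation changes
    them by an element of the image. *)
Lemma tensor_gen_eq0 K (k : 'I_n -> K) : \sum_i tens (gen i) (k i) = 0 ->
  exists y : 'I_m -> K, forall i, k i = \sum_j a j i *: y j.
Proof.
have [s sE] := choice p_surj.
pose Im (v : 'I_n -> K) := exists y : 'I_m -> K, forall i, v i = \sum_j a j i *: y j.
pose val (l : seq (B * K)) i := \sum_(x <- l) (s x.1 0 i : R) *: x.2.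
have val_cat l l' i : val (l ++ l') i = val l i + val l' i by exact: big_cat.
have val_nil i : val [::] i = 0 by exact: big_nil.
have val_cons b x l i : val ((b, x) :: l) i = (s b 0 i : R) *: x + val l i.
  exact: big_cons.
have ImE v v' : v =1 v' -> Im v -> Im v' by move=> e [y yE]; exists y => i; rewrite -e.
have Im0 : Im (fun=> 0).
  by exists (fun=> 0) => i; rewrite big1 // => j _; rewrite scaler0.
have ImB v v' : Im v -> Im v' -> Im (fun i => v i - v' i).
  move=> [y yE] [y' y'E]; exists (fun j => y j - y' j) => i.
  by rewrite yE y'E -sumrB; apply: eq_bigr => j _; rewrite scalerBr.
have ImD v v' : Im v -> Im v' -> Im (fun i => v i + v' i).
  move=> [y yE] [y' y'E]; exists (fun j => y j + y' j) => i.
  by rewrite yE y'E -big_split; apply: eq_bigr => j _; rewrite scalerDr.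
have ImK w x : p w = 0 -> Im (fun i => (w 0 i : R) *: x).
  move=> /qp[u <-]; exists (fun j => (u 0 j : R) *: x) => i.
  by rewrite qE scaler_suml; apply: eq_bigr => j _; rewrite scalerA.
have main l l' : tensor_eq l l' -> Im (fun i => val l i - val l' i).
  elim=> {l l'}.
  - by move=> l; apply: ImE Im0 => i; rewrite subrr.
  - by move=> l l' _ /(ImB _ _ Im0); apply: ImE => i; rewrite sub0r opprB.
  - move=> l l' l'' _ h _ /(ImD _ _ h); apply: ImE => i.
    by rewrite addrA subrK.
  - move=> l l' t t' _ h _ /(ImD _ _ h); apply: ImE => i.
    by rewrite !val_cat opprD addrACA.
  - by move=> l l'; apply: ImE Im0 => i; rewrite !val_cat [X in _ - X]addrC subrr.
  - move=> x; have /(ImK _ x) : p (s 0) = 0 by rewrite sE.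
    by apply: ImE => i; rewrite val_cons val_nil addr0 subr0.
  - move=> b b' x; have /(ImK _ x) : p (s (b + b') - s b - s b') = 0.
      by rewrite !linearB /= !sE addrAC addrK subrr.
    apply: ImE => i; rewrite !val_cons val_nil !addr0 !rowB.
    by rewrite opprD addrA.
  - move=> b x x'; apply: ImE Im0 => i; rewrite !val_cons val_nil !addr0 scalerDr.
    by rewrite subrr.
  - move=> t b x; have /(ImK _ x) : p (s ((t : R^c) *: b) - (t : R^c) *: s b) = 0.
      by rewrite linearB linearZ /= !sE subrr.
    by apply: ImE => i; rewrite !val_cons val_nil !addr0 rowB rowZ.
move=> k0; have {k0}: tensor_eq [seq (gen i, k i) | i <- index_enum 'I_n] [::].
  by apply/tclassP; rewrite tclassE big_map k0.
move=> /main h; rewrite -[exists y, _]/(Im k).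
suff h' : Im (fun i => k i - val [seq (gen i, k i) | i <- index_enum 'I_n] i).
  by apply: ImE (ImD _ _ h' h) => i; rewrite val_nil subr0 subrK.
have kE i : k i = \sum_j (('e_j : 'rV[R^c]_n) 0 i : R) *: k j.
  rewrite (bigD1 i) //= mxE !eqxx scale1r big1 ?addr0 // => j ji.
  by rewrite mxE eqxx eq_sym (negbTE ji) scale0r.
apply: (@ImE (fun i => \sum_j (('e_j - s (gen j)) 0 i : R) *: k j)).
  move=> i; rewrite /val big_map kE -sumrB; apply: eq_bigr => j _ /=.
  by rewrite rowB.
elim: (index_enum _) => [|j t IHt].
  by apply: ImE Im0 => i; rewrite big_nil.
have /(ImK _ (k j)) hj : p ('e_j - s (gen j)) = 0 by rewrite linearB /= sE subrr.
by apply: ImE (ImD _ _ hj IHt) => i; rewrite big_cons.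
Qed.

(** Coordinatewise, the exactness of [c] and [q] passes to a direct sum of copies
    of the ring. *)
Lemma finite_Tor1_free (T : Type) L (inj : forall t : T, {linear R^o -> L}) :
  is_dsum inj -> finite_Tor1 L.
Proof.
move=> dL y y0; have [pr [pr1 pr0]] := dsum_proj dL.
have [J [uJ JE]] : exists J : seq {classic T}, uniq J /\
    forall k, y k = \sum_(t <- J) inj (t : T) (pr t (y k)).
  have /choice[J JP] := fun k => dsum_decomp dL pr1 pr0 (y k).
  exists (undup (flatten [seq J k | k <- enum 'I_m])); split=> [|k]; first exact: undup_uniq.
  apply: (JP k).2; first exact: undup_uniq.
  move=> t tJ; rewrite mem_undup; apply/flattenP; exists (J k) => //.
  by rewrite map_f ?mem_enum.
have /choice[u uE] : forall t : T, exists u, c u = \row_k (pr t (y k) : R^c).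
  move=> t; apply/cq; apply/rowP => i; rewrite mxE qE.
  rewrite -[RHS](linear0 (pr t)) -(y0 i) linear_sum; apply: eq_bigr => k _.
  by rewrite linearZ mxE.
exists (fun l => \sum_(t <- J) inj (t : T) (u t 0 l)) => k.
rewrite {1}JE; under [RHS]eq_bigr => l _ do rewrite scaler_sumr.
rewrite exchange_big /=; apply: eq_bigr => t _.
have := congr1 (fun x : 'rV[R^c]_m => x 0 k) (uE t); rewrite cE mxE => <-.
rewrite linear_sum; apply: eq_bigr => l _.
by rewrite -linearZ.
Qed.

(** A diagram chase in the double complex formed by the presentation of [B] and a
    free presentation [K -> L -> M]. *)
Lemma finite_Tor1P M : Tor1_vanishes B M <-> finite_Tor1 M.
Proof.
have [L [inj dL]] := @dsum_exists R M (fun=> R^o).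
have [pi piE] := dL.2 M (fun x => linear_of (scale_linear x)).
have pi_surj : surjection pi.
  by move=> x; exists (inj x 1); rewrite piE linear_ofE scale1r.
have [s sE] := choice pi_surj.
have [K [j [j_inj jE]]] := kernel_exists pi.
have exj : short_exact j pi by split.
have prL : projective L by apply: (dsum_projective dL) => _; exact: ring_projective.
have Lfree := finite_Tor1_free dL.
have gen0 (N : lmodType R) (y : 'I_m -> N) :
    \sum_i tens (gen i) (\sum_k a k i *: y k) = 0 :> tensor B N.
  under eq_bigr => i _.
    have -> : tens (gen i) (\sum_k a k i *: y k) = \sum_k tens ((a k i : R^c) *: gen i) (y k).
      elim: (index_enum 'I_m) => [|k t IHt]; first by rewrite !big_nil tens0r.
      by rewrite !big_cons tensDr IHt tensZ.
    over.
  rewrite exchange_big big1 // => k _.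
  rewrite -[RHS](tens0l B (y k)) -[in RHS](_ : p (q 'e_k) = 0); last by apply/qp; exists 'e_k.
  rewrite [p _]row_map_of.
  elim: (index_enum 'I_n) => [|i t IHt]; first by rewrite !big_nil tens0l.
  by rewrite !big_cons tensDl IHt.
have tsum (N N' : lmodType R) (f : {linear N -> N'}) (k : 'I_n -> N) :
    tensor_map f (\sum_i tens (gen i) (k i)) = \sum_i tens (gen i) (f (k i)).
  elim: (index_enum 'I_n) => [|i t IHt]; first by rewrite !big_nil tensor_map0.
  by rewrite !big_cons tensor_mapD IHt tensor_mapE.
split=> [T0 y y0|fM].
  pose l k := s (y k).
  have /choice[k kE] : forall i, exists x, j x = \sum_k a k i *: l k.
    move=> i; apply/jE; rewrite linear_sum -[RHS](y0 i); apply: eq_bigr => k _.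
    by rewrite linearZ /= sE.
  have [|k' k'E] := @tensor_gen_eq0 K k.
    apply: (Tor1_mono T0 exj); rewrite tensor_map0 tsum -[RHS](gen0 L l).
    by apply: eq_bigr => i _; rewrite kE.
  have [|z zE] := Lfree (fun k => l k - j (k' k)).
    move=> i; under eq_bigr => t _ do rewrite scalerBr.
    rewrite sumrB -kE k'E linear_sum; apply/eqP; rewrite subr_eq0; apply/eqP.
    by apply: eq_bigr => t _; rewrite linearZ.
  exists (pi \o z) => t; rewrite -[LHS]sE -/(l t).
  have -> : pi (l t) = pi (l t - j (k' t)).
    by rewrite linearB (_ : pi (j _) = 0) ?subr0 //; apply/jE; exists (k' t).
  by rewrite zE linear_sum; apply: eq_bigr => u _; rewrite linearZ.
apply: (projective_Tor1 prL exj); apply: tensor_map_inj => x.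
have [k ->] := tensor_gen x; rewrite tsum => /tensor_gen_eq0[l lE].
have [|z zE] := fM (pi \o l).
  move=> i; have : pi (j (k i)) = 0 by apply/jE; exists (k i).
  rewrite lE linear_sum => e; rewrite -[RHS]e; apply: eq_bigr => t _.
  by rewrite linearZ.
have /choice[k' k'E] : forall t, exists x, j x = l t - \sum_u d u t *: s (z u).
  move=> t; apply/jE; rewrite linearB linear_sum [pi (l t)](zE t).
  by apply/eqP; rewrite subr_eq0; apply/eqP; apply: eq_bigr => u _; rewrite linearZ /= sE.
rewrite -[RHS](gen0 K k'); apply: eq_bigr => i _; congr tens; apply: j_inj.
rewrite lE linear_sum.
under [RHS]eq_bigr => t _ do rewrite linearZ /= k'E scalerBr scaler_sumr.
rewrite sumrB [X in _ - X]exchange_big [X in _ - X]big1 ?subr0 // => u _.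
have qc0 : q (c 'e_u) = 0 by apply/cq; exists 'e_u.
have := congr1 (fun w : 'rV[R^c]_n => (w 0 i : R) *: s (z u)) qc0.
rewrite qE mxE scale0r scaler_suml => e; rewrite -[RHS]e; apply: eq_bigr => t _.
by rewrite scalerA.
Qed.

Lemma finite_Tor1_products : closed_products (Tor1_vanishes B).
Proof.
move=> I E P pr dP BE; apply/finite_Tor1P => y y0.
have /dep_choice[z zE] : forall i, exists z : 'I_r -> E i,
    forall k, pr i (y k) = \sum_l d l k *: z l.
  move=> i; apply: ((finite_Tor1P (E i)).1 (BE i)) => k.
  rewrite -[RHS](linear0 (pr i)) -(y0 k) linear_sum; apply: eq_bigr => t _.
  by rewrite linearZ.
have /choice[w wE] : forall l, exists x, forall i, pr i x = z i l by move=> l; exact: dP.1.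
exists w => k; apply: dP.2 => i; rewrite zE linear_sum; apply: eq_bigr => l _.
by rewrite linearZ /= wE.
Qed.

Lemma finite_Tor1_pure_submodules : closed_pure_submodules (Tor1_vanishes B).
Proof.
move=> N' N i pi BN; apply/finite_Tor1P => y y0.
have [|z zE] := (finite_Tor1P N).1 BN (i \o y).
  move=> k; rewrite -[RHS](linear0 i) -(y0 k) linear_sum; apply: eq_bigr => t _.
  by rewrite linearZ.
have [|phi [phiE phi0]] := pi [seq y k | k <- enum 'I_m]
    [seq rcons [seq (d l k, z l) | l <- index_enum 'I_r] (-1, i (y k)) | k <- enum 'I_m].
  move=> _ /mapP[k _ ->]; rewrite -cats1 lc_cat lc1 scaleN1r /lc big_map.
  by rewrite [i (y k)](zE k) subrr.
have kI k : k \in enum 'I_m by rewrite mem_enum.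
exists (phi \o z) => k; have := phi0 _ (map_f _ (kI k)).
rewrite -cats1 lc_cat lc1 scaleN1r phiE; last exact: map_f.
by rewrite /lc big_map => /subr0_eq.
Qed.

End FiniteTor.

Lemma right_coherent_Tor1 (R : pzRingType) (B : lmodType R^c -> Prop) :
  right_coherent R -> (forall N, B N -> finitely_presented N) ->
  closed_products (KerTor1 B) /\ closed_pure_submodules (KerTor1 B).
Proof.
move=> coh fpB.
have fin b : B b -> closed_products (Tor1_vanishes b) /\
    closed_pure_submodules (Tor1_vanishes b).
  move=> /fpB[m [n [q [p [qp p_surj]]]]]; have [r [c cq]] := coherent_kernel coh q.
  split; first exact: (finite_Tor1_products cq qp p_surj).
  exact: (finite_Tor1_pure_submodules cq qp p_surj).
split=> [I E P pr dP BE b Bb|L M i pi BM b Bb].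
  by apply: (fin b Bb).1 dP _ => i; exact: BE.
exact: (fin b Bb).2 pi (BM b Bb).
Qed.

(** * Zorn's lemma for large types *)

Section Zorn.
Variables (T : Type) (le : T -> T -> Prop).
Hypothesis le_refl : forall t, le t t.

Let chain (A : T -> Prop) := forall s t, A s -> A t -> le s t \/ le t s.
Let sub (A A' : T -> Prop) := forall t, A t -> A' t.

(** Zermelo's argument: starting from a function [F] on subsets, the subsets
    obtained by adding [F A] to [A] and by taking unions are nested, so [F] cannot
    always produce a strict upper bound of a chain. *)
Section Tower.
Variable F : (T -> Prop) -> T.

Let succ A t := A t \/ t = F A.

Inductive tower : (T -> Prop) -> Prop :=
| tower_succ A : tower A -> tower (succ A)
| tower_union (G : (T -> Prop) -> Prop) : (forall A, G A -> tower A) ->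
    tower (fun t => exists2 A, G A & A t).

Let comparable A := forall B, tower B -> sub B A \/ sub A B.

Let comparable_succ A : comparable A -> forall B, tower B -> sub B A \/ sub (succ A) B.
Proof.
move=> cA B; elim=> {B} [C tC IHC|G tG IHG].
  case: IHC => [CA|AC]; last by right=> t /AC; left.
  case: (pselect (A (F C))) => [AFC|nAFC].
    by left=> t [/CA|->].
  case: (cA _ (tower_succ tC)) => [|AC]; first by left.
  have -> : A = C.
    apply/funext => t; apply/propext; split=> [At|/CA //].
    by case: (AC t At) => // tE; case: nAFC; rewrite -tE.
  by right.
case: (pselect (exists2 C, G C & sub (succ A) C)) => [[C GC AC]|nG].
  by right=> t /AC Ct; exists C.
left=> t [C GC Ct]; case: (IHG C GC) => [CA|AC]; first exact: CA.
by case: nG; exists C.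
Qed.

Let tower_comparable A : tower A -> comparable A.
Proof.
elim=> {A} [A tA cA|G tG IHG] B tB.
  by case: (comparable_succ cA tB) => [BA|]; [left=> t /BA; left|right].
case: (pselect (exists2 A, G A & sub B A)) => [[A GA BA]|nG].
  by left=> t /BA At; exists A.
right=> t [A GA At]; case: (IHG A GA B tB) => [BA|AB]; last exact: AB.
by case: nG; exists A.
Qed.

Lemma no_strict_bound : ~ forall A, chain A -> forall t, A t -> le t (F A) /\ ~ le (F A) t.
Proof.
move=> FP.
have tower_chain A : tower A -> chain A.
  elim=> {A} [A _ cA s t [As|->] [At|->]|G tG cG s t [A GA As] [B GB Bt]].
  - exact: cA.
  - by left; case: (FP A cA s As).
  - by right; case: (FP A cA t At).
  - by left; exact: le_refl.
  - case: (tower_comparable (tG A GA) (tG B GB)) => AB.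
      by apply: (cG A GA) => //; exact: AB.
    by apply: (cG B GB) => //; exact: AB.
pose U t := exists2 A, tower A & A t.
have tU : tower U by exact: tower_union.
have UF : U (F U) by exists (succ U); [exact: tower_succ|right].
by have [_] := FP U (tower_chain U tU) _ UF; apply; exact: le_refl.
Qed.

End Tower.

End Zorn.

(** The type [T] may lie above the universe of modules: in the main application
    it consists of modules equipped with generators. *)
Lemma zorn (T : Type) (Q : T -> Prop) (le : T -> T -> Prop) (t0 : T) :
  Q t0 -> (forall t, le t t) -> (forall r s t, le r s -> le s t -> le r t) ->
  (forall A : T -> Prop, (exists t, A t) -> (forall t, A t -> Q t) ->
     (forall s t, A s -> A t -> le s t \/ le t s) ->
     exists2 u, Q u & forall t, A t -> le t u) ->
  exists2 t, Q t & forall s, Q s -> le t s -> le s t.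
Proof.
move=> Q0 le_refl le_trans ub; apply: contrapT => nmax.
have up t : Q t -> exists s, [/\ Q s, le t s & ~ le s t].
  move=> Qt; apply: contrapT => nup; apply: nmax; exists t => // s Qs ts.
  by apply: contrapT => nst; apply: nup; exists s.
pose T' := {t | Q t}; pose le' (s t : T') := le (sval s) (sval t).
have /choice[F FP] : forall A : T' -> Prop, exists u : T',
    (forall s t, A s -> A t -> le' s t \/ le' t s) ->
    forall t, A t -> le' t u /\ ~ le' u t.
  move=> A; case: (pselect (forall s t, A s -> A t -> le' s t \/ le' t s)) => [cA|];
    last by exists (exist Q t0 Q0).
  have [u Qu uP] : exists2 u, Q u & forall t, A t -> le (sval t) u.
    case: (pselect (exists t, A t)) => [[[t Qt] At]|nex]; last first.
      by exists t0 => // t At; case: nex; exists t.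
    have [||s1 s2 [Q1 A1] [Q2 A2]|u Qu uP] := ub (fun t => exists Qt : Q t, A (exist Q t Qt)).
    + by exists t, Qt.
    + by move=> s [].
    + exact: cA A1 A2.
    by exists u => // -[s Qs] As; apply: uP; exists Qs.
  have [s [Qs us nsu]] := up u Qu; exists (exist Q s Qs) => _ t At.
  split; first exact: le_trans (uP t At) us.
  by move=> st; apply: nsu; apply: le_trans st (uP t At).
by apply: (@no_strict_bound T' le' _ F) => // t; exact: le_refl.
Qed.

(** * Relatively pure submodules *)

Lemma mem_map_ex (T : Type) (U : eqType) (f : T -> U) (s : seq T) y :
  y \in map f s -> exists x, f x = y.
Proof.
elim: s => [//|x s IHs]; rewrite inE => /orP[/eqP->|/IHs //].
by exists x.
Qed.

Lemma supported_in (R : pzRingType) (T : Type) (U : eqType) (f : T -> U) (Q : U -> Prop)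
    (l : seq (R * T)) : {in [seq f y.2 | y <- l], forall u, Q u} -> supported (Q \o f) l.
Proof.
elim: l => [//|x l IHl] fQ /=; split; first exact/fQ/mem_head.
by apply: IHl => u ul; apply: fQ; rewrite inE ul orbT.
Qed.

Section RelativePurity.
Variable R : pzRingType.
Implicit Types (E L M N Q : lmodType R).

(** For [P] meeting [V] trivially this says that the image of [P] in the quotient
    by [V] is pure: relations need only hold modulo [V] to be realized in [P]. *)
Definition relatively_pure E (V P : E -> Prop) : Prop :=
  forall (s : seq E) (rho : seq (seq (R * E))),
    {in s, forall x, P x} -> {in rho, forall l, V (lc id l)} ->
    exists phi : E -> E, [/\ forall e, P (phi e), {in s, forall x, phi x = x}
      & {in rho, forall l, lc phi l = 0}].

(** The relation [x = 0] holds modulo [V], and it is realized by fixing [x]. *)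
Lemma relatively_pure_disjoint E (V P : E -> Prop) x : relatively_pure V P -> V x -> P x -> x = 0.
Proof.
move=> VP Vx Px; have [||phi [_ phiE phi0]] := VP [:: x] [:: [:: (1, x)]].
- by move=> y; rewrite inE => /eqP->.
- by move=> l; rewrite inE => /eqP->; rewrite lc1 scale1r.
by have := phi0 _ (mem_head _ _); rewrite lc1 scale1r phiE // mem_head.
Qed.

Lemma relatively_pure_zero E (V : E -> Prop) : relatively_pure V (fun x => x = 0).
Proof.
move=> s rho s0 _; exists (fun=> 0); split=> // [x /s0|l _] //.
by rewrite /lc big1 // => x _; rewrite scaler0.
Qed.

Lemma relatively_pure_union E (V : E -> Prop) (F : (E -> Prop) -> Prop) :
  (exists P, F P) -> (forall P, F P -> relatively_pure V P) ->
  (forall P P', F P -> F P' -> (forall x, P x -> P' x) \/ (forall x, P' x -> P x)) ->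
  relatively_pure V (fun x => exists P, F P /\ P x).
Proof.
move=> [P0 F0] FV tot s rho sF rhoV.
have [P [FP sP]] : exists P, F P /\ {in s, forall x, P x}.
  elim: s sF => [|x s IHs] sF; first by exists P0.
  have [|P [FP sP]] := IHs; first by move=> y ys; apply: sF; rewrite inE ys orbT.
  have [P' [FP' Px]] := sF x (mem_head _ _).
  case: (tot _ _ FP FP') => PP.
    by exists P'; split=> // y; rewrite inE => /orP[/eqP->|/sP/PP].
  by exists P; split=> // y; rewrite inE => /orP[/eqP->|/sP]; first exact: PP.
have [phi [phiP phiE phi0]] := FV P FP s rho sP rhoV.
by exists phi; split=> // e; exists P.
Qed.

(** Realize the relations in the quotient first; the defect of a lift lies in [P]
    and is corrected by relative purity of [P]. *)
Lemma relatively_pure_trans E Q (V P : E -> Prop) (q : {linear E -> Q}) (P' : Q -> Prop) :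
  surjection q -> (forall x, q x = 0 <-> P x) -> relatively_pure V P ->
  relatively_pure (fun y => exists2 x, V x & q x = y) P' -> subm P' -> relatively_pure V (P' \o q).
Proof.
move=> q_surj qP VP VP' sP' s rho sP rhoV.
have [sec secE] := choice q_surj.
have [||phi' [phi'P phi'E phi'0]] := VP' (map q s) [seq fmap q l | l <- rho].
- by move=> _ /mapP[x xs ->]; exact: sP.
- move=> _ /mapP[l lr ->]; exists (lc id l); first exact: rhoV.
  by rewrite lc_linear lc_map.
pose f e := sec (phi' (q e)).
have fs x : x \in s -> P (x - f x).
  by move=> xs; apply/qP; rewrite linearB secE phi'E ?map_f // subrr.
have fr l : l \in rho -> P (lc f l).
  move=> lr; apply/qP; rewrite lc_linear -(phi'0 (fmap q l)) ?map_f // lc_map.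
  by apply: eq_lc => e /=; rewrite secE.
have [||phi [phiP phiE phi0]] := VP ([seq x - f x | x <- s] ++ [seq lc f l | l <- rho])
   [seq rcons (fmap (fun e => e - f e) l) (1, lc f l) | l <- rho].
- by move=> y; rewrite mem_cat => /orP[/mapP[x xs ->]|/mapP[l lr ->]]; auto.
- move=> _ /mapP[l lr ->]; rewrite -cats1 lc_cat lc1 scale1r lc_map.
  by rewrite lcB subrK; exact: rhoV.
exists (fun e => f e + phi (e - f e)); split=> [e|x xs|l lr] /=.
- rewrite linearD secE (_ : q (phi _) = 0) ?addr0 //.
  exact/qP.
- rewrite phiE; first by rewrite addrC subrK.
  by rewrite mem_cat (map_f (fun x => x - f x)).
- rewrite lcD; have := phi0 _ (map_f _ lr).
  rewrite -cats1 lc_cat lc1 scale1r lc_map phiE; last first.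
    by rewrite mem_cat map_f ?orbT.
  by rewrite addrC.
Qed.

End RelativePurity.

(** * Small pure and saturated submodules *)

Section Solutions.
Variables (R : pzRingType) (B : Type).

(** A term [sol_unknown rho b k g] names the value of the [k]-th unknown in a
    solution of the finite system [rho] whose first [b] unknowns are prescribed by
    the terms [g].  The terms form a set that bounds the size of the closure of
    [B] under solving systems. *)
Inductive sol_term : Type :=
| sol_base of B
| sol_unknown of seq (seq (R * nat)) & nat & nat & (nat -> sol_term).

Variables (E : lmodType R) (base : B -> E) (T : E -> Prop).

Let solves (rho : seq (seq (R * nat))) b (v y : nat -> E) :=
  (forall j, (j < b)%N -> y j = v j) /\ {in rho, forall l, T (lc y l)}.

Let sol rho b v : nat -> E :=
  if pselect (exists y, solves rho b v y) is left e then sval (cid e) else fun=> 0.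

Let solP rho b v y : solves rho b v y -> solves rho b v (sol rho b v).
Proof.
rewrite /sol; case: pselect => [e _|ne yP]; first exact: svalP (cid e).
by case: ne; exists y.
Qed.

Fixpoint sol_eval (u : sol_term) : E :=
  match u with
  | sol_base x => base x
  | sol_unknown rho b k g => sol rho b (fun j => sol_eval (g j)) k
  end.

(** A system with parameters in the image is indexed by the positions in the list
    of elements that occur in it, and its solution is named by a term. *)
Lemma sol_eval_pure (b0 : B) (s : seq E) (rho : seq (seq (R * E))) :
  {in s, forall x, exists u, sol_eval u = x} -> {in rho, forall l, T (lc id l)} ->
  exists h : E -> sol_term, {in s, forall x, sol_eval (h x) = x} /\
    {in rho, forall l, T (lc (sol_eval \o h) l)}.
Proof.
move=> sf rhoT; set L := s ++ terms rho.
have /choice[g gE] : forall j, exists u, (j < size s)%N -> sol_eval u = nth 0 L j.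
  move=> j; case: (ltnP j (size s)) => js; last by exists (sol_base b0).
  by have [u uE] := sf _ (mem_nth 0 js); exists u; rewrite nth_cat js.
pose rho' := [seq fmap (index^~ L) l | l <- rho].
have : solves rho' (size s) (sol_eval \o g) (nth 0 L).
  split=> [j js|_ /mapP[l lr ->]]; first by rewrite /= gE.
  rewrite lc_map (eq_lc_terms (psi := id) _ lr); first exact: rhoT.
  by move=> x xr /=; rewrite nth_index // mem_cat xr orbT.
move=> /solP[yE yT]; exists (fun e => sol_unknown rho' (size s) (index e L) g).
split=> [x xs /=|l lr].
  have iL : (index x L < size s)%N by rewrite index_cat xs index_mem.
  by rewrite -[LHS]/(sol _ _ (sol_eval \o g) _) yE //= gE // nth_index // mem_cat xs.
by have := yT _ (map_f _ lr); rewrite lc_map.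
Qed.

End Solutions.

Section Saturation.
Variables (R : pzRingType) (N M : lmodType R).
Notation sol_term := (sol_term R nat).

(** A term [sat_copy D mu u g] names the [u]-th member of a family with image [mu]
    in [M] whose combinations in [D] take the values [g].  Only [R], [N] and [M]
    enter, which bounds the size of saturated submodules uniformly. *)
Inductive sat_term : Type :=
| sat_base of N
| sat_copy of (seq (R * sol_term) -> Prop) & (sol_term -> M) & sol_term
    & (seq (R * sol_term) -> sat_term).

Variables (E : lmodType R) (n : {linear N -> E}) (m : {linear E -> M}).

Let copies (D : seq (R * sol_term) -> Prop) (mu : sol_term -> M) v (f : sol_term -> E) :=
  (forall u, m (f u) = mu u) /\ forall l, D l -> lc f l = v l.

Let copy (D : seq (R * sol_term) -> Prop) mu v : sol_term -> E :=
  if pselect (exists f, copies D mu v f) is left e then sval (cid e) else fun=> 0.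

Let copyP (D : seq (R * sol_term) -> Prop) mu v : (exists f, copies D mu v f) -> copies D mu v (copy D mu v).
Proof. by rewrite /copy => h; case: pselect => // e; exact: svalP (cid e). Qed.

Fixpoint sat_eval (w : sat_term) : E :=
  match w with
  | sat_base x => n x
  | sat_copy D mu u g => copy D mu (fun l => sat_eval (g l)) u
  end.

Let T e := exists w, sat_eval w = e.

Let T0 : T 0. Proof. by exists (sat_base 0); exact: linear0. Qed.

(** The image [T] of the terms contains, for every family [f], a family [f'] with
    the same image in [M] and the same combinations with values in [T]. *)
Lemma saturation (f : sol_term -> E) : exists f' : sol_term -> E,
  [/\ forall u, T (f' u), forall u, m (f' u) = m (f u)
    & forall l, T (lc f l) -> lc f' l = lc f l].
Proof.
have /choice[g gE] : forall l, exists w, T (lc f l) -> sat_eval w = lc f l.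
  move=> l; case: (pselect (T (lc f l))) => [[w wE]|nT]; first by exists w.
  by exists (sat_base 0).
pose w u := sat_copy (fun l => T (lc f l)) (m \o f) u g.
have [|mE lE] := @copyP (fun l => T (lc f l)) (m \o f) (sat_eval \o g).
  by exists f; split=> // l Tl; rewrite /= gE.
exists (sat_eval \o w); split=> [u|u|l Tl]; first by exists (w u).
  exact: mE.
by rewrite -[RHS](gE l Tl); exact: (lE l Tl).
Qed.

Let T_subm : subm T.
Proof.
split=> // a x y Tx Ty.
pose f (u : sol_term) := if u is sol_base k then nth 0 [:: x; y; a *: x + y] k else 0.
have [f' [f'T _ f'E]] := saturation f.
have e0 : f' (sol_base R 0%N) = x.
  have := f'E [:: (1, sol_base R 0%N)]; rewrite !lc1 !scale1r /=; exact.
have e1 : f' (sol_base R 1%N) = y.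
  have := f'E [:: (1, sol_base R 1%N)]; rewrite !lc1 !scale1r /=; exact.
have := f'E [:: (a, sol_base R 0%N); (1, sol_base R 1%N); (-1, sol_base R 2%N)].
rewrite !lc_cons !lc_nil /= !scale1r !scaleN1r !addr0 e0 e1 !addrA subrr => /(_ T0).
by move/eqP; rewrite subr_eq0 => /eqP->.
Qed.

(** If some [x0] is not named by a term, take a family [f] through [x0] that is
    pure modulo [T], and its copy [f'] in [T].  Relations on [E] that hold modulo
    [T] are realized by [f] modulo [T], and then exactly by [f - f']. *)
Lemma sat_eval_surj :
  (forall P, subm P -> (forall x, P x -> m x = 0) ->
     relatively_pure (fun y => exists x, n x = y) P -> forall x, P x -> x = 0) ->
  surjection sat_eval.
Proof.
move=> noP x0; apply: contrapT => nTx0.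
(* the image of f contains x0 and is pure modulo T *)
pose f := sol_eval (fun _ : nat => x0) T.
have image_pure := @sol_eval_pure R nat E (fun=> x0) T 0%N.
have [f' [f'T f'm f'E]] := saturation f.
pose P x := exists l, lc f l - lc f' l = x.
have Pm x : P x -> m x = 0.
  move=> [l <-]; rewrite linearB; apply/eqP; rewrite subr_eq0 eq_sym !lc_linear.
  by apply/eqP; apply: eq_lc => u; exact: f'm.
have Psub : subm P.
  split=> [|a _ _ [l <-] [l' <-]]; first by exists [::]; rewrite !lc_nil subr0.
  exists (fscale a l ++ l'); rewrite !lc_cat !lc_scale scalerBr opprD.
  by rewrite addrACA.
have Ppure : relatively_pure (fun y => exists x, n x = y) P.
  move=> s rho sP rhoV.
  have /choice[c cE] : forall x, exists l, P x -> lc f l - lc f' l = x.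
    by move=> x; case: (pselect (P x)) => [[l lE]|nP]; [exists l|exists [::]].
  have Tf' l : T (lc f' l) by apply: (subm_lc T_subm); exact: supported_all.
  have [||h [hE hT]] := image_pure (flatten [seq [seq f y.2 | y <- c x] | x <- s])
      (rho ++ [seq (1, x) :: fscale (-1) (fmap f (c x)) | x <- s]).
  - by move=> y /flattenP[_ /mapP[x xs ->] /mem_map_ex[u <-]]; exists u.2.
  - move=> l; rewrite mem_cat => /orP[/rhoV[x <-]|/mapP[x xs ->]].
      by exists (sat_base x).
    rewrite lc_cons scale1r lc_scale scaleN1r lc_map -[X in X - _](cE x (sP x xs)) /=.
    by rewrite addrAC subrr sub0r; exact: submN.
  exists (fun e => f (h e) - f' (h e)); split=> [e|x xs|l lr].
  - by exists [:: (1, h e)]; rewrite !lc1 !scale1r.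
  - have := hT ((1, x) :: fscale (-1) (fmap f (c x))).
    rewrite mem_cat map_f ?orbT // => /(_ isT).
    rewrite lc_cons scale1r lc_scale scaleN1r lc_map.
    rewrite (_ : lc ((f \o h) \o f) (c x) = lc f (c x)); last first.
      apply: (@eq_lc_supported _ _ _ ((fun e => f (h e) = e) \o f)) => //.
      apply: supported_in => y yc; apply: hE; apply/flattenP.
      by exists [seq f z.2 | z <- c x] => //; exact: map_f.
    move=> /= hx; have := f'E ((1, h x) :: fscale (-1) (c x)).
    rewrite !lc_cons !scale1r !lc_scale !scaleN1r => /(_ hx) e.
    have -> : f (h x) = f' (h x) - lc f' (c x) + lc f (c x) by rewrite e subrK.
    by rewrite addrC -addrA addKr addrC cE //; exact: sP.
  - rewrite lcB; apply/eqP; rewrite subr_eq0 eq_sym; apply/eqP.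
    have := f'E (fmap h l); rewrite !lc_map; apply.
    by apply: hT; rewrite mem_cat lr.
have : P (x0 - f' (sol_base R 0%N)) by exists [:: (1, sol_base R 0%N)]; rewrite !lc1 !scale1r.
by move=> /(noP P Psub Pm Ppure)/subr0_eq x0E; apply: nTx0; rewrite x0E; exact: f'T.
Qed.
End Saturation.

(** * Factorizations with cokernel in a class *)

Section Spanning.
Variables (R : pzRingType) (Om : Type) (D : Om -> Prop).
Implicit Types (E F : lmodType R).

Definition spans E (p : Om -> E) : Prop := forall e, exists l, supported D l /\ lc p l = e.

(** A module is presented by a generating family together with the relations that
    hold between its members. *)
Lemma span_map E F (p : Om -> E) (p' : Om -> F) : spans p ->
  (forall l, supported D l -> lc p l = 0 -> lc p' l = 0) ->
  exists g : {linear E -> F}, forall l, supported D l -> g (lc p l) = lc p' l.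
Proof.
move=> /choice[c cP] p0.
have wd l l' : supported D l -> supported D l' -> lc p l = lc p l' -> lc p' l = lc p' l'.
  move=> Dl Dl' e; apply/eqP; rewrite -subr_eq0 -scaleN1r -lc_scale -lc_cat; apply/eqP.
  apply: p0; first by apply/supported_cat; split=> //; exact: supported_scale.
  by rewrite lc_cat lc_scale scaleN1r e subrr.
have gP : linear (fun e => lc p' (c e)).
  move=> a x y; rewrite -lc_scale -lc_cat.
  have [Dx xE] := cP x; have [Dy yE] := cP y; have [Dxy xyE] := cP (a *: x + y).
  apply: wd => //; first by apply/supported_cat; split=> //; exact: supported_scale.
  by rewrite xyE lc_cat lc_scale xE yE.
exists (linear_of gP) => l Dl; rewrite linear_ofE; have [Dc cE] := cP (lc p l).
exact: wd.
Qed.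

End Spanning.

Section Factorizations.
Variables (R : pzRingType) (X : lmodType R -> Prop).
Variables (N M : lmodType R) (c : {linear N -> M}).
Hypotheses (X_sums : closed_sums X) (X_pquot : closed_pure_quotients X).
Implicit Types (E F H L Q : lmodType R).

Record factorization := Factorization {
  fact_obj :> lmodType R;
  fact_in : {linear N -> fact_obj};
  fact_out : {linear fact_obj -> M};
  fact_comp : forall x, fact_out (fact_in x) = c x;
  fact_coker : exists (H : lmodType R) (p : {linear fact_obj -> H}), short_exact fact_in p /\ X H
}.

Implicit Types (r s t u : factorization).

Definition fact_hom (s t : factorization) (g : {linear s -> t}) : Prop :=
  (forall x, g (fact_in s x) = fact_in t x) /\ (forall e, fact_out t (g e) = fact_out s e).

Definition has_hom (s t : factorization) : Prop := exists g : {linear s -> t}, fact_hom g.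

Lemma fact_hom_comp s t u (g : {linear s -> t}) (h : {linear t -> u}) :
  fact_hom g -> fact_hom h -> fact_hom (h \o g).
Proof. by move=> [g1 g2] [h1 h2]; split=> x /=; rewrite ?g1 ?h1 // h2 g2. Qed.

Lemma fact_hom_id s : fact_hom (idfun : {linear s -> s}).
Proof. by []. Qed.

Lemma has_hom_trans s t u : has_hom s t -> has_hom t u -> has_hom s u.
Proof. by move=> [g gP] [h hP]; exists (h \o g); exact: fact_hom_comp. Qed.

Lemma has_hom_refl s : has_hom s s.
Proof. by exists idfun; exact: fact_hom_id. Qed.

Let V (t : factorization) : t -> Prop := fun y => exists x, fact_in t x = y.

(** The cokernel of the quotient factorization is a pure quotient of the cokernel
    [H], by relative purity of [P]. *)
Lemma quotient_factorization (t : factorization) (P : t -> Prop) : subm P ->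
  (forall x, P x -> fact_out t x = 0) -> relatively_pure (V (t := t)) P ->
  exists (t' : factorization) (q : {linear t -> t'}),
    [/\ fact_hom q, surjection q & forall x, q x = 0 <-> P x].
Proof.
move=> sP P0 Ppure; have [Q [q [q_surj qP]]] := quotient_exists sP.
have [m' m'E] : exists m' : {linear Q -> M}, forall x, m' (q x) = fact_out t x.
  by apply: descend => // x /qP; exact: P0.
have [H [p [[n_inj np p_surj] XH]]] := fact_coker t.
have sP' : subm (fun h => exists2 x, P x & p x = h).
  split; first by exists 0; [exact: subm0|exact: linear0].
  move=> a _ _ [x Px <-] [y Py <-]; exists (a *: x + y); first exact: submP.
  exact: linearP.
have [H' [h [h_surj hP]]] := quotient_exists sP'.
have [p' p'E] : exists p' : {linear Q -> H'}, forall x, p' (q x) = h (p x).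
  by apply: (descend (f := h \o p)) => // x /qP Px; apply/hP; exists x.
have p'_surj : surjection p'.
  move=> y; have [z <-] := h_surj y; have [x <-] := p_surj z.
  by exists (q x); rewrite p'E.
have hpP x : h (p x) = 0 -> exists n y, P y /\ x = fact_in t n + y.
  move=> /hP[y Py yx]; have [|n nE] := (np (x - y)).1; first by rewrite linearB yx subrr.
  by exists n, y; rewrite nE subrK.
have ex : short_exact (q \o fact_in t) p'.
  split=> //.
  - apply: linear_inj => x /= /qP Px; apply: n_inj; rewrite linear0.
    by apply: (relatively_pure_disjoint Ppure) => //; exists x.
  - move=> y; split=> [|[x <-]]; last first.
      by rewrite /= p'E (_ : p _ = 0) ?linear0 //; apply/np; exists x.
    have [x <-] := q_surj y; rewrite p'E => /hpP[n [z [Pz ->]]].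
    by exists n; rewrite /= linearD (_ : q z = 0) ?addr0 //; apply/qP.
have hp : pure_epi h.
  move=> s rho rho0.
  have /choice[sec secE] : forall y, exists x, h (p x) = y.
    move=> y; have [z <-] := h_surj y; have [x <-] := p_surj z; by exists x.
  have /choice[x xE] : forall l, exists x, l \in rho -> P x /\ V (lc sec l - x).
    move=> l; case: (boolP (l \in rho)) => lr; last by exists 0.
    have [|n [y [Py yE]]] := hpP (lc sec l).
      rewrite !lc_linear -(rho0 l lr); apply: eq_lc => y /=; exact: secE.
    by exists y => _; split=> //; exists n; rewrite yE addrK.
  have [||phi [phiP phiE phi0]] := Ppure (map x rho)
      [seq rcons (fmap sec l) (-1, x l) | l <- rho].
  - by move=> _ /mapP[l lr ->]; exact: (xE l lr).1.
  - move=> _ /mapP[l lr ->]; rewrite -cats1 lc_cat lc_map lc1 scaleN1r.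
    by have [_] := xE l lr; rewrite (@eq_lc _ _ _ (id \o sec) sec).
  exists (fun y => p (sec y - phi (sec y))); split=> [y _|l lr].
    rewrite !linearB /= secE (_ : h (p (phi _)) = 0) ?subr0 //.
    by apply/hP; exists (phi (sec y)).
  rewrite -[LHS](lc_linear p (fun y => sec y - phi (sec y))) lcB.
  have := phi0 _ (map_f _ lr); rewrite -cats1 lc_cat lc_map lc1 scaleN1r.
  rewrite phiE ?map_f // => /eqP; rewrite subr_eq0 => /eqP e.
  rewrite (_ : lc (fun y => phi (sec y)) l = x l) //.
  by apply/np; have [_] := xE l lr.
have XH' : X H' by exact: X_pquot hp XH.
have mn x : m' ((q \o fact_in t) x) = c x by rewrite /= m'E fact_comp.
exists (@Factorization Q (q \o fact_in t) m' mn (ex_intro _ H' (ex_intro _ p' (conj ex XH')))), q.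
by split.
Qed.

Definition small (t : factorization) : Prop := exists w : sat_term N M -> t, surjection w.

(** Divide out a submodule that is maximal among the relatively pure ones dying in
    [M]; by transitivity of relative purity the quotient has no nonzero ones. *)
Lemma small_quotient (t : factorization) : exists2 t', small t' & has_hom t t'.
Proof.
pose good P := [/\ @subm R t P, forall x, P x -> fact_out t x = 0 & relatively_pure (V (t := t)) P].
have good0 : good (fun x => x = 0).
  split; [split=> // a x y -> ->; by rewrite scaler0 addr0| |exact: relatively_pure_zero].
  by move=> x ->; exact: linear0.
pose le (P P' : t -> Prop) := forall x, P x -> P' x.
have [||F exF Fgood Ftot|P [sP P0 Ppure] Pmax] := @zorn _ good le _ good0.
- by move=> P x.
- by move=> P P' P'' PP PP' x /PP/PP'.
- exists (fun x => exists P, F P /\ P x); last by move=> P FP x Px; exists P.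
  split.
  + split; first by have [P FP] := exF; exists P; split=> //; have [/subm0] := Fgood P FP.
    move=> a x y [P [FP Px]] [P' [FP' P'y]].
    case: (Ftot P P' FP FP') => PP.
      exists P'; split=> //; have [sP' _ _] := Fgood _ FP'.
      by apply: submP => //; exact: PP.
    exists P; split=> //; have [sP _ _] := Fgood _ FP.
    by apply: submP => //; exact: PP.
  + by move=> x [P [FP Px]]; have [_ P0 _] := Fgood _ FP; exact: P0.
  + by apply: relatively_pure_union => // P FP; have [] := Fgood _ FP.
have [t' [q [qh q_surj qP]]] := quotient_factorization sP P0 Ppure.
exists t'; last by exists q.
exists (sat_eval (fact_in t') (fact_out t')); apply: sat_eval_surj => P' sP' P'0 P'pure y.
have [x <-] := q_surj y => P'x; apply/qP; apply: (Pmax (P' \o q)) => //.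
- split.
  + split=> [|a u v Pu Pv] /=; first by rewrite linear0; exact: subm0.
    by rewrite linearP; exact: submP.
  + by move=> u Pu; rewrite -qh.2; exact: P'0.
  + apply: (relatively_pure_trans q_surj qP Ppure) => // s rho sP'' rhoV.
    apply: P'pure => // l /rhoV[_ [n <-] <-].
    by exists n; rewrite qh.1.
- by move=> u /qP qu /=; rewrite qu; exact: subm0.
Qed.

(** The pushout of the direct sum of the family along the codiagonal of [N]; its
    cokernel is the direct sum of the cokernels. *)
Lemma amalgam (I : Type) (t : I -> factorization) : exists Z : factorization, forall i, has_hom (t i) Z.
Proof.
have /dep_choice[H] : forall i, exists H, exists p : {linear t i -> H},
  short_exact (fact_in (t i)) p /\ X H by move=> i; exact: fact_coker.
move=> /dep_choice[p pP].
have [S [inS dS]] := dsum_exists (fun i => t i : lmodType R).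
have [SN [inN dN]] := dsum_exists (fun _ : I => N).
have [SH [inH dH]] := dsum_exists H.
have [f fE] := dN.2 S (fun i => inS i \o fact_in (t i)).
have [sg sgE] := dN.2 N (fun i => idfun).
have [prS [prS1 prS0]] := dsum_proj dS.
have [prN [prN1 prN0]] := dsum_proj dN.
have [prH [prH1 prH0]] := dsum_proj dH.
have [pS pSE] := dS.2 SH (fun i => inH i \o p i).
have [mS mSE] := dS.2 M (fun i => fact_out (t i)).
have n_inj i : injective (fact_in (t i)) by have [[]] := pP i.
have np i : exact (fact_in (t i)) (p i) by have [[]] := pP i.
have p_surj i : surjection (p i) by have [[]] := pP i.
have prf i x : prS i (f x) = fact_in (t i) (prN i x).
  apply: (dsum_gen_eq dN (f := prS i \o f) (g := fact_in (t i) \o prN i)) => j e /=.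
  rewrite fE /=; case: (pselect (j = i)) => [ji|ji]; last by rewrite prS0 // prN0 // linear0.
  by case: i / ji; rewrite prS1 prN1.
have prp i x : prH i (pS x) = p i (prS i x).
  apply: (dsum_gen_eq dS (f := prH i \o pS) (g := p i \o prS i)) => j e /=.
  rewrite pSE /=; case: (pselect (j = i)) => [ji|ji]; last by rewrite prH0 // prS0 // linear0.
  by case: i / ji; rewrite prH1 prS1.
have pf x : pS (f x) = 0.
  apply: (dsum_eq0 dH prH1 prH0) => i; rewrite prp prf.
  by apply/np; exists (prN i x).
have f_inj x : f x = 0 -> x = 0.
  move=> fx; apply: (dsum_eq0 dN prN1 prN0) => i; apply: (n_inj i).
  by rewrite -prf fx !linear0.
have pSf x : pS x = 0 -> exists y, f y = x.
  move=> px; have [J [uJ JE]] := dsum_decomp dS prS1 prS0 x.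
  have /dep_choice[y yE] : forall i, exists y, fact_in (t i) y = prS i x.
    by move=> i; apply/np; rewrite -prp px linear0.
  exists (\sum_(i <- J) inN (i : I) (y i)); rewrite (JE J uJ (fun _ => id)) linear_sum.
  by apply: eq_bigr => i _; rewrite fE /= yE.
have pS_surj : surjection pS.
  move=> h; have [l ->] := dH.1 h.
  have /dep_choice[s sE] : forall i, exists s : H i -> t i, forall y, p i (s y) = y.
    by move=> i; have /choice[s sE] := p_surj i; exists s.
  exists (\sum_(u <- l) inS (projT1 u) (s _ (projT2 u))); rewrite linear_sum.
  by apply: eq_bigr => u _; rewrite pSE /= sE.
have mf x : mS (f x) = c (sg x).
  apply: (dsum_gen_eq dN (f := mS \o f) (g := c \o sg)) => i e /=.
  by rewrite fE /= mSE sgE fact_comp.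
(* the pushout of f along the codiagonal of N *)
pose d : {linear SN -> (N * S)%type} := pairl (\- sg : {linear SN -> N}) f.
have [Q [q [q_surj qP]]] := quotient_exists (subm_im d).
have [m mE] : exists m : {linear Q -> M}, forall x, m (q x) = copair c mS x.
  apply: descend => // x /qP[y <-].
  by rewrite copairE /= mf linearN addNr.
have [pQ pQE] : exists pQ : {linear Q -> SH}, forall x, pQ (q x) = copair \0 pS x.
  by apply: descend => // x /qP[y <-]; rewrite copairE /= pf addr0.
pose nQ : {linear N -> Q} := q \o pairl idfun \0.
have mn x : m (nQ x) = c x by rewrite /nQ /= mE copairE /= linear0 addr0.
have ex : short_exact nQ pQ.
  split.
  - apply: linear_inj => x /qP[y [yx /f_inj y0]].
    by rewrite -yx y0 linear0 oppr0.
  - move=> u; split=> [|[x <-]]; last by rewrite /nQ /= pQE copairE /= linear0 addr0.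
    have [[x y] <-] := q_surj u; rewrite pQE copairE /= add0r => /pSf[z zy].
    exists (x + sg z); rewrite /nQ /=; apply/eqP; rewrite -subr_eq0 -linearB.
    apply/eqP/qP; exists (- z); apply: pair_ext => /=.
      by rewrite linearN opprK addrC addKr.
    by rewrite linearN zy sub0r.
  - move=> h; have [y <-] := pS_surj h; exists (q (0, y)).
    by rewrite pQE copairE /= add0r.
have XSH : X SH by apply: X_sums dH _ => i; have [] := pP i.
exists (@Factorization Q nQ m mn (ex_intro _ SH (ex_intro _ pQ (conj ex XSH)))) => i.
exists (q \o pairl \0 (inS i)); split=> [x|e] /=.
  apply/eqP; rewrite -subr_eq0 -linearB; apply/eqP/qP.
  exists (inN i x); apply: pair_ext => /=; first by rewrite sgE sub0r.
  by rewrite fE subr0.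
by rewrite mE copairE /= linear0 add0r mSE.
Qed.

Let W := sat_term N M.

(** A small factorization is determined up to isomorphism by the relations between
    its named elements and by the two structure maps, which form a set of codes;
    amalgamate one representative of each code. *)
Lemma weakly_terminal : exists Z : factorization, forall t, has_hom t Z.
Proof.
pose code := ((seq (R * W) -> Prop) * (N -> seq (R * W) -> Prop) * (W -> M))%type.
pose codeof (t : factorization) (w : W -> t) : code :=
  ((fun l => lc w l = 0), (fun x l => fact_in t x = lc w l), (fun z : W => fact_out t (w z))).
pose I := {k : code | exists (t : factorization) (w : W -> t), surjection w /\ codeof t w = k}.
have /choice[rep repP] : forall i : I, exists t : factorization, exists w : W -> t,
  surjection w /\ codeof t w = sval i by move=> i; exact: svalP i.
have [Z ZP] := amalgam rep.
exists Z => t; have [t' [w w_surj] tt'] := small_quotient t.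
apply: has_hom_trans tt' _.
have ex : exists (s : factorization) (v : W -> s), surjection v /\ codeof s v = codeof t' w.
  by exists t', w.
pose i : I := exist _ (codeof t' w) ex; apply: has_hom_trans (ZP i).
have [w' [w'_surj]] := repP i; rewrite /= => e.
have e1 l : (lc w' l = 0) = (lc w l = 0).
  exact: (congr1 (fun k : code => k.1.1 l) e).
have e2 x l : (fact_in (rep i) x = lc w' l) = (fact_in t' x = lc w l).
  exact: (congr1 (fun k : code => k.1.2 x l) e).
have e3 (z : W) : fact_out (rep i) (w' z) = fact_out t' (w z).
  exact: (congr1 (fun k : code => k.2 z) e).
have spanw : spans (fun=> True) w.
  move=> y; have [u <-] := w_surj y; exists [:: (1, u)]; split=> //.
  by rewrite lc1 scale1r.
have [g gE] : exists g : {linear t' -> rep i}, forall l, supported (fun=> True) l -> g (lc w l) = lc w' l.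
  by apply: span_map => // l _; rewrite e1.
exists g; split=> [x|y].
  have [l [_ lE]] := spanw (fact_in t' x); rewrite -lE gE; last exact: supported_all.
  by apply/esym; rewrite e2.
have [u <-] := w_surj y; rewrite -e3; congr (fact_out _ _).
have := gE [:: (1, u)]; rewrite !lc1 !scale1r; apply.
by split.
Qed.

End Factorizations.

(** * Directed colimits and chains of presentations *)

Section DirectedColimit.
Variables (R : pzRingType) (X : lmodType R -> Prop).
Hypotheses (X_sums : closed_sums X) (X_pquot : closed_pure_quotients X).

(** A directed colimit is a pure quotient of the direct sum: finitely many elements
    lift to one stage, and finitely many relations hold at a later one.  The
    transition maps are asked for one at a time, compatibly with the maps to [G]. *)
Lemma directed_closed (I : Type) (E : I -> lmodType R) (G : lmodType R)
    (u : forall i, {linear E i -> G}) :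
  (forall i j, exists k (f : {linear E i -> E k}) (g : {linear E j -> E k}),
     (forall x, u k (f x) = u i x) /\ (forall x, u k (g x) = u j x)) ->
  (forall y, exists i x, u i x = y) ->
  (forall i x, u i x = 0 -> exists k (f : {linear E i -> E k}),
     (forall z, u k (f z) = u i z) /\ f x = 0) ->
  (forall i, X (E i)) -> X G.
Proof.
move=> dir surj ker XE.
have [S [inj dS]] := dsum_exists E.
have [p pE] := dS.2 G u.
apply: (X_pquot (p := p)); last exact: X_sums dS XE.
move=> s rho rho0.
have [i0 _] := surj 0.
have [i [psi psiE]] : exists i (psi : G -> E i), {in s ++ terms rho, forall y, u i (psi y) = y}.
  elim: (s ++ terms rho) => [|y L [i [psi psiE]]]; first by exists i0, (fun=> 0).
  have [j [x xE]] := surj y; have [k [f [g [fE gE]]]] := dir i j.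
  exists k, (fun z => if z == y then g x else f (psi z)) => z.
  rewrite inE; case: eqP => [->|_] /= zL; first by rewrite gE.
  by rewrite fE psiE.
have lift (L : seq (seq (R * G))) : {subset L <= rho} -> exists k (psi : G -> E k),
    {in s ++ terms rho, forall y, u k (psi y) = y} /\ {in L, forall l, lc psi l = 0}.
  elim: L => [|l L IHL] sub; first by exists i, psi.
  have [|k [phi [phiE phi0]]] := IHL; first by move=> l' lL; apply: sub; rewrite inE lL orbT.
  have [|k' [f [fE f0]]] := ker k (lc phi l).
    rewrite lc_linear -(rho0 l (sub l (mem_head _ _))).
    apply: (eq_lc_terms (rho := rho)) => [y yr /=|]; last exact/sub/mem_head.
    by rewrite phiE // mem_cat yr orbT.
  exists k', (f \o phi); split=> [y ys /=|l']; first by rewrite fE phiE.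
  rewrite inE -lc_linear => /orP[/eqP->//|l'L].
  by rewrite phi0 // linear0.
have [|k [psi' [psi'E psi'0]]] := lift rho; first by [].
exists (inj k \o psi'); split=> [y ys /=|l lr].
  by rewrite pE psi'E // mem_cat ys.
by rewrite -lc_linear psi'0 // linear0.
Qed.

End DirectedColimit.

Section Stages.
Variables (R : pzRingType) (X : lmodType R -> Prop).
Variables (N M : lmodType R) (c : {linear N -> M}).
Hypotheses (X_sums : closed_sums X) (X_pquot : closed_pure_quotients X).

Notation factorization := (factorization X c).
Notation fact_in := (@fact_in R X N M c).
Notation fact_out := (@fact_out R X N M c).

Section Chains.
Variable Om : Type.

(** The generators make a map between two presentations compatible with them
    unique, so that a chain is a directed system.  The index set [Om] is fixed,
    while the subset of indices in use varies. *)
Record pres := Pres {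
  pres_obj :> factorization;
  pres_dom : Om -> Prop;
  pres_gen : Om -> pres_obj;
  pres_span : spans pres_dom pres_gen
}.

Definition pres_le (s t : pres) : Prop :=
  (forall w, pres_dom s w -> pres_dom t w) /\
  exists g : {linear s -> t}, fact_hom g /\ forall w, pres_dom s w -> g (pres_gen s w) = pres_gen t w.

Lemma pres_le_refl t : pres_le t t.
Proof. by split=> //; exists idfun. Qed.

Lemma pres_le_trans (r s t : pres) : pres_le r s -> pres_le s t -> pres_le r t.
Proof.
move=> [rs [g [gh gE]]] [st [h [hh hE]]]; split=> [w /rs/st //|].
exists (h \o g); split; first exact: fact_hom_comp.
by move=> w rw /=; rewrite gE // hE //; exact: rs.
Qed.

Lemma pres_le_lc (s t : pres) (g : {linear s -> t}) :
  (forall w, pres_dom s w -> g (pres_gen s w) = pres_gen t w) ->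
  forall l, supported (pres_dom s) l -> g (lc (pres_gen s) l) = lc (pres_gen t) l.
Proof. by move=> gE l sl; rewrite lc_linear; apply: eq_lc_supported sl => w; exact: gE. Qed.

Variable A : pres -> Prop.
Hypothesis A_ex : exists t, A t.
Hypothesis A_tot : forall s t, A s -> A t -> pres_le s t \/ pres_le t s.

Let D w := exists t, A t /\ pres_dom t w.

Let D_supported t (l : seq (R * Om)) : A t -> supported (pres_dom t) l -> supported D l.
Proof. by move=> At; apply: supported_imp => w tw; exists t. Qed.

Lemma chain_supported (l : seq (R * Om)) : supported D l -> exists t, A t /\ supported (pres_dom t) l.
Proof.
elim: l => [_|x l IHl /= [[t [At tx]] /IHl[t' [At' t'l]]]].
  by have [t At] := A_ex; exists t.
case: (A_tot At At') => [[tt' _]|[t't _]].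
  by exists t'; split=> //; split=> //; exact: tt'.
by exists t; split=> //; split=> //; exact: supported_imp t'l.
Qed.

Let K (l : seq (R * Om)) := exists t, [/\ A t, supported (pres_dom t) l & lc (pres_gen t) l = 0].

Let K_lc t l : A t -> supported (pres_dom t) l -> K l ->
  exists t', [/\ A t', pres_le t t', supported (pres_dom t') l & lc (pres_gen t') l = 0].
Proof.
move=> At tl [t' [At' t'l l0]]; case: (A_tot At At') => tt'; first by exists t'.
exists t; split=> //; first exact: pres_le_refl.
by have [_ [g [_ gE]]] := tt'; rewrite -(pres_le_lc gE t'l) l0 linear0.
Qed.

Lemma K_comb a l l' : K l -> K l' -> K (fscale a l ++ l').
Proof.
have KP (s t : pres) b (m m' : seq (R * Om)) : pres_le s t -> supported (pres_dom s) m -> lc (pres_gen s) m = 0 ->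
    supported (pres_dom t) m' -> lc (pres_gen t) m' = 0 ->
    supported (pres_dom t) m /\ lc (pres_gen t) (fscale b m) = 0.
  move=> [st [g [_ gE]]] sm m0 _ _; split; first exact: supported_imp sm.
  by rewrite lc_scale -(pres_le_lc gE sm) m0 linear0 scaler0.
move=> [t [At tl l0]] [t' [At' t'l l'0]]; case: (A_tot At At') => tt'.
  have [t'l' e] := KP t t' a l l' tt' tl l0 t'l l'0.
  exists t'; split=> //; first by apply/supported_cat; split=> //; exact: supported_scale.
  by rewrite lc_cat e l'0 addr0.
have [tl' e] := KP t' t 1 l' l tt' t'l l'0 tl l0.
exists t; split=> //; first by apply/supported_cat; split=> //; exact: supported_scale.
by move: e; rewrite lc_cat !lc_scale l0 scaler0 scale1r add0r.
Qed.

Lemma chain_module : exists (G : lmodType R) (p : Om -> G), spans D p /\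
  forall l, supported D l -> (lc p l = 0 <-> K l).
Proof.
pose OmD := {w | D w}.
have [F [b [b_gen b_univ]]] := free_exists R OmD.
pose KF x := exists l : seq (R * OmD), K (fmap sval l) /\ lc b l = x.
have sK : subm KF.
  split; first by exists [::]; rewrite lc_nil; split=> //; have [t At] := A_ex; exists t; rewrite lc_nil.
  move=> a _ _ [l [Kl <-]] [l' [Kl' <-]]; exists (fscale a l ++ l').
  rewrite lc_cat lc_scale; split=> //.
  have -> : fmap sval (fscale a l ++ l') = fscale a (fmap sval l) ++ fmap sval l'.
    by rewrite /fmap /fscale map_cat -!map_comp.
  exact: K_comb.
have [G [q [q_surj qP]]] := quotient_exists sK.
pose p w : G := if pselect (D w) is left Dw then q (b (exist _ w Dw)) else 0.
have pE (l : seq (R * OmD)) : q (lc b l) = lc p (fmap sval l).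
  rewrite lc_map lc_linear; apply: eq_lc => -[w Dw] /=; rewrite /p.
  by case: pselect => // Dw'; rewrite (Prop_irrelevance Dw Dw').
have lift (l : seq (R * Om)) : supported D l -> exists l' : seq (R * OmD), fmap sval l' = l.
  elim: l => [_|[a w] l IHl /= [Dw /IHl[l' <-]]]; first by exists [::].
  by exists ((a, exist _ w Dw) :: l').
have on_val (l : seq (R * OmD)) : supported D (fmap sval l).
  by apply: supported_map => -[].
exists G, p; split=> [y|l Dl].
  have [x <-] := q_surj y; have [l <-] := b_gen x.
  by exists (fmap sval l).
have [l' l'E] := lift l Dl; rewrite -l'E -pE; split=> [/qP[l2 [Kl2 e]]|Kl].
  have [t [At tl]] := chain_supported (on_val l').
  have [t2 [At2 tl2 l20]] := Kl2.
  (* compare the two combinations in a common member of the chain *)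
  have [u [Au ul ul2 l2u]] : exists u, [/\ A u, supported (pres_dom u) (fmap sval l'),
      supported (pres_dom u) (fmap sval l2) & lc (pres_gen u) (fmap sval l2) = 0].
    case: (A_tot At At2) => -[sub [g [_ gE]]].
      by exists t2; split=> //; exact: supported_imp tl.
    exists t; split=> //; first exact: supported_imp tl2.
    by rewrite -(pres_le_lc gE tl2) l20 linear0.
  have [f fE] := b_univ u (fun w => pres_gen u (sval w)).
  exists u; split=> //; rewrite -l2u !lc_map.
  have fl m : f (lc b m) = lc (pres_gen u \o sval) m.
    by rewrite lc_linear; apply: eq_lc => w /=; rewrite fE.
  by rewrite -!fl e.
by apply/qP; exists l'.
Qed.

(** The cokernel of the colimit is the directed colimit of the cokernels, indexed
    by a set because a member of the chain only matters through its generators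
    and relations. *)
Lemma chain_bound : exists u : pres,
  [/\ forall t, A t -> pres_le t u, forall w, pres_dom u w <-> D w
    & forall l, supported D l -> (lc (pres_gen u) l = 0 <-> K l)].
Proof.
have [G [p [Gspan GK]]] := chain_module.
have /dep_choice[g gE] : forall t : pres, exists g : {linear t -> G}, A t ->
    forall l, supported (pres_dom t) l -> g (lc (pres_gen t) l) = lc p l.
  move=> t; case: (pselect (A t)) => [At|]; last by exists \0.
  have [|g gE] := @span_map R Om (pres_dom t) t G (pres_gen t) p (@pres_span t); last by exists g.
  by move=> l tl l0; apply/GK; [exact: D_supported tl|exists t].
have gw (t : pres) w : A t -> pres_dom t w -> g t (pres_gen t w) = p w.
  by move=> At tw; have := gE t At [:: (1, w)]; rewrite !lc1 !scale1r /=; apply.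
have gtrans (s t : pres) (h : {linear s -> t}) : A s -> A t ->
    (forall w, pres_dom s w -> pres_dom t w) ->
    (forall w, pres_dom s w -> h (pres_gen s w) = pres_gen t w) -> forall x, g t (h x) = g s x.
  move=> As At sub hE x; have [l [sl <-]] := @pres_span s x.
  by rewrite (pres_le_lc hE sl) !gE //; exact: supported_imp sl.
have gker (t : pres) (x : t) : A t -> g t x = 0 -> exists (t' : pres) (h : {linear t -> t'}),
    [/\ A t', pres_le t t', forall w, pres_dom t w -> h (pres_gen t w) = pres_gen t' w, fact_hom h & h x = 0].
  move=> At; have [l [tl <-]] := @pres_span t x; rewrite gE // => /GK-/(_ (D_supported At tl)).
  move=> /(K_lc At tl)[t' [At' tt' t'l l0]]; have [_ [h [hh hE]]] := tt'.
  by exists t', h; split=> //; rewrite (pres_le_lc hE tl).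
have gsurj y : exists (t : pres) (x : t), A t /\ g t x = y.
  have [l [Dl <-]] := Gspan y; have [t [At tl]] := chain_supported Dl.
  by exists t, (lc (pres_gen t) l); rewrite gE.
(* the structure maps, glued from those of the members of the chain *)
have [t0 At0] := A_ex; pose n : {linear N -> G} := g t0 \o fact_in t0.
have nE (t : pres) : A t -> forall x, g t (fact_in t x) = n x.
  move=> At x; case: (A_tot At At0) => -[sub [h [hh hE]]].
    by rewrite -(gtrans _ _ h) // hh.1.
  by rewrite /n /= -(gtrans _ _ h) // hh.1.
have /choice[mw mwE] : forall w, exists y, forall t : pres, A t -> pres_dom t w -> fact_out t (pres_gen t w) = y.
  move=> w; case: (pselect (D w)) => [[t [At tw]]|nD]; last first.
    by exists 0 => t At tw; case: nD; exists t.
  exists (fact_out t (pres_gen t w)) => s As sw.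
  case: (A_tot As At) => -[sub [h [hh hE]]].
    by rewrite -hh.2 hE.
  by rewrite -hh.2 hE.
have mwlc (t : pres) (l : seq (R * Om)) : A t -> supported (pres_dom t) l -> fact_out t (lc (pres_gen t) l) = lc mw l.
  by move=> At tl; rewrite lc_linear; apply: eq_lc_supported tl => w tw; exact: mwE.
have [|m mE] := @span_map R Om D G M p mw Gspan.
  move=> l Dl /(GK _ Dl)[t [At tl l0]].
  by rewrite -(mwlc t) // l0 linear0.
have mg (t : pres) : A t -> forall x, m (g t x) = fact_out t x.
  move=> At x; have [l [tl <-]] := @pres_span t x.
  by rewrite gE // mE ?mwlc //; exact: D_supported tl.
have mn x : m (n x) = c x by rewrite /n /= mg // fact_comp.
(* H t is the cokernel of the member t, HG that of the colimit *)
have /choice[H] : forall t : pres, exists H : lmodType R, exists pr : {linear t -> H},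
  short_exact (fact_in t) pr /\ X H by move=> t; exact: fact_coker.
move=> /dep_choice[pr prP].
have pr0 (t : pres) x : pr t x = 0 <-> exists y, fact_in t y = x by have [[_ h _] _] := prP t; exact: h.
have prfin (t : pres) y : pr t (fact_in t y) = 0 by apply/pr0; exists y.
have pr_surj (t : pres) : surjection (pr t) by have [[]] := prP t.
have [HG [prG [prG_surj prG0]]] := quotient_exists (subm_im n).
have /dep_choice[u uE] : forall t : pres, exists u : {linear H t -> HG}, A t ->
    forall x, u (pr t x) = prG (g t x).
  move=> t; case: (pselect (A t)) => [At|]; last by exists \0.
  have [|u uE] := @descend R t (H t) HG (pr t) (prG \o g t) (pr_surj t); last by exists u.
  by move=> x /pr0[y <-]; apply/prG0; exists y; rewrite nE.
have induced (s t : pres) : A s -> A t -> pres_le s t -> exists h : {linear s -> t},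
    exists f : {linear H s -> H t},
    [/\ forall l, supported (pres_dom s) l -> h (lc (pres_gen s) l) = lc (pres_gen t) l,
        forall x, f (pr s x) = pr t (h x), forall x, u t (f x) = u s x
      & forall y, h (fact_in s y) = fact_in t y].
  move=> As At [sub [h [hh hE]]]; exists h.
  have [|f fE] := @descend R s (H s) (H t) (pr s) (pr t \o h) (pr_surj s).
    by move=> x /pr0[y <-]; rewrite /= hh.1 prfin.
  exists f; split=> // [l|y|y]; [exact: pres_le_lc| |exact: hh.1].
  by have [x <-] := pr_surj s y; rewrite fE !uE // (gtrans s t h).
pose code := ((Om -> Prop) * (seq (R * Om) -> Prop))%type.
pose codeof (t : pres) : code := (pres_dom t, fun l => lc (pres_gen t) l = 0).
pose I := {k : code | exists2 t, A t & codeof t = k}.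
have /choice[rep repP] : forall i : I, exists t, A t /\ codeof t = sval i.
  by move=> i; have [t At tE] := svalP i; exists t.
have Arep i : A (rep i) by have [] := repP i.
have rep_of (t : pres) : A t -> exists i, [/\ pres_dom (rep i) = pres_dom t
    & forall l, (lc (pres_gen (rep i)) l = 0) = (lc (pres_gen t) l = 0)].
  move=> At; have ex : exists2 s, A s & codeof s = codeof t by exists t.
  exists (exist _ (codeof t) ex); have [_ /= e] := repP (exist _ (codeof t) ex).
  split=> [|l]; first exact: (congr1 fst e).
  exact: (congr1 (fun k : code => k.2 l) e).
have XHG : X HG.
  apply: (directed_closed X_sums X_pquot (u := fun i => u (rep i))).
  - move=> i j; case: (A_tot (Arep i) (Arep j)) => le.
      have [h [f [_ _ fu _]]] := induced _ _ (Arep i) (Arep j) le.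
      by exists j, f, idfun.
    have [h [f [_ _ fu _]]] := induced _ _ (Arep j) (Arep i) le.
    by exists i, idfun, f.
  - move=> y; have [z <-] := prG_surj y; have [l [Dl <-]] := Gspan z.
    have [t [At tl]] := chain_supported Dl; have [i [iD _]] := rep_of t At.
    exists i, (pr _ (lc (pres_gen (rep i)) l)); rewrite uE // gE //.
    by rewrite iD.
  - move=> i y; have [x <-] := pr_surj _ y; rewrite uE // => /prG0[z zE].
    have [l [il lE]] := @pres_span (rep i) (x - fact_in _ z).
    have Kl : K l.
      apply/GK; first exact: D_supported il.
      by rewrite -(gE (rep i)) // lE linearB nE // zE subrr.
    have [t [At le tl l0]] := K_lc (Arep i) il Kl.
    have [j [jD j0]] := rep_of t At.
    have jl : lc (pres_gen (rep j)) l = 0 by rewrite j0.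
    case: (A_tot (Arep i) (Arep j)) => ij.
      have [h [f [hl fpr fu hfin]]] := induced _ _ (Arep i) (Arep j) ij.
      exists j, f; split=> //; rewrite fpr.
      have : h (x - fact_in (rep i) z) = 0 by rewrite -lE hl.
      by rewrite linearB hfin => /subr0_eq->; exact: prfin.
    have [h [f [hl fpr fu hfin]]] := induced _ _ (Arep j) (Arep i) ij.
    exists i, idfun; split=> //=.
    have : x - fact_in (rep i) z = 0 by rewrite -lE -hl ?jD // jl linear0.
    by move=> /subr0_eq->; exact: prfin.
  - by move=> i; have [] := prP (rep i).
have n_inj : injective n.
  apply: linear_inj => x /(gker _ _ At0)[t [h [At _ _ hh h0]]].
  have [[i_inj _ _] _] := prP t.
  by apply: i_inj; rewrite -hh.1 h0 linear0.
have exG : short_exact n prG by split.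
pose G' := @Factorization R X N M c G n m mn (ex_intro _ HG (ex_intro _ prG (conj exG XHG))).
exists (@Pres G' D p Gspan); split=> // t At.
split=> [w tw|]; first by exists t.
exists (g t); split; last by move=> w tw; exact: gw.
by split=> x; [exact: nE|exact: mg].
Qed.

End Chains.

(** * Minimal factorizations *)

Variable Z : factorization.
Hypothesis Zterm : forall t : factorization, has_hom t Z.

(** Besides the elements of [Z] there is room for a copy of [Z] for each formal
    combination; the copy belonging to [l] is put to use when [l] is killed, so
    that fresh indices remain available after any union. *)
Inductive marked : Type := mark_base of Z | mark_new of seq (R * marked) & Z.

(** In a maximal presentation no map to [Z] can kill a nonzero element [lc l],
    since replacing the module by [Z] and using the indices reserved for [l] would
    give a strictly larger presentation. *)
Lemma injective_stage : exists t : factorization,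
  has_hom Z t /\ forall g : {linear t -> Z}, fact_hom g -> injective g.
Proof.
pose good (t : pres marked) := has_hom Z t /\
  forall l z, pres_dom t (mark_new l z) -> supported (pres_dom t) l /\ lc (pres_gen t) l = 0.
pose D0 (w : marked) := if w is mark_base _ then True else False.
pose p0 (w : marked) : Z := if w is mark_base z then z else 0.
have sp0 : spans D0 p0.
  by move=> z; exists [:: (1, mark_base z)]; rewrite lc1 scale1r; split.
have good0 : good (Pres sp0) by split; [exact: has_hom_refl|].
have [A Aex Agood Atot|t [Zt tgood] tmax] := zorn good0 (@pres_le_refl marked) (@pres_le_trans marked).
  have [u [ub uD _]] := chain_bound Aex Atot; exists u => //; split.
    have [t At] := Aex; have [Zt _] := Agood t At; have [_ [g [gh _]]] := ub t At.
    by apply: has_hom_trans Zt _; exists g.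
  move=> l z /uD[t [At tz]]; have [_ /(_ l z tz)[tl l0]] := Agood t At.
  have [sub [g [_ gE]]] := ub t At; split; first exact: supported_imp tl.
  by rewrite -(pres_le_lc gE tl) l0 linear0.
exists t; split=> // g gh; apply: linear_inj => e ge; apply: contrapT => e0.
have [l [tl lE]] := @pres_span _ t e.
have new z : ~ pres_dom t (mark_new l z) by move=> /tgood[_]; rewrite lE.
pose D' w := pres_dom t w \/ exists z, w = mark_new l z.
pose p' (w : marked) : Z := if w is mark_new l' z then
    (if pselect (l' = l) then z else g (pres_gen t w)) else g (pres_gen t w).
have p'E w : pres_dom t w -> g (pres_gen t w) = p' w.
  case: w => [//|l' z] /=; case: pselect => // ll' tl'; case: (new z).
  by rewrite -ll'.
have p'l l' : supported (pres_dom t) l' -> lc p' l' = g (lc (pres_gen t) l').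
  move=> tl'; rewrite lc_linear; apply: eq_lc_supported tl' => w tw /=.
  by rewrite p'E.
have sp' : spans D' p'.
  move=> z; exists [:: (1, mark_new l z)]; split; first by split=> //; right; exists z.
  by rewrite lc1 scale1r /=; case: pselect.
have tD' l' : supported (pres_dom t) l' -> supported D' l' by apply: supported_imp => w; left.
have [||sub _] := tmax (Pres sp').
- split; first exact: has_hom_refl.
  move=> l' z /= [/tgood[tl' l'0]|[z' [-> _]]].
    by split; [exact: tD'|rewrite p'l // l'0 linear0].
  by split; [exact: tD'|rewrite p'l // lE].
- by split=> [w tw|]; [left|exists g].
by apply: (new 0); apply: sub; right; exists 0.
Qed.

Lemma cantor_injective (T : Type) (f : (T -> Prop) -> T) : ~ injective f.
Proof.
move=> f_inj; pose S z := exists P, f P = z /\ ~ P z.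
case: (pselect (S (f S))) => [SS|nSS]; last by apply: (nSS); exists S.
by have [P [/f_inj -> nS]] := SS.
Qed.

Lemma inj_surj_bij (T U : Type) (f : T -> U) : injective f -> surjection f -> bijective f.
Proof.
by move=> f_inj /choice[g gE]; exists g => // x; apply: f_inj; rewrite gE.
Qed.

(** Take a factorization from the injective stage embedded in [Z * (Z -> Prop)] and
    maximal under extension of the embedding.  As it embeds in [Z], it misses a
    column by Cantor's theorem.  If an endomorphism [e] were not surjective, then
    regarding the module as an extension of its copy [im e], with the elements
    outside [im e] placed in that column, would contradict maximality. *)
Lemma minimal_factorization : exists t : factorization,
  (forall s : factorization, has_hom s t) /\ forall e : {linear t -> t}, fact_hom e -> bijective e.
Proof.
have [tA [ZtA tA_inj]] := injective_stage.
pose Om := (Z * (Z -> Prop))%type.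
pose good (t : pres Om) := [/\ has_hom Z t, forall g : {linear t -> Z}, fact_hom g -> injective g,
  forall x, exists w, pres_dom t w /\ pres_gen t w = x
  & forall w w', pres_dom t w -> pres_dom t w' -> pres_gen t w = pres_gen t w' -> w = w'].
have [g gh] := Zterm tA; have g_inj := tA_inj g gh.
have /choice[k kE] : forall z, exists x, (exists y, g y = z) -> g x = z.
  by move=> z; case: (pselect (exists y, g y = z)) => [[x xE]|]; [exists x|exists 0].
pose D0 (w : Om) := w.2 = (fun=> True) /\ exists x, g x = w.1.
pose p0 (w : Om) := k w.1.
have p0K x : p0 (g x, fun=> True) = x by apply: g_inj; apply: kE; exists x.
have D0g x : D0 (g x, fun=> True) by split=> //; exists x.
have sp0 : spans D0 p0.
  move=> x; exists [:: (1, (g x, fun=> True))]; rewrite lc1 scale1r.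
  by rewrite p0K; split=> //; split=> //; exact: D0g.
have good0 : good (Pres sp0).
  split=> //= [x|w w' [w2 [x xw]] [w'2 [x' xw']]].
    by exists (g x, fun=> True); split; [exact: D0g|exact: p0K].
  move=> e; apply: pair_ext; last by rewrite w2 w'2.
  have <- := kE w.1 (ex_intro _ x xw); have <- := kE w'.1 (ex_intro _ x' xw').
  by congr (g _); exact: e.
have [A Aex Agood Atot|t [Zt t_inj t_surj t_uniq] tmax] :=
    zorn good0 (@pres_le_refl Om) (@pres_le_trans Om).
  have [u [ub uD uK]] := chain_bound Aex Atot; exists u => //.
  have from x : exists t, A t /\ exists (h : {linear t -> u}) (y : t),
      [/\ fact_hom h, forall w, pres_dom t w -> h (pres_gen t w) = pres_gen u w & h y = x].
    have [l [ul <-]] := @pres_span _ u x.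
    have [|t [At tl]] := chain_supported Aex Atot (l := l); first by apply: supported_imp ul => w /uD.
    have [_ [h [hh hE]]] := ub t At; exists t; split=> //.
    by exists h, (lc (pres_gen t) l); split=> //; exact: pres_le_lc.
  split.
  - have [t At] := Aex; have [Zt _ _ _] := Agood t At; have [_ [h [hh _]]] := ub t At.
    by apply: has_hom_trans Zt _; exists h.
  - move=> f fh; apply: linear_inj => x.
    have [t [At [h [y [hh _ <-]]]]] := from x; have [_ t_inj _ _] := Agood t At.
    move=> fhy; rewrite (t_inj (f \o h) (fact_hom_comp hh fh) y 0) ?linear0 //.
  - move=> x; have [t [At [h [y [hh hE <-]]]]] := from x.
    have [_ _ /(_ y)[w [tw <-]] _] := Agood t At; exists w; rewrite hE //.
    by split=> //; apply/uD; exists t.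
  - move=> w w' uw uw' e.
    have [|t [At [tw [tw' _]]]] := (uK [:: (1, w); (-1, w')]
        (conj ((uD w).1 uw) (conj ((uD w').1 uw') I))).1.
      by rewrite !lc_cons lc_nil /= scale1r scaleN1r addr0 e subrr.
    rewrite !lc_cons lc_nil /= scale1r scaleN1r addr0 => /subr0_eq.
    by have [_ _ _ t_uniq] := Agood t At; exact: t_uniq.
exists t; split=> [s|e eh]; first exact: has_hom_trans (Zterm s) Zt.
have [h hh] := Zterm t; have h_inj := t_inj h hh.
have e_inj : injective e.
  by move=> x y /(congr1 h) exy; apply: (t_inj (h \o e)) exy; exact: fact_hom_comp.
apply: inj_surj_bij => //.
(* otherwise h would embed the set of all columns in Z *)
have [col colP] : exists col : Z -> Prop, forall z, ~ pres_dom t (z, col).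
  apply: contrapT => nocol.
  have /choice[z zP] : forall col : Z -> Prop, exists z, pres_dom t (z, col).
    by move=> col; apply: contrapT => nz; apply: nocol; exists col => z tz; apply: nz; exists z.
  apply: (@cantor_injective Z (fun col => h (pres_gen t (z col, col)))) => P Q /h_inj.
  by move=> /(t_uniq _ _ (zP P) (zP Q))/(congr1 snd).
pose D' (w : Om) := pres_dom t w \/ w.2 = col /\ exists y, h y = w.1 /\ ~ exists x, e x = y.
have /choice[r rE] : forall z, exists y, (exists y, h y = z) -> h y = z.
  by move=> z; case: (pselect (exists y, h y = z)) => [[x xE]|]; [exists x|exists 0].
have rK y : r (h y) = y by apply: h_inj; apply: rE; exists y.
pose p' (w : Om) : t := if pselect (pres_dom t w) then e (pres_gen t w) else r w.1.
have p'E w : pres_dom t w -> e (pres_gen t w) = p' w by rewrite /p'; case: pselect.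
have p'N y : p' (h y, col) = y.
  rewrite /p'; case: pselect => [tw|nt]; last exact: rK.
  by case: (colP _ tw).
have p'_surj y : exists w, D' w /\ p' w = y.
  case: (pselect (exists x, e x = y)) => [[x <-]|ny].
    have [w [tw <-]] := t_surj x; exists w; rewrite -p'E //.
    by split=> //; left.
  by exists (h y, col); split; [right; split=> //; exists y|exact: p'N].
have p'_inj w w' : D' w -> D' w' -> p' w = p' w' -> w = w'.
  have aux z v y v' : pres_dom t v -> v' = (h y, col) -> (~ exists x, e x = y) ->
      p' v = p' v' -> z.
    by move=> tv -> ny; rewrite p'N -p'E // => ey; case: ny; exists (pres_gen t v).
  move=> [tw|[w2 [y [yw ny]]]] [tw'|[w'2 [y' [y'w' ny']]]].
  - by rewrite -!p'E // => /e_inj; exact: t_uniq.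
  - by apply: aux tw _ ny'; apply: pair_ext.
  - by move=> /esym; apply: aux tw' _ ny; apply: pair_ext.
  - have -> : w = (h y, col) by apply: pair_ext.
    have -> : w' = (h y', col) by apply: pair_ext.
    by rewrite !p'N => ->.
have sp' : spans D' p'.
  move=> y; have [w [Dw <-]] := p'_surj y; exists [:: (1, w)].
  by rewrite lc1 scale1r; split=> //; split.
have [||sub _] := tmax (Pres sp'); first by split.
  by split=> [w tw|]; [left|exists e].
move=> y; apply: contrapT => ny; apply: (colP (h y)); apply: sub.
by right; split=> //; exists y.
Qed.

End Stages.

Lemma minimal_weakly_terminal (R : pzRingType) (X : lmodType R -> Prop)
    (N M : lmodType R) (c : {linear N -> M}) :
  closed_sums X -> closed_pure_quotients X ->
  exists t : factorization X c, (forall s : factorization X c, has_hom s t) /\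
    forall e : {linear t -> t}, fact_hom e -> bijective e.
Proof.
move=> X_sums X_pquot; have [Z Zterm] := weakly_terminal c X_sums X_pquot.
exact: minimal_factorization Zterm.
Qed.

(** * Covers, envelopes and perfect cotorsion pairs *)

Section Approximations.
Variables (R : pzRingType) (X : lmodType R -> Prop).
Implicit Types (E F G H K L M N : lmodType R).

Lemma linear_inverse M N (f : {linear M -> N}) : bijective f ->
  exists g : {linear N -> M}, cancel f g /\ cancel g f.
Proof.
move=> f_bij; have [h fK hK] := f_bij.
have [|g gE] := @corestrict R M N N f idfun (bij_inj f_bij).
  by move=> x; exists (h x); exact: hK.
by exists g; split=> x; [apply: (bij_inj f_bij)|]; rewrite gE.
Qed.

Hypotheses (X_sums : closed_sums X) (X_pquot : closed_pure_quotients X).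

Let zero_mod : lmodType R := 'rV[R]_0.

Let zero_modE (x y : zero_mod) : x = y.
Proof. by apply/rowP => -[]. Qed.

(** The factorizations of the zero map out of the zero module are the modules of
    [X] over [M]. *)
Lemma covering_of_sums_pure_quotients : covering X.
Proof.
move=> M; pose c : {linear zero_mod -> M} := \0.
have [t [term min]] := minimal_weakly_terminal c X_sums X_pquot.
exists t, (fact_out t); split; last first.
  move=> e eE; apply: min; split=> x; last exact: eE.
  by rewrite (zero_modE x 0) !linear0.
split.
  have [H [p [[_ np p_surj] XH]]] := fact_coker t.
  apply: (pure_quotients_iso X_pquot) XH.
  have p_inj : injective p.
    by apply: linear_inj => x /np[z <-]; rewrite (zero_modE z 0) linear0.
  have [g [pg gp]] := linear_inverse (inj_surj_bij p_inj p_surj).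
  by exists g; exists p.
move=> F f XF; pose n : {linear zero_mod -> F} := \0.
have ex : short_exact n (idfun : {linear F -> F}).
  split=> [x y _|x|x]; [exact: zero_modE| |by exists x].
  by split=> [/= ->|[y <-] //]; exists 0.
have nc x : f (n x) = c x by exact: linear0.
have coker : exists H (p : {linear F -> H}), short_exact n p /\ X H by exists F, idfun.
pose s := Factorization nc coker.
by have [g [_ gE]] := term s; exists g.
Qed.

Hypothesis X_ext : closed_extensions X.

(** Let [N -> E] be a minimal factorization over zero with cokernel [H].  An
    extension [L] of a module of [X] by [E] is a factorization too, because its
    cokernel is an extension of modules of [X]; the map back from [L] to [E] is
    bijective on [E], so the extension splits. *)
Lemma enveloping_right_perp : enveloping (right_perp X).
Proof.
move=> N; pose c : {linear N -> zero_mod} := \0.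
have [t [term min]] := minimal_weakly_terminal c X_sums X_pquot.
have [H [p [ex XH]]] := fact_coker t.
exists t, (fact_in t); split; last first.
  by move=> e eE; apply: min; split=> x; [exact: eE|exact: zero_modE].
split; last first.
  by move=> G f XG; have [g gE] := Ext1_extend (XG H XH) ex f; exists g.
move=> M XM; apply: split_Ext1 => L i q exi.
have [Q [r [i' [q' [exr ex' _]]]]] := short_exact_comp ex exi.
have XQ : X Q by exact: X_ext ex' XH XM.
have nc x : (\0 : {linear L -> zero_mod}) ((i \o fact_in t) x) = c x by [].
have coker : exists H (p : {linear L -> H}), short_exact (i \o fact_in t) p /\ X H.
  by exists Q, r.
have [g [gE _]] := term (Factorization nc coker).
have /linear_inverse[k [kK _]] : bijective (g \o i : {linear t -> t}).
  by apply: min; split=> x; [exact: gE|exact: zero_modE].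
by exists (k \o g) => x; exact: kK.
Qed.

Hypothesis X_ring : X (R^o : lmodType R).

(** Maps out of the ring factor through the cover. *)
Lemma cover_surjective F M (f : {linear F -> M}) : cover X f -> surjection f.
Proof.
move=> [[XF pre] _] m.
have [h hE] := pre _ (linear_of (scale_linear m)) X_ring.
by exists (h 1); rewrite -[LHS]/((f \o h) 1) hE linear_ofE scale1r.
Qed.

(** Wakamatsu's lemma: the pushout of an extension of the kernel along [k] lies in
    [X] and maps to [M], hence factors through the cover; the resulting
    endomorphism of [F] is bijective and gives a retraction. *)
Lemma cover_kernel F M K (f : {linear F -> M}) (k : {linear K -> F}) :
  cover X f -> injective k -> exact k f -> right_perp X K.
Proof.
move=> [[XF pre] min] k_inj kf M' XM'; apply: split_Ext1 => L i p ex.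
have [Q [u [v [p' [exu uv _ univ]]]]] := pushout_short_exact k ex.
have fk x : f (k x) = 0 by apply/kf; exists x.
have [|f' [f'u f'v]] := univ M f \0; first by move=> x; rewrite fk.
have XQ : X Q by exact: X_ext exu XF XM'.
have [g gE] := pre Q f' XQ.
have fe : f \o (g \o u) =1 f by move=> x; rewrite -[LHS]/((f \o g) (u x)) gE f'u.
have [e [eK Ke]] := linear_inverse (min (g \o u) fe).
have f_e x : f (e x) = f x by rewrite -{2}(Ke x) -[RHS]/((f \o (g \o u)) (e x)) fe.
have [|r rE] := @corestrict R K F L k (e \o g \o v) k_inj.
  move=> l; apply/kf; rewrite /= f_e -[LHS]/((f \o g) (v l)) gE.
  by rewrite f'v.
exists r => x; apply: k_inj; rewrite rE /= -uv.
exact: (eK (k x)).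
Qed.

(** A module left orthogonal to the right orthogonal of [X] is a direct summand of
    its cover, since the kernel of the cover is in that right orthogonal. *)
Lemma perfect_cotorsion : perfect_cotorsion_pair X (right_perp X).
Proof.
split; [|exact: covering_of_sums_pure_quotients|exact: enveloping_right_perp].
split=> // M; split=> [XM N|perpM]; first exact.
have [F [f fcov]] := covering_of_sums_pure_quotients M.
have [K [k [k_inj kf]]] := kernel_exists f.
have K_perp := cover_kernel fcov k_inj kf.
have ex : short_exact k f by split=> //; exact: cover_surjective fcov.
have [s sE] := Ext1_lift idfun (perpM K K_perp) ex.
have [[XF _] _] := fcov; apply: X_pquot XF => /= S rho rho0.
exists s; split=> [y _|l lr]; first exact: sE.
by rewrite -[LHS](lc_linear s id) rho0 ?linear0.
Qed.

Lemma right_perp_iso (Y : lmodType R -> Prop) : iso_closed (right_perp Y).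
Proof.
move=> M N [f /linear_inverse[g [fK gK]]] YM E YE; apply: extend_Ext1 => K L i p ex h.
have [e eE] := Ext1_extend (YM E YE) ex (g \o h).
by exists (f \o e) => x; rewrite /= eE /= gK.
Qed.

Lemma first_half_of_closed : first_half_of_perfect_cotorsion_pair X.
Proof.
by exists (right_perp X); [exact: right_perp_iso|exact: perfect_cotorsion].
Qed.

End Approximations.

(** * Preenvelopes *)

Section Preenvelopes.
Variables (R : pzRingType) (X : lmodType R -> Prop).
Hypotheses (X_prod : closed_products X) (X_psub : closed_pure_submodules X).
Implicit Types (E F G H K L M N S : lmodType R).

(** Close the image of [f] under solving finite systems; the result is the image of
    a set of terms that only depends on [N]. *)
Lemma small_pure_submodule N G (f : {linear N -> G}) : X G ->
  exists S (w : sol_term R N -> S) (n : {linear N -> S}) (i : {linear S -> G}),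
    [/\ X S, surjection w, forall x, n x = w (sol_base R x) & forall x, i (n x) = f x].
Proof.
move=> XG; pose ev := sol_eval f (fun x => x = 0).
have ev_pure := @sol_eval_pure R N G f (fun x => x = 0) 0.
pose P x := exists u, ev u = x.
have sP : subm P.
  split=> [|a x y Px Py]; first by exists (sol_base R 0); exact: linear0.
  have [||h [hE h0]] := ev_pure [:: x; y] [:: [:: (a, x); (1, y); (-1, a *: x + y)]].
  - by move=> z; rewrite !inE => /orP[]/eqP->.
  - move=> l; rewrite inE => /eqP->; rewrite !lc_cons lc_nil /= scale1r scaleN1r addr0.
    by rewrite addrA subrr.
  exists (h (a *: x + y)); have := h0 _ (mem_head _ _).
  rewrite !lc_cons lc_nil /= scale1r scaleN1r addr0.
  rewrite (hE x) ?(hE y) ?inE ?eqxx ?orbT // addrA => /eqP.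
  by rewrite subr_eq0 => /eqP.
have [S [i [i_inj iP]]] := sub_exists sP.
have /choice[w wE] : forall u, exists x, i x = ev u by move=> u; apply/iP; exists u.
have [|n nE] := @corestrict R S G N i f i_inj.
  by move=> x; apply/iP; exists (sol_base R x).
exists S, w, n, i; split=> //.
- apply: X_psub XG => s rho rho0.
  have [|h [hE h0]] := ev_pure (map i s) rho _ rho0.
    by move=> _ /mapP[x xs ->]; apply/iP; exists x.
  exists (w \o h); split=> [x xs|l lr] /=.
    by apply: i_inj; rewrite wE /ev hE // map_f.
  apply: i_inj; rewrite linear0 lc_linear -(h0 l lr).
  by apply: eq_lc => x /=; rewrite wE.
- move=> x; have [|u uE] := (iP (i x)).2; first by exists x.
  by exists u; apply: i_inj; rewrite wE.
- by move=> x; apply: i_inj; rewrite nE wE.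
Qed.

(** The product, over a set of representatives, of the small modules of [X] under
    [N]. *)
Lemma preenveloping_of_products : preenveloping X.
Proof.
move=> N; pose W := sol_term R N.
pose I := {k : seq (R * W) -> Prop | exists S (w : W -> S) (n : {linear N -> S}),
  [/\ X S, surjection w, forall x, n x = w (sol_base R x)
    & (fun l => lc w l = 0) = k]}.
have /choice[S] : forall i : I, exists S (w : W -> S) (n : {linear N -> S}),
  [/\ X S, surjection w, forall x, n x = w (sol_base R x)
    & (fun l => lc w l = 0) = sval i] by move=> i; exact: svalP i.
move=> /dep_choice[w /dep_choice[n SP]].
have [P [pr dP]] := prod_exists S.
have [f fE] := prod_lift n dP.
exists P, f; split; first by apply: X_prod dP _ => i; have [] := SP i.
move=> G f' XG; have [T [v [m [j [XT v_surj mE jm]]]]] := small_pure_submodule f' XG.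
have ex : exists S (w : W -> S) (n : {linear N -> S}),
  [/\ X S, surjection w, forall x, n x = w (sol_base R x)
    & (fun l => lc w l = 0) = (fun l => lc v l = 0)] by exists T, v, m.
pose i : I := exist _ _ ex.
have [_ w_surj nE /= e] := SP i.
have spanw : spans (fun=> True) (w i).
  move=> y; have [u <-] := w_surj y; exists [:: (1, u)]; split=> //.
  by rewrite lc1 scale1r.
have [|g gE] := span_map (p' := v) spanw.
  by move=> l _ l0; rewrite -[_ = _]/((fun l => lc v l = 0) l) -e.
exists (j \o g \o pr i) => x /=; rewrite fE nE -jm mE; congr (j _).
by have := gE [:: (1, sol_base R x)]; rewrite !lc1 !scale1r; apply; split.
Qed.

End Preenvelopes.

Theorem theorem4p3 (R : pzRingType)
    (C : lmodType R -> Prop) (B : lmodType R^c -> Prop) (A : lmodType R -> Prop)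
    (C_iso : iso_closed C) (B_iso : iso_closed B) (A_iso : iso_closed A)
    (C_pure_injective : forall M, C M -> pure_injective M)
    (A_finitely_presented : forall M, A M -> finitely_presented M) :
  [/\
      [/\ covering (left_perp C),
          covering (KerTor1 B)
        & left_coherent R ->
            covering (classI (right_perp A) (left_perp C)) /\
            covering (classI (right_perp A) (KerTor1 B))],
      first_half_of_perfect_cotorsion_pair (KerTor1 B) /\
      (left_coherent R -> right_perp A R^o ->
         first_half_of_perfect_cotorsion_pair
           (classI (right_perp A) (KerTor1 B)))
    &
      preenveloping (right_perp A) /\
      (right_coherent R -> (forall N, B N -> finitely_presented N) ->
         preenveloping (classI (right_perp A) (KerTor1 B)))].
Proof.
have A_sums := right_perp_sums A_finitely_presented.
have A_psub := right_perp_pure_submodules A_finitely_presented.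
have A_prod := @right_perp_products R A.
have C_sums := @left_perp_sums R C.
have C_pquot := left_perp_pure_quotients C_pure_injective.
have B_sums := @KerTor1_sums R B.
have B_pquot := @KerTor1_pure_quotients R B.
have B_ring : KerTor1 B R^o by apply: projective_KerTor1; exact: ring_projective.
split; [split|split|split].
- exact: covering_of_sums_pure_quotients.
- exact: covering_of_sums_pure_quotients.
- move=> coh; have A_pquot := right_perp_pure_quotients A_finitely_presented coh.
  split; apply: covering_of_sums_pure_quotients;
    by [exact: closed_sumsI|exact: closed_pure_quotientsI].
- by apply: first_half_of_closed => //; exact: KerTor1_extensions.
- move=> coh AR; have A_pquot := right_perp_pure_quotients A_finitely_presented coh.
  apply: first_half_of_closed; last by split.
  + exact: closed_sumsI.
  + exact: closed_pure_quotientsI.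
  + by apply: closed_extensionsI; [exact: right_perp_extensions|exact: KerTor1_extensions].
- exact: preenveloping_of_products.
- move=> coh fpB; have [B_prod B_psub] := right_coherent_Tor1 coh fpB.
  apply: preenveloping_of_products.
  + exact: closed_productsI.
  + exact: closed_pure_submodulesI.
Qed.
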